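(* Fix $k\in\mathbb N$ and $q\in(0,\infty)$. For each integer $n\ge k$ let $X^{(n)}$ be a random vector in $\mathbb R^n$ and let $\mathbf A_{n,k}$ be a random $n\times k$ matrix distributed according to the Haar measure on the Stiefel manifold $\mathbb V_{n,k}$, independent of $X^{(n)}$. Suppose that one of the following two assumptions holds for a positive sequence $\{s_n\}$ and a good rate function $J_X:\mathbb R\to[0,\infty]$: (A* ) $s_n=n$ for all $n$, and $\{\|X^{(n)}\|_2/\sqrt n\}_n$ satisfies an LDP in $\mathbb R$ at speed $s_n=n$ with GRF $J_X$; (B) $s_n\to\infty$, $n/s_n\to\infty$, and $\{\sqrt{s_n}\,\|X^{(n)}\|_2/n\}_n$ satisfies an LDP in $\mathbb R$ at speed $s_n$ with GRF $J_X$. Let $Y^n_{q,k}:=\|\mathbf A_{n,k}^TX^{(n)}\|_q$. Then $\{n^{-1/2}Y^n_{q,k}\}_n$ satisfies an LDP at speed $s_n$ with GRF $$\mathbb J_q^{\mathsf{con}}(x)=\inf_{z\in\mathbb R^k}\{I_{\mathbf AX,k}(z):\|z\|_q=x\},\qquad x\in\mathbb R_+=[0,\infty),$$ where $I_{\mathbf AX,k}:\mathbb R^k\to[0,\infty]$ is defined, for $z\in\mathbb R^k$, by $I_{\mathbf AX,k}(z)=\inf_{0<c<1}\{J_X(\|z\|_2/c)-\frac12\log(1-c^2)\}$ if (A* ) holds, and $I_{\mathbf AX,k}(z)=\inf_{c>0}\{J_X(\|z\|_2/c)+\frac{c^2}2\}$ if (B) holds.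
   Context: Stiefel manifold: $\mathbb V_{n,k}=\{A\in\mathbb R^{n\times k}:A^TA=I_k\}$; its Haar measure is the unique probability measure on $\mathbb V_{n,k}$ invariant under orthogonal transformations. $\|z\|_q=(\sum_i|z_i|^q)^{1/q}$ (a quasi-norm if $q<1$). LDP: a sequence of random variables $\{\eta_n\}$ with values in a regular topological space $\mathcal X$ satisfies a large deviation principle (LDP) at speed $s_n$ with rate function $I:\mathcal X\to[0,\infty]$ if $I$ is lower semicontinuous and for every Borel set $\Gamma$, $-\inf_{\Gamma^\circ}I\le\liminf_n\frac1{s_n}\log\mathbb P(\eta_n\in\Gamma)\le\limsup_n\frac1{s_n}\log\mathbb P(\eta_n\in\Gamma)\le-\inf_{\bar\Gamma}I$. It is a good rate function (GRF) if moreover its level sets are compact.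
   Formalization: I_{AX,k}(0) is set to 0 instead of the printed value J_X(0); for J_X(0)>0 the printed rate is not lower semicontinuous at 0 (e.g. ‖X^(n)‖_2=√n, k=1), so the claim as printed fails; for J_X(0)=0 the two formulas agree. *)

(* Defs.v *)
From HB Require Import structures.
From mathcomp Require Import all_boot all_order all_algebra.
From mathcomp Require Import all_classical all_reals all_analysis.

Set Implicit Arguments.
Unset Strict Implicit.
Unset Printing Implicit Defensive.

Import Order.TTheory GRing.Theory Num.Theory.
Import numFieldNormedType.Exports.

Local Open Scope classical_set_scope.
Local Open Scope ring_scope.

Definition borel {X : topologicalType} : set (set X) := <<s @open X >>.

Section large_deviations.
Context {R : realType} {X : topologicalType}.

Definition rate_function (I : X -> \bar R) :=
  (forall x, 0 <= I x)%E /\ lower_semicontinuous I.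

Definition good_rate_function (I : X -> \bar R) :=
  rate_function I /\ forall a : R, compact [set x | (I x <= a%:E)%E].

Context {d : nat -> measure_display} {T : forall n, measurableType (d n)}.

(* Each [eta n] may live on its own probability space. Since [lne 0 = -oo],
   null events contribute [-oo]. *)
Definition ldp (P : forall n, probability (T n) R) (eta : forall n, T n -> X)
    (s : nat -> R) (I : X -> \bar R) :=
  rate_function I /\
  forall G : set X, borel G ->
    let u n := ((s n)^-1%:E * lne (P n (eta n @^-1` G)))%E in
    [/\ (- ereal_inf (I @` G°) <= limn_einf u)%E,
        (limn_einf u <= limn_esup u)%E
      & (limn_esup u <= - ereal_inf (I @` closure G))%E].

Definition ldp_grf (P : forall n, probability (T n) R)
    (eta : forall n, T n -> X) (s : nat -> R) (I : X -> \bar R) :=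
  good_rate_function I /\ ldp P eta s I.

End large_deviations.

Section random_elements.
Context {R : realType} {d : measure_display} {T : measurableType d}.

Definition random_element {X : topologicalType} (f : T -> X) :=
  forall B, borel B -> measurable (f @^-1` B).

Definition independent_elements {X Y : topologicalType}
    (P : probability T R) (f : T -> X) (g : T -> Y) :=
  forall B C, borel B -> borel C ->
    P (f @^-1` B `&` g @^-1` C) = (P (f @^-1` B) * P (g @^-1` C))%E.

Definition stiefel (n k : nat) : set 'M[R]_(n, k) :=
  [set A | A^T *m A = 1%:M].

(* The law of [A] is carried by the Stiefel manifold and is invariant under
   the action [A |-> Q *m A] of the orthogonal group O(n); these properties
   determine the law. *)
Definition haar_stiefel (P : probability T R) (n k : nat)
    (A : T -> 'M[R]_(n, k)) :=
  P (A @^-1` @stiefel n k) = 1%E /\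
  forall Q : 'M[R]_n, Q^T *m Q = 1%:M ->
  forall B, borel B -> P ((fun w => Q *m A w) @^-1` B) = P (A @^-1` B).

End random_elements.

Section rates.
Context {R : realType}.

Definition qnorm (q : R) (n : nat) (z : 'cV[R]_n) : R :=
  (\sum_(i < n) `|z i 0| `^ q) `^ q^-1.

(* Both rates at [z = 0]: for [z != 0] the infimum below minimises
   [JX r + (cost of u)] over [r] and [u] with [r *: u = z] and [c] the Euclidean
   norm of [u]. For [z = 0] this constrained minimum is [inf JX + 0 = 0]
   (take [u = 0]), whereas the infimum over [c] alone would be [JX 0], which
   breaks lower semicontinuity at the origin unless [JX 0 = 0]. *)
Definition rate_AX_A (JX : R -> \bar R) (k : nat) (z : 'cV[R]_k) : \bar R :=
  if z == 0 then 0%E else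
  ereal_inf [set (JX (qnorm 2 z / c)%R - (2^-1 * ln (1 - c ^+ 2))%:E)%E
            | c in [set c : R | 0 < c < 1]].

Definition rate_AX_B (JX : R -> \bar R) (k : nat) (z : 'cV[R]_k) : \bar R :=
  if z == 0 then 0%E else
  ereal_inf [set (JX (qnorm 2 z / c)%R + (c ^+ 2 / 2)%:E)%E
            | c in [set c : R | 0 < c]].

(* The half-line [0, +oo[, with the topology induced by [R]. *)
Definition Rplus : set R := [set x | 0 <= x].

Definition rate_con (q : R) (k : nat) (I : 'cV[R]_k -> \bar R)
    (x : Rplus) : \bar R :=
  ereal_inf [set I z | z in [set z | qnorm q z = set_val x]].

Lemma scaled_qnorm_ge0 (q : R) (n k : nat) (z : 'cV[R]_k) :
  Rplus ((Num.sqrt n%:R)^-1 * qnorm q z).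
Proof. by rewrite /Rplus /= mulr_ge0 ?invr_ge0 ?sqrtr_ge0 ?powR_ge0. Qed.

Definition scaled_qnorm (q : R) (n k : nat) (z : 'cV[R]_k) : Rplus :=
  SigSub (mem_set (scaled_qnorm_ge0 q n z)).

End rates.

Section assumptions.
Context {R : realType} {d : nat -> measure_display}.
Context {T : forall n, measurableType (d n)}.

Definition assumption_A (k : nat) (P : forall n, probability (T n) R)
    (X : forall n, T n -> 'cV[R]_n) (s : nat -> R) (JX : R -> \bar R) :=
  (forall n, (k <= n)%N -> s n = n%:R) /\
  ldp_grf P (fun n w => qnorm 2 (X n w) / Num.sqrt n%:R) s JX.

Definition assumption_B (P : forall n, probability (T n) R)
    (X : forall n, T n -> 'cV[R]_n) (s : nat -> R) (JX : R -> \bar R) :=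
  [/\ s n @[n --> \oo] --> +oo,
      (n%:R / s n : R) @[n --> \oo] --> +oo
    & ldp_grf P (fun n w => Num.sqrt (s n) * qnorm 2 (X n w) / n%:R) s JX].

End assumptions.

(* Main.v *)
(* By the invariance of the Haar measure, A^T X = |X| u, where u has the law of
   the first row of A and is independent of X. The squared norm z of the first
   row (or, for the lower bound, of its component along a fixed direction, which
   is the case k = 1) satisfies Stein's identity
     E [2 z (1 - z) f'(z) + (k - n z) f(z)] = 0,
   obtained by differentiating the invariance along plane rotations. The test
   functions (1 + eta - z)^-j and (w - z)_+^2 (1 - z)^-j give two-sided
   exponential bounds on the tails of z, hence the costs -ln(1 - c^2)/2 and
   c^2/2 for |u| to be c (respectively c sqrt(s_n / n)).
   If th maximises ||.||_q on the unit sphere and M = ||th||_q, then ||u||_q has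
   at scale M the same cost as |u|: the bound ||u||_q <= M |u| is sharp when u is
   a multiple of th. The theorem is then the large deviation principle for the
   product of the independent variables |X| and ||u||_q. *)

Require Import Defs.
From mathcomp Require Import all_boot all_order all_algebra.
From mathcomp Require Import all_classical all_reals all_analysis measurable_realfun.
From mathcomp Require Import ring lra.

Set Implicit Arguments.
Unset Strict Implicit.
Unset Printing Implicit Defensive.

Import Order.TTheory GRing.Theory Num.Theory.
Import numFieldNormedType.Exports.

Local Open Scope classical_set_scope.
Local Open Scope ring_scope.

(** * Borel sets and bounded integrands *)

(** Stein's identity is that of the law Beta(k/2, (n-k)/2); using it avoids every computation with
    densities, Gamma functions or surface measures. The obstacle in the lower bound is that a bound
    on |u| alone does not control ||u||_q, which is close to M |u| only when u points near [th] or
    its opposite. So the component of u along [th] is confined to a thin band, and the event that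
    |u| is noticeably larger than the band allows is subtracted. That event is exponentially rarer
    because the cost increases strictly, and on what remains u is close to a multiple of [th]. Both
    regimes share one argument, with an abstract cost [kappa] and a scale [r]: |u| deviates at size
    sqrt(r n), where r n is 1 or s n / n. An LDP for ||u||_q is never stated. Since the cost is
    monotone, tail estimates from above and estimates of small intervals from below suffice for the
    product. The rate is handled through the identity behind the choice of [th]: among all z with a
    given q-norm, multiples of [th] are the cheapest, so the infimum over vectors reduces to one
    over pairs (r, c) of numbers. *)

Section borel_sets.

Lemma borel_measurableE (R : realType) (B : set R) : borel B <-> measurable B.
Proof.
split.
  apply: smallest_sub; first exact: sigma_algebra_measurable.
  by move=> U; exact: open_measurable.
suff: (@RGenOpens.G R).-sigma.-measurable `<=` borel.
  by rewrite -RGenOpens.measurableE; apply.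
apply: smallest_sub; first exact: smallest_sigma_algebra.
by move=> _ [x [y ->]]; apply: sub_sigma_algebra; exact: interval_open.
Qed.

Lemma borel_preimage (X Y : topologicalType) (f : X -> Y) (B : set Y) :
  continuous f -> borel B -> borel (f @^-1` B).
Proof.
move=> cf; suff: borel `<=` [set B | borel (f @^-1` B)] by apply.
apply: smallest_sub; last first.
  by move=> U oU; apply: sub_sigma_algebra; exact: open_comp.
split=> /=.
- by rewrite preimage_set0; exact: sigma_algebra0.
- move=> A bA; rewrite setTD preimage_setC -setTD; exact: sigma_algebraCD.
- by move=> F bF; rewrite preimage_bigcup; exact: sigma_algebra_bigcup.
Qed.

Context {R : realType} {d : measure_display} {T : measurableType d}.

Lemma random_element_comp (X Y : topologicalType) (f : X -> Y) (g : T -> X) :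
  continuous f -> random_element g -> random_element (f \o g).
Proof.
by move=> cf rg B bB; rewrite comp_preimage; apply: rg; exact: borel_preimage.
Qed.

Lemma random_elementP (f : T -> R) :
  random_element f <-> measurable_fun [set: T] f.
Proof.
split=> [rf _ B /borel_measurableE bB|mf B /borel_measurableE mB].
  by rewrite setTI; exact: rf.
by rewrite -[X in measurable X]setTI; exact: mf.
Qed.

Lemma measurable_coord (m n : nat) (f : T -> 'M[R]_(m, n)) i j :
  random_element f -> measurable_fun [set: T] (fun w => f w i j).
Proof.
move=> rf; apply/random_elementP.
exact: (random_element_comp (@coord_continuous R m n i j) rf).
Qed.

Lemma measurable_borel_preimage (m n : nat) (h : 'M[R]_(m, n) -> R) (B : set R) :
  measurable_fun [set: g_sigma_algebraType (@open 'M[R]_(m, n))] h ->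
  measurable B -> borel (h @^-1` B).
Proof. by move=> mh mB; have := mh measurableT B mB; rewrite setTI. Qed.

Lemma measurable_coord_id (m n : nat) i j :
  measurable_fun [set: g_sigma_algebraType (@open 'M[R]_(m, n))]
    (fun M : 'M[R]_(m, n) => M i j).
Proof.
move=> _ B /borel_measurableE bB; rewrite setTI.
by apply: (borel_preimage (@coord_continuous R m n i j)) => //.
Qed.

End borel_sets.

Section bounded_integrable.
Context {R : realType} {d : measure_display} {T : measurableType d}.

Lemma bounded_integrable (P : probability T R) (D : set T) (f : T -> R) (K : R) :
  measurable D -> measurable_fun D f -> (forall x, D x -> `|f x| <= K) ->
  P.-integrable D (EFin \o f).
Proof.
move=> mD mf fK; apply: measurable_bounded_integrable => //.
  by rewrite (le_lt_trans (probability_le1 P mD))// ltry.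
exists K; split; first exact: num_real.
by move=> M KM x Dx /=; rewrite (le_trans (fK x Dx))// ltW.
Qed.

End bounded_integrable.

Section matrix_measurability.
Context {R : realType} (n k : nat).
Local Notation mxT := (g_sigma_algebraType (@open 'M[R]_(n, k))).

(** Entries of the Gram matrix of the rows. The diagonal entry at i is the squared norm of row i,
    the variable z of the overview. *)
Definition row_dot (M : 'M[R]_(n, k)) (i j : 'I_n) : R :=
  \sum_l M i l * M j l.

Lemma row_dotE M i j : row_dot M i j = (M *m M^T) i j.
Proof. by rewrite mxE; apply: eq_bigr => l _; rewrite mxE. Qed.

Lemma row_dotC M i j : row_dot M i j = row_dot M j i.
Proof. by apply: eq_bigr => l _; rewrite mulrC. Qed.

Lemma measurable_row_dot i j :
  measurable_fun [set: mxT] (fun M : 'M[R]_(n, k) => row_dot M i j).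
Proof.
apply: measurable_sum => l; apply: measurable_funM; exact: measurable_coord_id.
Qed.

Lemma borel_stiefel : borel (@stiefel R n k).
Proof.
(* The matrix equation becomes the vanishing of one real function, whose measurability is that of a
   polynomial in the entries. *)
pose h (M : 'M[R]_(n, k)) : R := \sum_i \sum_j ((M^T *m M) i j - (i == j)%:R) ^+ 2.
have -> : @stiefel R n k = h @^-1` [set 0].
  apply/seteqP; split=> M /=; rewrite /stiefel /h /=.
    move=> ->; rewrite big1// => i _; rewrite big1// => j _.
    by rewrite mxE subrr expr0n.
  move=> /psumr_eq0P hM; apply/matrixP => i j; rewrite [RHS]mxE.
  have /psumr_eq0P/(_ j isT)/eqP := hM (fun i _ => sumr_ge0 _ (fun j _ => sqr_ge0 _)) i isT.
  by rewrite sqrf_eq0 subr_eq0 => /(_ (fun j _ => sqr_ge0 _))/eqP.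
apply: measurable_borel_preimage => //.
apply: measurable_sum => i; apply: measurable_sum => j.
apply: measurable_funX; apply: measurable_funB => //.
have -> : (fun M : mxT => (M^T *m M) i j) = (fun M : mxT => \sum_l M l i * M l j).
  by apply/funext => M; rewrite mxE; apply: eq_bigr => l _; rewrite mxE.
apply: measurable_sum => l; apply: measurable_funM; exact: measurable_coord_id.
Qed.

Lemma measurable_random_comp d (T : measurableType d) (A : T -> 'M[R]_(n, k))
    (h : 'M[R]_(n, k) -> R) :
  measurable_fun [set: mxT] h -> random_element A ->
  measurable_fun [set: T] (h \o A).
Proof.
move=> mh rA _ B mB; rewrite setTI comp_preimage; apply: rA.
exact: measurable_borel_preimage.
Qed.

End matrix_measurability.

(** * Gram matrix of the rows on the Stiefel manifold *)

Section stiefel_rows.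
Context {R : realType} (n k : nat) (M : 'M[R]_(n, k)).
Hypothesis stM : stiefel M.

Lemma row_dot_ge0 i : 0 <= row_dot M i i.
Proof. by apply: sumr_ge0 => l _; rewrite -expr2 sqr_ge0. Qed.

(* [M *m M^T] is a symmetric idempotent matrix. *)
Lemma sum_sqr_row_dot i : \sum_j row_dot M i j ^+ 2 = row_dot M i i.
Proof.
transitivity ((M *m M^T *m (M *m M^T)) i i).
  rewrite [RHS]mxE; apply: eq_bigr => j _.
  by rewrite expr2 {2}row_dotC !row_dotE.
by rewrite mulmxA -(mulmxA M) stM mulmx1 row_dotE.
Qed.

Lemma sum_row_dot : \sum_j row_dot M j j = k%:R.
Proof.
under eq_bigr do rewrite row_dotE.
by rewrite -[LHS]/(\tr _) mxtrace_mulC stM mxtrace1.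
Qed.

(** By idempotence the diagonal entry z equals a sum of squares containing z^2, so z^2 <= z. *)
Lemma row_dot_le1 i : row_dot M i i <= 1.
Proof.
have [->|nz] := eqVneq (row_dot M i i) 0; first exact: ler01.
have gt0 : 0 < row_dot M i i by rewrite lt_def nz row_dot_ge0.
rewrite -(ler_pM2l gt0) mulr1 -expr2 -[leRHS]sum_sqr_row_dot.
by rewrite (bigD1 i)//= lerDl sumr_ge0// => j _; exact: sqr_ge0.
Qed.

Lemma normr_row_dot_le1 i j : `|row_dot M i j| <= 1.
Proof.
rewrite -(@ler_pXn2r _ 2)// ?nnegrE// expr1n real_normK ?num_real//.
rewrite (le_trans _ (row_dot_le1 i))// -sum_sqr_row_dot.
by rewrite (bigD1 j)//= lerDl sumr_ge0// => l _; exact: sqr_ge0.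
Qed.

End stiefel_rows.

(** * Rotations in a coordinate plane *)

Section plane_rotation.
Context {R : realType} (n : nat) (i0 i : 'I_n) (i0i : i0 != i).

(** Written with the projection [D] on the plane and the quarter turn [J], which satisfies J^2 = -D;
    orthogonality then reduces to cos^2 + sin^2 = 1. *)
Definition plane_rot (t : R) : 'M[R]_n :=
  1%:M + (cos t - 1) *: (delta_mx i0 i0 + delta_mx i i)
       + sin t *: (delta_mx i0 i - delta_mx i i0).

Let D : 'M[R]_n := delta_mx i0 i0 + delta_mx i i.
Let J : 'M[R]_n := delta_mx i0 i - delta_mx i i0.

Lemma plane_rot_orthogonal t : (plane_rot t)^T *m plane_rot t = 1%:M.
Proof.
have ii0 : i != i0 by rewrite eq_sym.
have DD : D *m D = D.
  by rewrite /D mulmxDl !mulmxDr !mul_delta_mx_cond !eqxx (negbTE i0i)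
     (negbTE ii0) !mulr0n !mulr1n addr0 add0r.
have JJ : J *m J = - D.
  by rewrite /J /D mulmxBl !mulmxBr !mul_delta_mx_cond !eqxx (negbTE i0i)
     (negbTE ii0) !mulr0n !mulr1n subr0 !sub0r opprD.
have DJ : D *m J = J.
  by rewrite /J /D mulmxDl !mulmxBr !mul_delta_mx_cond !eqxx (negbTE i0i)
     (negbTE ii0) !mulr0n !mulr1n subr0 sub0r.
have JD : J *m D = J.
  by rewrite /J /D mulmxBl !mulmxDr !mul_delta_mx_cond !eqxx (negbTE i0i)
     (negbTE ii0) !mulr0n !mulr1n addr0 add0r.
have -> : (plane_rot t)^T = 1%:M + (cos t - 1) *: D - sin t *: J.
  apply/matrixP => a b; rewrite !mxE (eq_sym b a) ![(b == _) && _]andbC.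
  by ring.
rewrite /plane_rot -/D -/J mulmxBl mulmxDl mul1mx -!scalemxAl !mulmxDr mulmx1.
rewrite -!scalemxAr mulmx1 DD JJ DJ JD.
move: (D) (J) {DD JJ DJ JD} => D' J'; apply/matrixP => a b; rewrite !mxE.
have /eqP := cos2Dsin2 t; rewrite -subr_eq0 => /eqP cs.
by apply/eqP; rewrite -subr_eq0 -[X in _ == X](mulr0 (D' a b)) -{1}cs; apply/eqP; ring.
Qed.

(** As functions of t, the first expression has twice the second as its derivative. This is why f(Z)
    times the mixed product is the right quantity to differentiate. *)
Lemma row_dot_plane_rot t k (M : 'M[R]_(n, k)) :
  row_dot (plane_rot t *m M) i0 i0 = cos t ^+ 2 * row_dot M i0 i0
    + 2 * cos t * sin t * row_dot M i0 i + sin t ^+ 2 * row_dot M i i /\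
  row_dot (plane_rot t *m M) i0 i =
    (cos t ^+ 2 - sin t ^+ 2) * row_dot M i0 i
    + cos t * sin t * (row_dot M i i - row_dot M i0 i0).
Proof.
have ii0 : i != i0 by rewrite eq_sym.
have E a l : (plane_rot t *m M) a l = M a l
    + (cos t - 1) * ((a == i0)%:R * M i0 l + (a == i)%:R * M i l)
    + sin t * ((a == i0)%:R * M i l - (a == i)%:R * M i0 l).
  have dE (b c : 'I_n) : (delta_mx b c *m M) a l = (a == b)%:R * M c l.
    rewrite mxE (bigD1 c)//= big1 ?addr0 => [|e ec]; first by rewrite mxE eqxx andbT.
    by rewrite mxE (negbTE ec) andbF mul0r.
  rewrite /plane_rot !mulmxDl mul1mx -!scalemxAl mulmxBl mulmxDl !mxE.
  by rewrite -!dE !mxE.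
have E0 l : (plane_rot t *m M) i0 l = cos t * M i0 l + sin t * M i l.
  by rewrite E eqxx (negbTE i0i) /=; ring.
have Ei l : (plane_rot t *m M) i l = cos t * M i l - sin t * M i0 l.
  by rewrite E eqxx (negbTE ii0) /=; ring.
rewrite /row_dot; split.
  rewrite !mulr_sumr -!big_split/=; apply: eq_bigr => l _.
  by rewrite E0; ring.
rewrite -sumrB !mulr_sumr -!big_split/=; apply: eq_bigr => l _.
by rewrite E0 Ei; ring.
Qed.

Lemma plane_rot_stiefel t k (M : 'M[R]_(n, k)) :
  stiefel (plane_rot t *m M) <-> stiefel M.
Proof.
by rewrite /stiefel /= trmx_mul mulmxA -(mulmxA M^T) plane_rot_orthogonal mulmx1.
Qed.

End plane_rotation.

(** * Stein's identity for the Haar measure *)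

Section same_law.
Context {R : realType} {d : measure_display} {T : measurableType d}.

Lemma eq_law_Rintegral (P : probability T R) (f g : T -> R) (K : R) :
  measurable_fun [set: T] f -> measurable_fun [set: T] g ->
  (forall x, `|f x| <= K) -> (forall x, `|g x| <= K) ->
  (forall B : set R, measurable B -> P (f @^-1` B) = P (g @^-1` B)) ->
  \int[P]_x f x = \int[P]_x g x.
Proof.
move=> mf mg fK gK law; rewrite /Rintegral; congr fine.
have push (h : T -> R) : measurable_fun [set: T] h -> (forall x, `|h x| <= K) ->
    (\int[P]_x (h x)%:E = \int[pushforward P h]_y (y%:E))%E.
  move=> mh hK; rewrite integral_pushforward//=.
  rewrite preimage_setT.
  exact: (@bounded_integrable _ _ _ _ _ h K).
by rewrite !push//; apply: eq_measure_integral => B mB _; exact: law.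
Qed.

End same_law.

Section stein.
Context {R : realType} {d : measure_display} {T : measurableType d}.
Context (P : probability T R) (n k : nat) (A : T -> 'M[R]_(n, k)).
Hypothesis rA : random_element A.
Hypothesis hA : haar_stiefel P A.
Local Notation mxT := (g_sigma_algebraType (@open 'M[R]_(n, k))).
Local Notation S := (A @^-1` @stiefel R n k).

Let mS : measurable S.
Proof. by apply: rA; exact: borel_stiefel. Qed.

Let mAh (h : 'M[R]_(n, k) -> R) :
  measurable_fun [set: mxT] h -> measurable_fun [set: T] (h \o A).
Proof. by move=> mh; exact: measurable_random_comp. Qed.

Let mrow i j D : measurable_fun D (fun w => row_dot (A w) i j).
Proof.
apply: measurable_funTS.
by apply: (mAh (h := fun M => row_dot M i j)); exact: measurable_row_dot.
Qed.

Let mcrow (c : R) i j D : measurable_fun D (fun w => c * row_dot (A w) i j).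
Proof. by apply: measurable_funM; [exact: measurable_cst|exact: mrow]. Qed.

Variables (f f' : R -> R) (K : R).
Hypothesis mf : measurable_fun [set: R] f.
Hypothesis mf' : measurable_fun [set: R] f'.
Hypothesis df : forall z : R, 0 <= z <= 1 -> is_derive z 1 f (f' z).
Hypothesis fK : forall z : R, 0 <= z <= 1 -> `|f z| <= K.
Hypothesis f'K : forall z : R, 0 <= z <= 1 -> `|f' z| <= K.

Let K_ge0 : 0 <= K.
Proof. by rewrite (le_trans _ (fK (z := 0) _))// ?lexx ?ler01. Qed.

Let Z w i := row_dot (A w) i i.

Let Z01 w i : S w -> 0 <= Z w i <= 1.
Proof. by move=> Sw; rewrite /Z row_dot_ge0 row_dot_le1. Qed.

Section plane.
Variables (i0 i : 'I_n).
Hypothesis i0i : i0 != i.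

Let g (M : 'M[R]_(n, k)) := f (row_dot M i0 i0) * row_dot M i0 i.

Let rot_invariant t : \int[P]_(w in S) g (plane_rot i0 i t *m A w) =
  \int[P]_(w in S) g (A w).
Proof.
rewrite Rintegral_mkcond [RHS]Rintegral_mkcond.
(* Extension by zero off the manifold makes the integrand bounded everywhere, so that equality of
   laws applies; rotations preserve the manifold, hence the extension. *)
pose h : 'M[R]_(n, k) -> R := g \_ (@stiefel R n k).
have E1 : ((fun w => g (plane_rot i0 i t *m A w)) \_ S) = h \o (fun w => plane_rot i0 i t *m A w).
  apply/funext => w; rewrite /h /= !patchE.
  have [Sw|nSw] := pselect (S w).
    by rewrite !mem_set//; apply/(plane_rot_stiefel i0i).
  by rewrite !memNset// => /(plane_rot_stiefel i0i).
have E2 : ((fun w => g (A w)) \_ S) = h \o A.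
  apply/funext => w; rewrite /h /= !patchE.
  by have [Sw|nSw] := pselect (S w); [rewrite !mem_set|rewrite !memNset].
have mh : measurable_fun [set: mxT] h.
  have [+ _] := @measurable_restrictT _ _ mxT R (@stiefel R n k) g
    (@borel_stiefel R n k).
  apply; apply: measurable_funTS; apply: measurable_funM; last exact: measurable_row_dot.
  by apply: measurableT_comp => //; exact: measurable_row_dot.
have hK M : `|h M| <= K.
  rewrite /h patchE; case: ifPn => [/set_mem sM|_]; last by rewrite normr0.
  rewrite /g normrM -[leRHS]mulr1 ler_pM//; last exact: normr_row_dot_le1.
  by apply: fK; rewrite row_dot_ge0 row_dot_le1.
have mrot : measurable_fun [set: T] (h \o (fun w => plane_rot i0 i t *m A w)).
  rewrite -E1; apply: (measurable_restrictT _ mS).1; apply: measurable_funTS.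
  have -> : (fun w => g (plane_rot i0 i t *m A w)) = fun w =>
      f (cos t ^+ 2 * Z w i0 + 2 * cos t * sin t * row_dot (A w) i0 i
         + sin t ^+ 2 * Z w i)
      * ((cos t ^+ 2 - sin t ^+ 2) * row_dot (A w) i0 i
         + cos t * sin t * (Z w i - Z w i0)).
    apply/funext => w; rewrite /g.
    by have [-> ->] := row_dot_plane_rot i0i t (A w).
  apply: measurable_funM.
    apply: (measurableT_comp mf).
    apply: measurable_funD; first apply: measurable_funD.
    - exact: mcrow.
    - exact: mcrow.
    - exact: mcrow.
  apply: measurable_funD.
    exact: mcrow.
  apply: measurable_funM; first exact: measurable_cst.
  by apply: measurable_funB; exact: mrow.
rewrite E1 E2; apply: (@eq_law_Rintegral _ _ _ _ _ _ K) => //.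
- exact: mAh.
- by move=> w; exact: hK.
- by move=> w; exact: hK.
move=> B mB; have := hA.2 (plane_rot i0 i t) (plane_rot_orthogonal i0i t) (h @^-1` B).
by apply; exact: measurable_borel_preimage.
Qed.

Let phi (p b r t : R) := f (cos t ^+ 2 * p + 2 * cos t * sin t * b + sin t ^+ 2 * r)
  * ((cos t ^+ 2 - sin t ^+ 2) * b + cos t * sin t * (r - p)).

Let phi' (p b r t : R) :=
  let z := cos t ^+ 2 * p + 2 * cos t * sin t * b + sin t ^+ 2 * r in
  let w := (cos t ^+ 2 - sin t ^+ 2) * b + cos t * sin t * (r - p) in
  2 * f' z * w ^+ 2 + f z * ((cos t ^+ 2 - sin t ^+ 2) * (r - p) - 4 * cos t * sin t * b).

Let is_derive_phi p b r t :
  0 <= cos t ^+ 2 * p + 2 * cos t * sin t * b + sin t ^+ 2 * r <= 1 ->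
  is_derive t 1 (phi p b r) (phi' p b r t).
Proof.
move=> z01.
pose zf : R -> R := (cos * cos) * cst p + cos * sin * cst (2 * b) + (sin * sin) * cst r.
pose wf : R -> R := (cos * cos - sin * sin) * cst b + cos * sin * cst (r - p).
have -> : phi p b r = (f \o zf) * wf.
  by apply/funext => u; rewrite /phi /zf /wf !fctE/=; congr (f _ * _); ring.
have dcos := is_derive_cos t; have dsin := is_derive_sin t.
have dcst (a : R) : is_derive t 1 (cst a : R -> R) 0 := is_derive_cst a t 1.
have dz : is_derive t 1 zf (2 * wf t).
  apply: (is_derive_eq (is_deriveD (is_deriveD
    (is_deriveM (is_deriveM dcos dcos) (dcst p))
    (is_deriveM (is_deriveM dcos dsin) (dcst (2 * b))))
    (is_deriveM (is_deriveM dsin dsin) (dcst r)))).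
  by rewrite /wf !fctE /GRing.scale/=; ring.
have dw : is_derive t 1 wf ((cos t ^+ 2 - sin t ^+ 2) * (r - p) - 4 * cos t * sin t * b).
  apply: (is_derive_eq (is_deriveD
    (is_deriveM (is_deriveB (is_deriveM dcos dcos) (is_deriveM dsin dsin)) (dcst b))
    (is_deriveM (is_deriveM dcos dsin) (dcst (r - p))))).
  by rewrite !fctE /GRing.scale/=; ring.
have zE : cos t ^+ 2 * p + 2 * cos t * sin t * b + sin t ^+ 2 * r = zf t.
  by rewrite /zf !fctE/=; ring.
have wE : (cos t ^+ 2 - sin t ^+ 2) * b + cos t * sin t * (r - p) = wf t.
  by rewrite /wf !fctE/=; ring.
have dfz : is_derive (zf t) 1 f (f' (zf t)) by apply: df; rewrite -zE.
have dc := is_derive1_comp dfz dz.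
apply: is_derive_eq; rewrite /phi' zE wE /GRing.scale/=; ring.
Qed.

(* The expectation of [f(Z_t) * W_t] does not depend on the angle [t] of the
   rotation of the rows [i0] and [i]; differentiate it at [t = 0]. *)
Lemma plane_stein : \int[P]_(w in S)
  (2 * f' (Z w i0) * row_dot (A w) i0 i ^+ 2 + f (Z w i0) * (Z w i - Z w i0)) = 0.
Proof.
pose F (t : R) w := phi (Z w i0) (row_dot (A w) i0 i) (Z w i) t.
have FE t w : F t w = g (plane_rot i0 i t *m A w).
  by rewrite /F /phi /g; have [-> ->] := row_dot_plane_rot i0i t (A w).
have zin t w : S w -> 0 <= cos t ^+ 2 * Z w i0 + 2 * cos t * sin t * row_dot (A w) i0 i
    + sin t ^+ 2 * Z w i <= 1.
  move=> Sw; have [<- _] := row_dot_plane_rot i0i t (A w).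
  have sQ : stiefel (plane_rot i0 i t *m A w) by apply/(plane_rot_stiefel i0i).
  by rewrite row_dot_ge0 row_dot_le1.
have win t w : S w -> `|(cos t ^+ 2 - sin t ^+ 2) * row_dot (A w) i0 i
    + cos t * sin t * (Z w i - Z w i0)| <= 1.
  move=> Sw; have [_ <-] := row_dot_plane_rot i0i t (A w).
  have sQ : stiefel (plane_rot i0 i t *m A w) by apply/(plane_rot_stiefel i0i).
  exact: normr_row_dot_le1.
have dF (t : R) w : S w -> is_derive t 1 (F ^~ w)
    (phi' (Z w i0) (row_dot (A w) i0 i) (Z w i) t).
  by move=> Sw; apply: is_derive_phi; exact: zin.
have mF t : measurable_fun [set: T] (F t).
  rewrite /F /phi; apply: measurable_funM.
    apply: (measurableT_comp mf).
    apply: measurable_funD; first apply: measurable_funD.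
    - exact: mcrow.
    - exact: mcrow.
    - exact: mcrow.
  apply: measurable_funD.
    exact: mcrow.
  apply: measurable_funM; first exact: measurable_cst.
  by apply: measurable_funB; exact: mrow.
have FK t w : S w -> `|F t w| <= K.
  move=> Sw; rewrite /F /phi normrM -[leRHS]mulr1 ler_pM//; last exact: win.
  by apply: fK; exact: zin.
(* Uniform in t, as differentiation under the integral requires: 2 K for the term in f', and (2 + 4)
   K for f times the derivative of the mixed product. *)
have dFK t w : S w -> `|partial1of2 F t w| <= K * 8.
  move=> Sw; rewrite partial1of2E (@derive_val _ _ _ _ _ _ _ (dF t w Sw)).
  rewrite /phi'; set z := (X in f' X); set y := (X in X ^+ 2).
  have fz : `|f z| <= K by apply: fK; exact: zin.
  have f'z : `|f' z| <= K by apply: f'K; exact: zin.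
  have y1 : `|y| <= 1 by exact: win.
  have b1 : `|row_dot (A w) i0 i| <= 1 by exact: normr_row_dot_le1.
  have := Z01 i0 Sw; have := Z01 i Sw => /andP[Zi0 Zi1] /andP[Z00 Z01'].
  have cs := cos2Dsin2 t.
  rewrite (le_trans (ler_normD _ _))// (_ : K * 8 = K * 2 + K * 6); last by ring.
  apply: lerD.
    rewrite normrM normrX normrM (ger0_norm (x := 2))// (mulrC 2) -mulrA.
    apply: ler_pM => //; rewrite ?mulr_ge0 ?exprn_ge0//.
    by rewrite -[leRHS]mulr1 ler_pM ?exprn_ge0// exprn_ile1.
  rewrite normrM; apply: ler_pM => //.
  have s2 := sqr_ge0 (sin t); have c2 := sqr_ge0 (cos t).
  have cb : `|4 * cos t * sin t * row_dot (A w) i0 i| <= 4.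
    rewrite -!mulrA normrM (ger0_norm (x := 4))// -[leRHS]mulr1 ler_pM// mulrA normrM.
    rewrite -[leRHS]mulr1 ler_pM// ler_norml; apply/andP; split; nra.
  apply: (le_trans (ler_normB _ _)); rewrite (_ : 6 = 2 + 4 :> R); last by ring.
  apply: lerD => //; rewrite normrM (_ : 2 = 2 * 1 :> R); last by rewrite mulr1.
  by apply: ler_pM => //; rewrite ler_norml; apply/andP; split; nra.
have intF t : P.-integrable S (EFin \o F t).
  by apply: (bounded_integrable _ mS _ (FK t)); exact: measurable_funTS.
have I0 : `]-1, 1[%classic (0 : R) by rewrite /= in_itv/= ltrN10 ltr01.
have K8 (w : T) : 0 <= cst (K * 8) w by rewrite /= mulr_ge0.
have iK : P.-integrable S (EFin \o cst (K * 8)).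
  by apply: (@bounded_integrable _ _ _ _ _ _ `|K * 8|) => //; exact: measurable_cst.
have := differentiation_under_integral mS I0 (fun t _ => intF t)
  (fun t w _ Sw => @ex_derive _ _ _ _ _ _ _ (dF t w Sw)) K8 iK (fun t w _ => @dFK t w).
rewrite (_ : (fun t => \int[P]_(w in S) F t w) = cst (\int[P]_(w in S) g (A w))); last first.
  apply/funext => t /=; rewrite -(rot_invariant t); apply: eq_Rintegral => w _.
  exact: FE.
rewrite derive1_cst => E; rewrite [RHS]E.
apply: eq_Rintegral => w /set_mem Sw.
rewrite partial1of2E (@derive_val _ _ _ _ _ _ _ (dF 0 w Sw)) /phi' cos0 sin0.
by rewrite !(expr1n, expr0n, mul0r, mulr0, mul1r, mulr1, subr0, addr0, add0r).
Qed.

End plane.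

(** Sum [plane_stein] over all rows i other than i0. Idempotence gives Z - Z^2 for the sum of the
    squared mixed products, and the trace k gives k - n Z for the sum of the differences. *)
Lemma stein_haar (i0 : 'I_n) : \int[P]_(w in S)
  (2 * Z w i0 * (1 - Z w i0) * f' (Z w i0) + (k%:R - n%:R * Z w i0) * f (Z w i0)) = 0.
Proof.
pose G i w := 2 * f' (Z w i0) * row_dot (A w) i0 i ^+ 2 + f (Z w i0) * (Z w i - Z w i0).
have mG i : measurable_fun S (G i).
  apply: measurable_funTS; apply: measurable_funD; apply: measurable_funM.
  - apply: measurable_funM; first exact: measurable_cst.
    by apply: measurableT_comp => //; exact: mrow.
  - by apply: measurable_funX; exact: mrow.
  - by apply: measurableT_comp => //; exact: mrow.
  - by apply: measurable_funB; exact: mrow.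
have GK i w : S w -> `|G i w| <= K * 3.
  move=> Sw; have f1 := fK (Z01 i0 Sw); have f2 := f'K (Z01 i0 Sw).
  have b1 : `|row_dot (A w) i0 i| <= 1 by exact: normr_row_dot_le1.
  have := Z01 i0 Sw; have := Z01 i Sw => /andP[Zi0 Zi1] /andP[Z00 Z01'].
  rewrite (le_trans (ler_normD _ _))// (_ : K * 3 = K * 2 + K); last by ring.
  apply: lerD.
    rewrite normrM normrX normrM (ger0_norm (x := 2))// (mulrC 2) -mulrA.
    apply: ler_pM => //; rewrite ?mulr_ge0 ?exprn_ge0//.
    by rewrite -[leRHS]mulr1 ler_pM ?exprn_ge0// exprn_ile1.
  rewrite normrM -[leRHS]mulr1; apply: ler_pM => //.
  by rewrite ler_norml; apply/andP; split; lra.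
have intG i : P.-integrable S (EFin \o G i) by exact: (bounded_integrable _ mS (mG i) (GK i)).
transitivity (\int[P]_(w in S) (\sum_(i | i != i0) G i w)).
  apply: eq_Rintegral => w /set_mem Sw.
  have /eqP := sum_sqr_row_dot Sw i0; rewrite (bigD1 i0)//= eq_sym addrC -subr_eq => /eqP E1.
  have /eqP := sum_row_dot Sw; rewrite (bigD1 i0)//= eq_sym addrC -subr_eq => /eqP E2.
  rewrite big_split/= -!mulr_sumr -E1 sumrB -E2 sumr_const.
  have -> : #|[pred i | i != i0]| = n.-1.
    by rewrite cardC1 card_ord.
  have -> : n%:R = n.-1%:R + 1 :> R by rewrite natr1 (ltn_predK (ltn_ord i0)).
  by rewrite -/(Z w i0) -mulr_natl; ring.
suff sumG : forall s : seq 'I_n, \int[P]_(w in S) (\sum_(i <- s | i != i0) G i w) = 0.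
  exact: sumG.
elim => [|i s IH].
  by under eq_Rintegral do rewrite big_nil; rewrite Rintegral_cst// mul0r.
have [->|ii0] := eqVneq i i0.
  by under eq_Rintegral do rewrite big_cons eqxx.
under eq_Rintegral do rewrite big_cons ii0.
rewrite RintegralD//; first by rewrite IH plane_stein ?addr0// eq_sym.
apply: (@bounded_integrable _ _ _ _ _ _ (\sum_(j <- s | j != i0) K * 3)) => //.
  rewrite [X in measurable_fun _ X](_ : _ = fun w => \sum_(j <- s | j != i0) G j w)//.
  under eq_fun do rewrite big_mkcond.
  by apply: measurable_sum => j; case: (j != i0); [exact: mG|exact: measurable_cst].
move=> w Sw; rewrite (le_trans (ler_norm_sum _ _ _))//.
by apply: ler_sum => j _; exact: GK.
Qed.

End stein.

(** * Derivatives of the test functions *)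

Section derivatives.
Context {R : realType}.

(** The square removes the kink of the positive part at 0; there the slope function is the positive
    part itself. *)
Lemma is_derive_sqr_maxr0 (x : R) :
  is_derive x 1 (fun y => Num.max y 0 ^+ 2) (2 * Num.max x 0).
Proof.
have [x0|x0|->] := ltgtP x 0.
- rewrite mulr0; apply: (@near_eq_is_derive _ _ _ (cst 0)) => //.
  near=> y; rewrite /= max_r ?expr0n//; apply/ltW; near: y.
  exact: lt_nbhsl.
- have dX : is_derive x 1 (fun y : R => y ^+ 2) (2 * x).
    by apply: is_derive_eq; rewrite /GRing.scale/=; ring.
  apply: near_eq_is_derive dX.
  near=> y; rewrite /= max_l//; apply/ltW; near: y.
  exact: lt_nbhsr.
rewrite mulr0; apply/is_derive1_caratheodory.
exists (fun z => Num.max z 0); split.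
- move=> z; rewrite maxxx expr0n !subr0.
  by case: (ltP z 0) => _; rewrite ?mul0r ?expr0n// expr2.
- apply: (@continuous_max _ _ (fun z : R => z) (cst 0)) => //.
  exact: cvg_cst.
- by rewrite maxxx.
Unshelve. all: by end_near. Qed.

(** The inverse is written as a power with exponent -1, a measurable function on the whole line that
    agrees with the inverse wherever the base is nonnegative. *)
Lemma is_derive_powRN1 (c z : R) : z < c ->
  is_derive z 1 (fun y => (c - y) `^ (-1)) ((c - z)^-1 ^+ 2).
Proof.
move=> zc; have cz : 0 < c - z by rewrite subr_gt0.
have d1 : is_derive z 1 (fun y : R => c - y) (-1).
  by apply: is_derive_eq; rewrite add0r mul1r.
have := @is_derive1_comp R (fun x => x `^ (-1)) (fun y => c - y) z _ _
  (is_derive1_powR (-1) cz) d1.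
rewrite (_ : -1 * _ * -1 = (c - z)^-1 ^+ 2)//.
rewrite mulrN1 mulN1r opprK (_ : -1 - 1 = - 2%:R :> R); last by ring.
by rewrite powR_invn ?ltW// exprVn.
Qed.

Lemma is_derive_invX (c z : R) (j : nat) : z < c ->
  is_derive z 1 (fun y => (c - y) `^ (-1) ^+ j) (j%:R * (c - z)^-1 ^+ j.+1).
Proof.
move=> zc; have d := is_derive_powRN1 zc.
have := @is_deriveX _ _ _ j _ _ _ d.
rewrite powR_inv1 ?subr_ge0 ?ltW// => dX.
have -> : (fun y => (c - y) `^ (-1) ^+ j) = (fun y => (c - y) `^ (-1)) ^+ j.
  by apply/funext => y; rewrite !fctE.
suff <- : (j%:R * (c - z)^-1 ^+ j.-1) *: (c - z)^-1 ^+ 2 = j%:R * (c - z)^-1 ^+ j.+1.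
  by [].
case: j {dX} => [|j]; rewrite /GRing.scale/=; first by rewrite !mul0r.
by rewrite -mulrA -exprD addn2.
Qed.

End derivatives.

(** * Tail bounds from Stein's identity *)

Section almost_sure.
Context {R : realType} {d : measure_display} {T : measurableType d}.
Variable P : probability T R.

Lemma probability_setI1 (S B : set T) : measurable S -> P S = 1%E ->
  measurable B -> P (B `&` S) = P B.
Proof.
move=> mS PS mB.
have PnS : P (~` S) = 0%E by rewrite probability_setC// PS subee.
rewrite [RHS](measureDI P mB mS).
rewrite [X in (X + _)%E](_ : _ = 0%E) ?add0e//.
apply: (subset_measure0 _ _ _ PnS) => //; first exact: measurableD.
  exact: measurableC.
Qed.

Lemma Rintegral_indic (S : set T) (Z : T -> R) (B : set R) :
  measurable S -> P S = 1%E -> measurable_fun [set: T] Z -> measurable B ->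
  \int[P]_(w in S) \1_B (Z w) = fine (P (Z @^-1` B)).
Proof.
move=> mS PS mZ mB.
have mZB : measurable (Z @^-1` B) by rewrite -[X in measurable X]setTI; exact: mZ.
rewrite /Rintegral; congr fine; rewrite -(probability_setI1 mS PS mZB).
by rewrite -integral_indic.
Qed.

End almost_sure.

(** * Tails of a variable satisfying the Stein identity of Beta(k/2, (n-k)/2) *)

Section beta_tails.
Context {R : realType} {d : measure_display} {T : measurableType d}.
Variables (P : probability T R) (S : set T) (Z : T -> R) (n k : nat).
Hypothesis mS : measurable S.
Hypothesis PS : P S = 1%E.
Hypothesis mZ : measurable_fun [set: T] Z.
Hypothesis Z01 : forall w, S w -> 0 <= Z w <= 1.
Hypothesis stein : forall (f f' : R -> R) (K : R),
  measurable_fun [set: R] f -> measurable_fun [set: R] f' ->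
  (forall z : R, 0 <= z <= 1 -> is_derive z 1 f (f' z)) ->
  (forall z : R, 0 <= z <= 1 -> `|f z| <= K) ->
  (forall z : R, 0 <= z <= 1 -> `|f' z| <= K) ->
  \int[P]_(w in S)
    (2 * Z w * (1 - Z w) * f' (Z w) + (k%:R - n%:R * Z w) * f (Z w)) = 0.

Let pr (B : set R) := fine (P (Z @^-1` B)).

Let pr_ge0 B : 0 <= pr B. Proof. exact: fine_ge0. Qed.

Let prT : pr setT = 1.
Proof. by rewrite /pr preimage_setT probability_setT. Qed.

Let intg (g : R -> R) (K : R) : measurable_fun [set: R] g ->
  (forall z : R, 0 <= z <= 1 -> `|g z| <= K) ->
  P.-integrable S (EFin \o (g \o Z)).
Proof.
move=> mg gK; apply: (@bounded_integrable _ _ _ _ _ _ K) => //.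
  by apply: measurable_funTS; exact: measurableT_comp.
by move=> w Sw; apply: gK; exact: Z01.
Qed.

Let op (f f' : R -> R) (z : R) := 2 * z * (1 - z) * f' z + (k%:R - n%:R * z) * f z.

Let measurable_op f f' : measurable_fun [set: R] f -> measurable_fun [set: R] f' ->
  measurable_fun [set: R] (op f f').
Proof.
move=> mf mf'; apply: measurable_funD; apply: measurable_funM => //.
  by apply: measurable_funM; [exact: measurable_funM|exact: measurable_funB].
by apply: measurable_funB => //; exact: measurable_funM.
Qed.

Let op_bounded f f' (K : R) : 
  (forall z : R, 0 <= z <= 1 -> `|f z| <= K) ->
  (forall z : R, 0 <= z <= 1 -> `|f' z| <= K) ->
  forall z : R, 0 <= z <= 1 -> `|op f f' z| <= 2 * K + (k%:R + n%:R) * K.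
Proof.
move=> fK f'K z z01; have /andP[z0 z1] := z01.
rewrite /op (le_trans (ler_normD _ _))// lerD// normrM ler_pM//.
- by rewrite ger0_norm; nra.
- exact: f'K.
- by rewrite (le_trans (ler_normB _ _))// lerD// ger0_norm ?mulr_ge0// ler_piMr.
- exact: fK.
Qed.

(** Integrate the pointwise inequality: its right-hand side has mean zero by Stein's identity. *)
Lemma stein_ineq (f f' : R -> R) (K a b : R) (B1 B2 : set R) :
  measurable_fun [set: R] f -> measurable_fun [set: R] f' ->
  (forall z : R, 0 <= z <= 1 -> is_derive z 1 f (f' z)) ->
  (forall z : R, 0 <= z <= 1 -> `|f z| <= K) ->
  (forall z : R, 0 <= z <= 1 -> `|f' z| <= K) ->
  measurable B1 -> measurable B2 ->
  (forall z : R, 0 <= z <= 1 -> a * \1_B1 z - b * \1_B2 z <=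
    2 * z * (1 - z) * f' z + (k%:R - n%:R * z) * f z) ->
  a * fine (P (Z @^-1` B1)) <= b * fine (P (Z @^-1` B2)).
Proof.
move=> mf mf' df fK f'K mB1 mB2 le_op.
have mI B : measurable B -> measurable_fun [set: R] (\1_B : R -> R).
  by move=> mB; exact: measurable_indic.
have iI B c : measurable B -> P.-integrable S (EFin \o (fun w => c * \1_B (Z w))).
  move=> mB; apply: (@intg (fun z => c * \1_B z) `|c|).
    by apply: measurable_funM; [exact: measurable_cst|exact: mI].
  move=> z _; rewrite normrM ler_piMr// indicE; case: (_ \in _); rewrite ?normr1 ?normr0//.
have iI0 B : measurable B -> P.-integrable S (EFin \o (fun w => \1_B (Z w))).
  by move=> mB; apply: eq_integrable (iI B 1 mB) => // w _ /=; rewrite mul1r.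
rewrite -subr_ge0 -oppr_le0 opprB -(stein mf mf' df fK f'K).
rewrite -!(Rintegral_indic mS PS mZ)// -!RintegralZl//; [|exact: iI0..].
rewrite -RintegralB//; [|exact: iI..].
apply: le_Rintegral => //.
- apply: (@intg (fun z => a * \1_B1 z - b * \1_B2 z) (`|a| + `|b|)).
    by apply: measurable_funB; apply: measurable_funM => //; exact: mI.
  move=> z _; rewrite (le_trans (ler_normB _ _))// !normrM.
  by rewrite lerD// ler_piMr// indicE; case: (_ \in _); rewrite ?normr1 ?normr0.
- exact: (intg (measurable_op mf mf') (op_bounded fK f'K)).
- by move=> w Sw; apply: le_op; exact: Z01.
Qed.

(** Markov's inequality for the mean k/n, read off from the constant test function -1, whose Stein
    operator is n z - k. *)
Lemma markov_tail (w : R) :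
  n%:R * w * fine (P (Z @^-1` [set z | w <= z])) <= k%:R.
Proof.
rewrite -[leRHS]mulr1 -[X in _ <= _ * X]prT.
apply: (@stein_ineq (cst (-1)) (cst 0) 1) => //.
- by move=> z _; rewrite /= normrN1.
- by move=> z _; rewrite /= normr0 ler01.
- rewrite [X in measurable X](_ : _ = `[w, +oo[%classic)//.
  by apply/seteqP; split => z /=; rewrite in_itv/= andbT.
move=> z /andP[z0 z1]; rewrite indicT/= mulr0 add0r !indicE mulr1 mulrN1 opprB.
case: (boolP (z \in _)) => [/set_mem/= wz|_].
  by rewrite mulr1 lerD2r ler_wpM2l.
by rewrite mulr0 lerD2r mulr_ge0.
Qed.

(** The test function is (w' - z)_+^2 (1 - z)^-(j+1). Its Stein operator vanishes beyond w', is at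
    least k (w' - w)^2 / 2 below w, and can be negative only in the band from w to w', by at most 4
    w'^2 (1 - w')^-j. Since its mean is zero, the band must carry mass of order (1 - w')^j, and j
    can be taken close to n/2. *)
Lemma lower_tail (w w' : R) (j : nat) : 0 <= w -> w < w' -> w' < 1 ->
  8 <= (2 * j.+1%:R - n%:R) * (w' - w) ->
  k%:R * (w' - w) ^+ 2 / 2 * fine (P (Z @^-1` [set z | z <= w])) <=
  4 * w' ^+ 2 * (1 - w')^-1 ^+ j * fine (P (Z @^-1` [set z | w <= z <= w'])).
Proof.
move=> w0 ww' w'1 jw.
pose m (z : R) : R := Num.max (w' - z) 0.
pose V (z : R) := (1 - z) `^ (-1).
pose V0 := (1 - w')^-1.
have w'0 : 0 < w' by exact: le_lt_trans ww'.
have V01 : 1 <= V0 by rewrite invf_ge1 ?subr_gt0// gerBl ltW.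
have V00 : 0 <= V0 by exact: le_trans V01.
have mm : measurable_fun [set: R] m.
  apply: measurable_maxr => //; exact: measurable_funB.
have mV : measurable_fun [set: R] V.
  by apply: (measurableT_comp (measurable_powR (-1))); exact: measurable_funB.
have m0 z : 0 <= m z by rewrite le_max lexx orbT.
have m1 (z : R) : 0 <= z -> m z <= 1.
  by move=> z0; rewrite ge_max ler01 andbT; lra.
have Vge0 z : 0 <= V z by exact: powR_ge0.
have mV0 z : w' <= z -> m z = 0 by move=> w'z; apply/max_idPr; rewrite subr_le0.
have VE z : z < 1 -> V z = (1 - z)^-1 by move=> z1; rewrite /V powR_inv1// subr_ge0 ltW.
have Vle z : z <= w' -> V z <= V0.
  by move=> zw'; rewrite VE ?(le_lt_trans zw')// lef_pV2 ?posrE; lra.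
have dm (z : R) : is_derive z 1 (fun y => m y ^+ 2) (- (2 * m z)).
  have d1 : is_derive z 1 (fun y : R => w' - y) (-1).
    by apply: is_derive_eq; rewrite add0r mul1r.
  have := @is_derive1_comp R (fun x => Num.max x 0 ^+ 2) (fun y => w' - y) z _ _
    (is_derive_sqr_maxr0 (w' - z)) d1.
  by rewrite mulrN1.
pose f z := m z ^+ 2 * V z ^+ j.+1.
pose f' z := - (2 * m z) * V z ^+ j.+1 + m z ^+ 2 * (j.+1%:R * V z ^+ j.+2).
have Vj i z : z <= w' -> V z ^+ i <= V0 ^+ i.
  by move=> zw'; rewrite lerXn2r ?nnegrE// Vle.
have m21 (z : R) : 0 <= z -> m z ^+ 2 <= 1 by move=> z0; rewrite exprn_ile1// m1.
apply: (@stein_ineq f f' (2 * V0 ^+ j.+1 + j.+1%:R * V0 ^+ j.+2)).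
- by apply: measurable_funM; exact: measurable_funX.
- apply: measurable_funD; apply: measurable_funM.
  + apply: measurableT_comp => //; exact: measurable_funM.
  + exact: measurable_funX.
  + exact: measurable_funX.
  + by apply: measurable_funM => //; exact: measurable_funX.
- move=> z /andP[z0 z1]; have [z1'|z1'] := ltP z 1.
    have dV := @is_derive_invX R 1 z j.+1 z1'.
    have -> : f = (fun y => m y ^+ 2) * (fun y => V y ^+ j.+1) by [].
    have := @is_deriveM _ _ _ _ z 1 _ _ (dm z) dV.
    rewrite /GRing.scale/= -VE// => dM.
    suff <- : m z ^+ 2 * (j.+1%:R * V z ^+ j.+2) + V z ^+ j.+1 * - (2 * m z) = f' z.
      by [].
    by rewrite /f'; ring.
  (* At z = 1 the power is singular, but the factor [m] vanishes on a whole neighbourhood because w'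
     < 1. *)
  have zE : z = 1 by apply/eqP; rewrite eq_le z1 z1'.
  have -> : f' z = 0 by rewrite /f' mV0 ?zE ?ltW// mulr0 oppr0 expr0n !mul0r addr0.
  have dc : is_derive z 1 (cst 0 : R -> R) (0 : R) by exact: is_derive_cst.
  apply: near_eq_is_derive dc.
  near=> y; rewrite /f /= mV0 ?expr0n ?mul0r// ltW//; near: y.
  by apply: lt_nbhsr; rewrite zE.
- move=> z /andP[z0 z1]; have [zw'|/ltW zw'] := leP z w'; last first.
    by rewrite /f mV0// expr0n mul0r normr0 addr_ge0// mulr_ge0// exprn_ge0.
  rewrite ger0_norm; last by apply: mulr_ge0; exact: exprn_ge0.
  apply: (@le_trans _ _ (1 * V0 ^+ j.+1)).
    by apply: ler_pM; rewrite ?exprn_ge0 ?m21 ?Vj.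
  rewrite mul1r; apply: (@le_trans _ _ (2 * V0 ^+ j.+1)).
    by rewrite ler_peMl ?exprn_ge0// ler1n.
  by rewrite lerDl mulr_ge0// exprn_ge0.
- move=> z /andP[z0 z1]; have [zw'|/ltW zw'] := leP z w'; last first.
    rewrite /f' mV0// mulr0 oppr0 expr0n !mul0r addr0 normr0 addr_ge0// mulr_ge0//.
      exact: exprn_ge0.
    exact: exprn_ge0.
  rewrite /f' (le_trans (ler_normD _ _))// lerD//.
    rewrite normrM normrN (ger0_norm (mulr_ge0 _ (m0 z)))// ger0_norm//; last first.
      exact: exprn_ge0.
    apply: ler_pM; [exact: mulr_ge0|exact: exprn_ge0| |exact: Vj].
    by rewrite ler_piMr ?m1.
  rewrite ger0_norm; last first.
    by apply: mulr_ge0; [exact: sqr_ge0|apply: mulr_ge0 => //; exact: exprn_ge0].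
  rewrite -[leRHS]mul1r; apply: ler_pM.
  + exact: exprn_ge0.
  + by apply: mulr_ge0 => //; exact: exprn_ge0.
  + exact: m21.
  + by apply: ler_wpM2l => //; exact: Vj.
- rewrite [X in measurable X](_ : _ = `]-oo, w]%classic)//.
- rewrite [X in measurable X](_ : _ = `[w, w']%classic)//.
move=> z /andP[z0 z1].
have [w'z|zw'] := ltP w' z.
  rewrite !indicE /f /f' (mV0 _ (ltW w'z)) memNset /=; last by move=> /= zw; lra.
  rewrite memNset /=; last by move=> /= /andP[_ zw]; lra.
  by rewrite !(mulr0, mul0r, oppr0, expr0n, addr0, subr0).
have z1' : z < 1 by exact: le_lt_trans w'1.
have VV : (1 - z) * V z = 1 by rewrite VE// mulfV// lt0r_neq0// subr_gt0.
have V1 : 1 <= V z by rewrite VE// invf_ge1 ?subr_gt0// gerBl.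
(* Since (1 - z) V z = 1, differentiating the power contributes 2 (j+1) z against the drift -n z.
   This is where 2 (j+1) > n is needed. *)
have -> : 2 * z * (1 - z) * f' z + (k%:R - n%:R * z) * f z =
    m z ^+ 2 * V z ^+ j.+1 * (k%:R + (2 * j.+1%:R - n%:R) * z)
    - 4 * z * m z * V z ^+ j.
  rewrite /f /f' !exprS.
  transitivity ((1 - z) * V z * (- 4 * z * m z * V z ^+ j + 2 * z * m z ^+ 2 * j.+1%:R * (V z * V z ^+ j))
     + (k%:R - n%:R * z) * (m z ^+ 2 * (V z * V z ^+ j))); first by ring.
  by rewrite VV; ring.
have a0 : 0 <= 2 * j.+1%:R - n%:R :> R by nra.
have mE : m z = w' - z by apply/max_idPl; rewrite subr_ge0.
have mVV : m z * V z ^+ j <= m z * V z ^+ j.+1.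
  by rewrite ler_wpM2l// ler_weXn2l.
set A := 2 * j.+1%:R - n%:R in a0 jw *.
have pX : 0 <= V z ^+ j.+1 by exact: exprn_ge0.
have X1 : 1 <= V z ^+ j.+1 by exact: exprn_ege1.
rewrite !indicE; have [zw|wz] := leP z w.
  rewrite mem_set//=; set b := (_ \in _).
  have : 0 <= 4 * w' ^+ 2 * V0 ^+ j * b%:R.
    apply: mulr_ge0 => //; apply: mulr_ge0; last exact: exprn_ge0.
    by apply: mulr_ge0 => //; exact: sqr_ge0.
  rewrite /V0 mulr1; move: (_ * b%:R) => C C0.
  have mw : w' - w <= m z by rewrite mE; lra.
  have h0 : 0 < w' - w by lra.
  (* Below w one has m z >= w' - w, hence A * m z >= 8: half of the positive term in A pays for the
     negative term. *)
  have E1 : 4 * z * m z * V z ^+ j <= m z ^+ 2 * V z ^+ j.+1 * (A * z) / 2.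
    have : 4 * z * (m z * V z ^+ j) <= 4 * z * (m z * V z ^+ j.+1).
      by rewrite ler_wpM2l// mulr_ge0.
    have : 8 * (z * (m z * V z ^+ j.+1)) <= A * m z * (z * (m z * V z ^+ j.+1)).
      apply: ler_wpM2r; first by rewrite !mulr_ge0.
      by rewrite (le_trans jw)// ler_wpM2l.
    by move: (V z ^+ j) (V z ^+ j.+1) => X Y; nra.
  have E2 : (w' - w) ^+ 2 <= m z ^+ 2 * V z ^+ j.+1.
    rewrite -[leLHS]mulr1; apply: ler_pM => //; first exact: sqr_ge0.
    by rewrite lerXn2r ?nnegrE// ltW.
  have E3 : k%:R * (w' - w) ^+ 2 <= k%:R * (m z ^+ 2 * V z ^+ j.+1) by rewrite ler_wpM2l.
  have E4 : 0 <= m z ^+ 2 * V z ^+ j.+1 * (A * z).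
    by apply: mulr_ge0; apply: mulr_ge0 => //; exact: sqr_ge0.
  have E5 : 0 <= k%:R * (w' - w) ^+ 2 by rewrite mulr_ge0// sqr_ge0.
  by rewrite mulrDr; lra.
rewrite memNset /=; last by move=> /= zw; lra.
rewrite mem_set /=; last by rewrite ltW.
rewrite mulr0 sub0r mulr1.
have E1 : 4 * z * m z * V z ^+ j <= 4 * w' ^+ 2 * V0 ^+ j.
  apply: ler_pM; [|exact: exprn_ge0| |exact: Vj].
    by apply: mulr_ge0 => //; apply: mulr_ge0.
  by rewrite -mulrA ler_wpM2l// expr2 ler_pM// mE; lra.
have E2 : 0 <= m z ^+ 2 * V z ^+ j.+1 * (k%:R + A * z).
  apply: mulr_ge0; first by apply: mulr_ge0 => //; exact: sqr_ge0.
  by apply: addr_ge0 => //; exact: mulr_ge0.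
rewrite -/V0; lra.
Unshelve. all: by end_near. Qed.

(* Stein's identity for [(1 + eta - z) ^- i] relates the moments of order [i]
   and [i - 1]; [eta] only serves to avoid the pole at [z = 1]. *)
Let inverse_moment_le (eta : R) (N : nat) : 0 < eta ->
  k%:R + 2 * N%:R * eta < n%:R - 2 * N%:R ->
  \int[P]_(w in S) ((1 + eta - Z w) `^ (-1) ^+ N) <=
  ((n%:R - 2 * N%:R) / (n%:R - 2 * N%:R - (k%:R + 2 * N%:R * eta))) ^+ N.
Proof.
move=> eta0; set a := n%:R - 2 * N%:R; set c := k%:R + _ => ca.
pose V (z : R) : R := (1 + eta - z) `^ (-1).
have c0 : 0 <= c by rewrite addr_ge0// !mulr_ge0// ltW.
have ac0 : 0 < a - c by rewrite subr_gt0.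
have mV : measurable_fun [set: R] V.
  by apply: (measurableT_comp (measurable_powR (-1))); exact: measurable_funB.
have Vge0 z : 0 <= V z by exact: powR_ge0.
have VE z : z <= 1 -> V z = (1 + eta - z)^-1 by move=> z1; rewrite /V powR_inv1//; lra.
have Vle z : z <= 1 -> V z <= eta^-1.
  by move=> z1; rewrite VE// lef_pV2 ?posrE; lra.
have VX i z : 0 <= z <= 1 -> `|V z ^+ i| <= eta^-1 ^+ i.
  move=> /andP[_ z1]; rewrite ger0_norm ?exprn_ge0//.
  by apply: lerXn2r; rewrite ?nnegrE// ?Vle// invr_ge0 ltW.
have intV i : P.-integrable S (EFin \o (fun w => V (Z w) ^+ i)).
  by apply: (@intg (fun z => V z ^+ i) (eta^-1 ^+ i)) => //; [exact: measurable_funX|exact: VX].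
pose E i := \int[P]_(w in S) (V (Z w) ^+ i).
have E_ge0 i : 0 <= E i by apply: Rintegral_ge0 => w _; exact: exprn_ge0.
have step i : (i < N)%N -> (n%:R - 2 * i.+1%:R - c) * E i.+1 <= (n%:R - 2 * i.+1%:R) * E i.
  move=> iN.
  have iN' : i.+1%:R <= N%:R :> R by rewrite ler_nat.
  pose f z := V z ^+ i.+1; pose f' z := i.+1%:R * V z ^+ i.+2.
  pose K := eta^-1 ^+ i.+1 + i.+1%:R * eta^-1 ^+ i.+2.
  have e0 j : 0 <= eta^-1 ^+ j by rewrite exprn_ge0 ?invr_ge0 ?ltW.
  have mf : measurable_fun [set: R] f by exact: measurable_funX.
  have mf' : measurable_fun [set: R] f' by apply: measurable_funM => //; exact: measurable_funX.
  have df (z : R) : 0 <= z <= 1 -> is_derive z 1 f (f' z).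
    move=> /andP[_ z1]; have z1' : z < 1 + eta by lra.
    by have := @is_derive_invX R (1 + eta) z i.+1 z1'; rewrite -VE.
  have fK (z : R) : 0 <= z <= 1 -> `|f z| <= K.
    by move=> z01; rewrite (le_trans (VX _ _ z01))// lerDl mulr_ge0.
  have f'K (z : R) : 0 <= z <= 1 -> `|f' z| <= K.
    move=> z01; rewrite normrM ger0_norm// /K addrC ler_wpDr// ler_wpM2l//; exact: VX.
  have st := stein mf mf' df fK f'K.
  rewrite -subr_ge0 -st -!RintegralZl// -RintegralB//; last 2 first.
  - apply: (@intg (fun z => (n%:R - 2 * i.+1%:R) * V z ^+ i) (`|n%:R - 2 * i.+1%:R| * eta^-1 ^+ i)).
      by apply: measurable_funM => //; exact: measurable_funX.
    by move=> z z01; rewrite normrM ler_wpM2l//; exact: VX.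
  - apply: (@intg (fun z => (n%:R - 2 * i.+1%:R - c) * V z ^+ i.+1) (`|n%:R - 2 * i.+1%:R - c| * eta^-1 ^+ i.+1)).
      by apply: measurable_funM => //; exact: measurable_funX.
    by move=> z z01; rewrite normrM ler_wpM2l//; exact: VX.
  apply: le_Rintegral => //.
  - exact: (intg (measurable_op mf mf') (op_bounded fK f'K)).
  - apply: (@intg (fun z => (n%:R - 2 * i.+1%:R) * V z ^+ i - (n%:R - 2 * i.+1%:R - c) * V z ^+ i.+1)
      (`|n%:R - 2 * i.+1%:R| * eta^-1 ^+ i + `|n%:R - 2 * i.+1%:R - c| * eta^-1 ^+ i.+1)).
      by apply: measurable_funB; apply: measurable_funM => //; exact: measurable_funX.
    move=> z z01; rewrite (le_trans (ler_normB _ _))// !normrM.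
    by apply: lerD; apply: ler_wpM2l => //; exact: VX.
  move=> w Sw; have /andP[z0 z1] := Z01 Sw; move: (Z w) z0 z1 => z z0 z1.
  have VV : (1 + eta - z) * V z = 1 by rewrite VE// mulfV// lt0r_neq0//; lra.
  rewrite /f /f' !exprS; set X := V z ^+ i.
  have X0 : 0 <= X by exact: exprn_ge0.
  (* Substituting z V = (1 + eta) V - 1 leaves only powers of V. The one of order i + 2 has a
     negative coefficient and is dropped. *)
  have -> : 2 * z * (1 - z) * (i.+1%:R * (V z * (V z * X))) + (k%:R - n%:R * z) * (V z * X) =
    (n%:R - 2 * i.+1%:R) * X + V z * X * (2 * i.+1%:R * (1 + 2 * eta) + k%:R - n%:R * (1 + eta))
    - 2 * i.+1%:R * eta * (1 + eta) * (V z * V z * X).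
    transitivity ((1 - (1 + eta - z) * V z) * 0 + 2 * z * (1 - z) * (i.+1%:R * (V z * (V z * X))) + (k%:R - n%:R * z) * (V z * X)); first by ring.
    rewrite mulr0 add0r.
    have zV : z * V z = (1 + eta) * V z - 1 by move: VV; lra.
    transitivity (2 * i.+1%:R * X * ((z * V z) * (V z - z * V z)) + k%:R * (V z * X) - n%:R * (z * V z) * X); first by ring.
    by rewrite zV; ring.
  have p1 : 0 <= 2 * i.+1%:R * eta * (1 + eta) * (V z * V z * X).
    by rewrite !mulr_ge0//; lra.
  have p2 : 0 <= V z * X by rewrite mulr_ge0.
  have p3 : 2 * i.+1%:R * (1 + 2 * eta) + k%:R - n%:R * (1 + eta) <= - (n%:R - 2 * i.+1%:R - c).
    have : 0 <= eta * (n%:R - 2 * i.+1%:R + 2 * (N%:R - i.+1%:R)).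
      apply: mulr_ge0; first exact: ltW.
      apply: addr_ge0; last by rewrite mulr_ge0// subr_ge0.
      by move: ca c0; rewrite /a; lra.
    by rewrite /c; lra.
  have := ler_wpM2l p2 p3; lra.
have base : E 0%N = 1.
  by rewrite /E; under eq_Rintegral do rewrite expr0; rewrite Rintegral_cst// mul1r;
    exact: (congr1 fine PS).
suff : forall i, (i <= N)%N -> E i <= (a / (a - c)) ^+ i by apply.
elim => [|i IH] iN; first by rewrite base expr0.
have iN' : i.+1%:R <= N%:R :> R by rewrite ler_nat.
have b0 : a <= n%:R - 2 * i.+1%:R by rewrite /a; lra.
have := step i iN; set b := n%:R - _ in b0 * => st.
have bc0 : 0 < b - c by lra.
(* The quotient x / (x - c) does not increase with x and b >= a, so each step of the recursion costs
   at most the factor a / (a - c). *)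
rewrite exprS; apply: (@le_trans _ _ (b / (b - c) * E i)).
  by rewrite mulrAC ler_pdivlMr// mulrC.
apply: ler_pM => //; last exact/IH/ltnW.
  by rewrite divr_ge0//; lra.
rewrite ler_pdivrMr// mulrAC ler_pdivlMr//; nra.
Qed.

(** Markov's inequality for (1 + eta - z)^-N with the moment bound above, after which eta tends to
    0. *)
Lemma upper_tail (w : R) (N : nat) : 0 <= w <= 1 ->
  k%:R < n%:R - 2 * N%:R :> R ->
  fine (P (Z @^-1` [set z | w <= z])) <=
  ((1 - w) * ((n%:R - 2 * N%:R) / (n%:R - 2 * N%:R - k%:R))) ^+ N.
Proof.
move=> /andP[w0 w1]; set a := n%:R - 2 * N%:R => ka.
pose h (eta : R) := ((1 + eta - w) * (a / (a - (k%:R + 2 * N%:R * eta)))) ^+ N.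
have bound eta : 0 < eta -> k%:R + 2 * N%:R * eta < a ->
    fine (P (Z @^-1` [set z | w <= z])) <= h eta.
  move=> eta0 ca; rewrite /h exprMn.
  have ew : 0 < 1 + eta - w by lra.
  rewrite -ler_pdivrMl ?exprn_gt0//.
  apply: le_trans (inverse_moment_le eta0 ca).
  have mB : measurable [set z : R | w <= z].
    rewrite [X in measurable X](_ : _ = `[w, +oo[%classic)//.
    by apply/seteqP; split => z /=; rewrite in_itv/= andbT.
  pose V (z : R) : R := (1 + eta - z) `^ (-1).
  have mV : measurable_fun [set: R] V.
    by apply: (measurableT_comp (measurable_powR (-1))); exact: measurable_funB.
  have iB : P.-integrable S (EFin \o (fun w' => \1_[set z | w <= z] (Z w'))).
    apply: (@intg (\1_[set z | w <= z]) 1); first exact: measurable_indic.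
    by move=> z _; rewrite indicE; case: (_ \in _); rewrite ?normr1 ?normr0.
  rewrite -(Rintegral_indic mS PS mZ mB) -RintegralZl//.
  apply: le_Rintegral => //.
  - apply: (@intg (fun z => ((1 + eta - w) ^+ N)^-1 * \1_[set z | w <= z] z) `|((1 + eta - w) ^+ N)^-1|).
      by apply: measurable_funM => //; exact: measurable_indic.
    move=> z _; rewrite normrM ler_piMr// indicE; case: (_ \in _); rewrite ?normr1 ?normr0//.
  - apply: (@intg (fun z => V z ^+ N) (eta^-1 ^+ N)); first exact: measurable_funX.
    move=> z /andP[_ z1]; rewrite ger0_norm ?exprn_ge0 ?powR_ge0//.
    apply: lerXn2r; rewrite ?nnegrE ?invr_ge0 ?powR_ge0// ?(ltW eta0)//.
    by rewrite /V powR_inv1 ?lef_pV2 ?posrE; lra.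
  move=> x Sx; have /andP[z0 z1] := Z01 Sx; rewrite indicE.
  case: (boolP (_ \in _)) => [/set_mem/= wz|_]; last by rewrite mulr0 exprn_ge0// powR_ge0.
  rewrite mulr1 -exprVn.
  apply: lerXn2r; rewrite ?nnegrE ?powR_ge0 ?invr_ge0 ?(ltW ew)//.
  by rewrite powR_inv1 ?lef_pV2 ?posrE; lra.
(* Only the bound passes to the limit; the probability does not depend on eta. *)
have ch : h eta @[eta --> 0^'+] --> h 0.
  apply: cvg_at_right_filter; rewrite /h.
  apply: (@cvg_comp _ _ _ _ (fun x : R => x ^+ N)); last exact: exprn_continuous.
  apply: cvgM.
    by apply: cvgB; [apply: cvgD; [exact: cvg_cst|exact: cvg_id]|exact: cvg_cst].
  apply: cvgMl_tmp; apply: cvgV.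
    by rewrite mulr0 addr0 subr_eq0 gt_eqF.
  apply: cvgB; first exact: cvg_cst.
  by apply: cvgD; [exact: cvg_cst|apply: cvgMl_tmp; exact: cvg_id].
have -> : ((1 - w) * (a / (a - k%:R))) ^+ N = h 0 by rewrite /h mulr0 !addr0.
apply: (cvgr_to_ge ch); near=> eta; have eta0 : 0 < eta by near: eta; exact: nbhs_right_gt.
apply: bound => //; rewrite -ltrBrDl.
(* N + 1 instead of N keeps this threshold positive when N = 0. *)
have eta1 : eta < (2 * N.+1%:R)^-1 * (a - k%:R).
  by near: eta; apply: nbhs_right_lt; rewrite mulr_gt0 ?invr_gt0 ?subr_gt0.
rewrite ltr_pdivlMl// in eta1; apply: le_lt_trans eta1.
by rewrite ler_pM2r// ler_pM2l// ler_nat.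
Unshelve. all: by end_near. Qed.

End beta_tails.

(** * Exponential bounds for the squared norm of a row *)

Section haar_row_tails.
Context {R : realType} {d : measure_display} {T : measurableType d}.
Context (P : probability T R) (n k : nat) (A : T -> 'M[R]_(n, k)).
Hypothesis rA : random_element A.
Hypothesis hA : haar_stiefel P A.
Variable i0 : 'I_n.
Let Z w := row_dot (A w) i0 i0.
Local Notation S := (A @^-1` @stiefel R n k).

Let mS : measurable S.
Proof. by apply: rA; exact: borel_stiefel. Qed.

Let mZ : measurable_fun [set: T] Z.
Proof.
have := @measurable_random_comp R n k _ _ A (fun M => row_dot M i0 i0) _ rA.
by apply; exact: measurable_row_dot.
Qed.

Let Z01 w : S w -> 0 <= Z w <= 1.
Proof. by move=> Sw; rewrite /Z row_dot_ge0 row_dot_le1. Qed.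

Let upper := upper_tail mS hA.1 mZ Z01
  (fun f f' K mf mf' df fK f'K => stein_haar rA hA mf mf' df fK f'K i0).
Let markov := markov_tail mS hA.1 mZ Z01
  (fun f f' K mf mf' df fK f'K => stein_haar rA hA mf mf' df fK f'K i0).
Let lower := lower_tail mS hA.1 mZ Z01
  (fun f f' K mf mf' df fK f'K => stein_haar rA hA mf mf' df fK f'K i0).

(** The order N of the moment is the integer part of (1 - eps) n / 2. The part eps n kept back is at
    least 2 k and bounds the correction factor by exp(k / eps), uniformly in n; the summand 2 in the
    exponent is the rounding loss. *)
Lemma haar_upper_exp (w L eps : R) : 0 < eps < 1 -> 2 * k%:R <= eps * n%:R ->
  0 <= w <= 1 -> 0 <= L -> 1 - w <= expR (- (2 * L)) ->
  fine (P (Z @^-1` [set z | w <= z])) <=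
  expR (k%:R / eps - L * ((1 - eps) * n%:R - 2)).
Proof.
move=> /andP[eps0 eps1] kn w01 L0 wL.
have n0 : 0 < n%:R :> R by rewrite ltr0n (leq_trans _ (ltn_ord i0)).
have x0 : 0 <= (1 - eps) * n%:R / 2 by rewrite divr_ge0// mulr_ge0// subr_ge0 ltW.
pose N := Num.truncn ((1 - eps) * n%:R / 2).
have /andP[N1 N2] := Num.Theory.truncn_itv x0; rewrite -/N in N1 N2.
have N2' : (1 - eps) * n%:R / 2 < N%:R + 1 by rewrite natr1.
have a1 : eps * n%:R <= n%:R - 2 * N%:R by lra.
have en0 : 0 < eps * n%:R by rewrite mulr_gt0.
have kge0 : 0 <= k%:R :> R by [].
have ka : k%:R < n%:R - 2 * N%:R :> R by lra.
apply: (le_trans (upper w01 ka)); rewrite exprMn [X in expR X]addrC expRD.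
apply: ler_pM.
- by apply: exprn_ge0; rewrite subr_ge0; case/andP: w01.
- by apply: exprn_ge0; apply: divr_ge0; lra.
- apply: (@le_trans _ _ (expR (- (2 * L)) ^+ N)).
    by apply: lerXn2r; rewrite ?nnegrE ?expR_ge0 ?subr_ge0//; case/andP: w01.
  rewrite -expRM_natl ler_expR mulrN lerNl opprK.
  have : 0 <= L * (2 * N%:R - ((1 - eps) * n%:R - 2)).
    apply: mulr_ge0 => //. lra.
  lra.
set a := n%:R - _ in a1 ka *.
(* Here a - k >= a / 2 >= eps n / 2, so a / (a - k) <= 1 + 2 k / (eps n); the power N <= n / 2 turns
   this into exp(k / eps). *)
apply: (@le_trans _ _ (expR (2 * k%:R / (eps * n%:R)) ^+ N)).
  apply: lerXn2r; rewrite ?nnegrE ?expR_ge0//; first by apply: divr_ge0; lra.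
  apply: (le_trans _ (expR_ge1Dx _)).
  rewrite ler_pdivrMr ?subr_gt0//.
  rewrite mulrDl mul1r -[leLHS](subrK k%:R) lerD2l.
  rewrite mulrAC ler_pdivlMr// -mulrA mulrCA ler_wpM2l//; lra.
rewrite -expRM_natl ler_expR.
have -> : N%:R * (2 * k%:R / (eps * n%:R)) = k%:R / eps * (2 * N%:R / n%:R).
  by field; rewrite !gt_eqF.
rewrite ler_piMr ?divr_ge0 ?(ltW eps0)// ler_pdivrMr// mul1r; nra.
Qed.

(** [lower_tail] with j just large enough for its hypothesis. The constant 1/16 collects the 1/2 and
    the 4 of [lower_tail] and the mass 1/2 found below w. *)
Lemma haar_lower_exp (w w' L : R) : k = 1%N -> 0 < w -> w < w' -> w' < 1 ->
  2 <= n%:R * w -> 0 <= L -> expR (- (2 * L)) <= 1 - w' ->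
  ((w' - w) / w') ^+ 2 / 16 * expR (- (L * (n%:R + 8 / (w' - w)))) <=
  fine (P (Z @^-1` [set z | w <= z <= w'])).
Proof.
move=> k1 w0 ww' w'1 nw L0 wL.
have ww'0 : 0 < w' - w by rewrite subr_gt0.
have w'0 : 0 < w' by exact: lt_trans ww'.
have n0 : 0 < n%:R :> R by rewrite ltr0n (leq_trans _ (ltn_ord i0)).
(* As j + 1 > x, the excess 2 (j+1) - n is more than 8 / (w' - w); as j <= x, the power costs at
   most L (n + 8 / (w' - w)). *)
pose x := n%:R / 2 + 4 / (w' - w).
have x0 : 0 <= x by rewrite addr_ge0// divr_ge0// ltW.
pose j := Num.truncn x.
have /andP[j1 j2] := Num.Theory.truncn_itv x0; rewrite -/j in j1 j2.
have jw : 8 <= (2 * j.+1%:R - n%:R) * (w' - w).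
  have : 8 / (w' - w) <= 2 * j.+1%:R - n%:R.
    by move: j2; rewrite /x; lra.
  by rewrite ler_pdivrMr.
have mset (B : set R) : measurable B -> measurable (Z @^-1` B).
  by move=> mB; rewrite -[X in measurable X]setTI; exact: mZ.
(* For k = 1 the mean is 1/n, and n w >= 2 leaves at most half of the mass above w. *)
have Pw : 1 / 2 <= fine (P (Z @^-1` [set z | z <= w])).
  have mw : measurable (Z @^-1` [set z | w <= z]).
    apply: mset; rewrite [X in measurable X](_ : _ = `[w, +oo[%classic)//.
    by apply/seteqP; split => z /=; rewrite in_itv/= andbT.
  have mw' : measurable (Z @^-1` [set z | z <= w]).
    apply: mset; rewrite [X in measurable X](_ : _ = `]-oo, w]%classic)//.
  have := markov w; rewrite k1.
  have : (1 <= fine (P (Z @^-1` [set z | z <= w])) + fine (P (Z @^-1` [set z | w <= z]))).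
    rewrite -lee_fin EFinD !fineK ?fin_num_measure//.
    rewrite -(probability_setT P) (le_trans _ (measureU2 _ _ _))//.
    rewrite le_measure ?inE//; first exact: measurableU.
    by move=> t _ /=; case: (leP (Z t) w); [left|move/ltW; right].
  set p := fine _; set q := fine _ => pq nwq.
  have q0 : 0 <= q by exact: fine_ge0.
  have : 2 * q <= n%:R * w * q by rewrite ler_wpM2r.
  by lra.
have := lower (ltW w0) ww' w'1 jw; rewrite k1 mul1r.
set p := fine _ in Pw *; set q := fine _ => pq.
have v0 : 0 < 1 - w' by lra.
have E : (1 - w') ^+ j * ((w' - w) ^+ 2 / 2 * p) <= 4 * w' ^+ 2 * q.
  have := ler_wpM2l (exprn_ge0 j (ltW v0)) pq.
  rewrite [X in _ <= X -> _](_ : _ = ((1 - w') * (1 - w')^-1) ^+ j * (4 * w' ^+ 2 * q)).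
    by rewrite mulfV ?gt_eqF// expr1n mul1r.
  by rewrite exprMn; ring.
have F : expR (- (L * (n%:R + 8 / (w' - w)))) <= (1 - w') ^+ j.
  apply: (@le_trans _ _ (expR (- (2 * L)) ^+ j)).
    rewrite -expRM_natl ler_expR mulrN lerN2.
    have : 0 <= L * (x - j%:R) by rewrite mulr_ge0// subr_ge0.
    by rewrite /x; lra.
  by apply: lerXn2r; rewrite ?nnegrE ?expR_ge0// ltW.
have G : (w' - w) ^+ 2 / 4 <= (w' - w) ^+ 2 / 2 * p.
  have : 0 <= (w' - w) ^+ 2 * (p - 1 / 2) by rewrite mulr_ge0 ?sqr_ge0//; lra.
  by lra.
have : expR (- (L * (n%:R + 8 / (w' - w)))) * ((w' - w) ^+ 2 / 4) <= 4 * w' ^+ 2 * q.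
  apply: le_trans E; apply: ler_pM; rewrite ?expR_ge0//.
  by rewrite divr_ge0// sqr_ge0.
rewrite expr_div_n => H.
rewrite -(ler_pM2l (x := 4 * w' ^+ 2)); last by rewrite mulr_gt0// exprn_gt0.
apply: le_trans H; rewrite le_eqVlt; apply/orP; left; apply/eqP.
have : w' ^+ 2 != 0 by rewrite expf_neq0// gt_eqF.
by move: (expR _) ((w' - w) ^+ 2) (w' ^+ 2) => X D W W0; field.
Qed.

End haar_row_tails.

(** * Quasi-norms *)

Section qnorm_theory.
Context {R : realType}.

Lemma continuous_sumr (T : topologicalType) (I : Type) (r : seq I) (f : I -> T -> R) :
  (forall i, continuous (f i)) -> continuous (fun x => \sum_(i <- r) f i x).
Proof.
move=> cf; apply: continuous_big => //.
exact: tvs.add_continuous.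
Qed.

Lemma continuous_normr_powR (p : R) : 0 < p -> continuous (fun x : R => `|x| `^ p).
Proof.
move=> p0 x; have [->|x0] := eqVneq x 0.
  apply/(@cvgrPdist_lt _ R^o) => e e0 /=; near=> y.
  rewrite normr0 powR0 ?gt_eqF// sub0r normrN ger0_norm ?powR_ge0//.
  have ep : e = (e `^ p^-1) `^ p by rewrite -powRrM mulVf ?gt_eqF// powRr1// ltW.
  rewrite ep gt0_ltr_powR ?nnegrE ?powR_ge0//.
  have : `|0 - y| < e `^ p^-1.
    near: y; apply: (@cvgr_dist_lt _ R^o _ _ _ id 0) => //; exact: powR_gt0.
  by rewrite sub0r normrN.
apply: (@cvg_comp _ _ _ (fun x : R => `|x|) (fun x : R => x `^ p) _ (nbhs `|x|)).
  exact: norm_continuous.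
have := @is_derive1_powR R p `|x|.
rewrite normr_gt0 => /(_ x0) => dx.
suff : {for `|x|, continuous (fun y : R => y `^ p)} by [].
apply: differentiable_continuous.
by apply/derivable1_diffP; exact: ex_derive.
Unshelve. all: by end_near. Qed.

Definition sqn (k : nat) (z : 'cV[R]_k) : R := \sum_(i < k) z i 0 ^+ 2.

Lemma sqn_ge0 k (z : 'cV[R]_k) : 0 <= sqn z.
Proof. by apply: sumr_ge0 => i _; exact: sqr_ge0. Qed.

Lemma qnorm2E k (z : 'cV[R]_k) : qnorm 2 z = Num.sqrt (sqn z).
Proof.
rewrite /qnorm powR12_sqrt; last by apply: sumr_ge0 => i _; exact: powR_ge0.
congr Num.sqrt; apply: eq_bigr => i _.
by rewrite powR_mulrn// -normrX ger0_norm// sqr_ge0.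
Qed.

Lemma sqnZ k (a : R) (z : 'cV[R]_k) : sqn (a *: z) = a ^+ 2 * sqn z.
Proof. by rewrite /sqn mulr_sumr; apply: eq_bigr => i _; rewrite mxE exprMn. Qed.

Lemma sqn_eq0 k (z : 'cV[R]_k) : sqn z = 0 -> z = 0.
Proof.
move=> /psumr_eq0P z0; apply/colP => i; rewrite mxE.
have /eqP := z0 (fun i _ => sqr_ge0 _) i isT.
by rewrite sqrf_eq0 => /eqP.
Qed.

Variable q : R.
Hypothesis q0 : 0 < q.

Lemma qnorm_ge0 k (z : 'cV[R]_k) : 0 <= qnorm q z.
Proof. exact: powR_ge0. Qed.

Lemma qnormZ k (a : R) (z : 'cV[R]_k) : qnorm q (a *: z) = `|a| * qnorm q z.
Proof.
rewrite /qnorm (_ : \sum_(i < k) _ = `|a| `^ q * \sum_(i < k) `|z i 0| `^ q).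
  rewrite powRM ?powR_ge0//; last by apply: sumr_ge0 => i _; exact: powR_ge0.
  by rewrite -powRrM mulfV ?gt_eqF// powRr1.
by rewrite mulr_sumr; apply: eq_bigr => i _; rewrite mxE normrM powRM.
Qed.

Lemma qnorm0 k : qnorm q (0 : 'cV[R]_k) = 0.
Proof. by rewrite -(scale0r 0) qnormZ normr0 mul0r. Qed.

Lemma qnorm_eq0 k (z : 'cV[R]_k) : qnorm q z = 0 -> z = 0.
Proof.
move=> /powR_eq0_eq0 /psumr_eq0P z0; apply/colP => i; rewrite mxE.
have /powR_eq0_eq0/eqP := z0 (fun i _ => powR_ge0 _ _) i isT.
by rewrite normr_eq0 => /eqP.
Qed.

Lemma continuous_qnorm (T : topologicalType) k (f : T -> 'cV[R]_k) :
  (forall i, continuous (fun x => f x i 0)) -> continuous (fun x => qnorm q (f x)).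
Proof.
move=> cf x.
have -> : (fun x => qnorm q (f x)) =
    (fun y : R => `|y| `^ q^-1) \o (fun x => \sum_(i < k) `|f x i 0| `^ q).
  apply/funext => y /=; rewrite ger0_norm//.
  by apply: sumr_ge0 => i _; exact: powR_ge0.
apply: continuous_comp; last by apply: continuous_normr_powR; rewrite invr_gt0.
apply: continuous_sumr => i {}x.
apply: (continuous_comp (f := fun x => f x i 0) (g := fun y : R => `|y| `^ q)).
  exact: cf.
exact: continuous_normr_powR.
Qed.

Lemma measurable_qnorm d (T : measurableType d) (D : set T) k (f : T -> 'cV[R]_k) :
  (forall i, measurable_fun D (fun x => f x i 0)) ->
  measurable_fun D (fun x => qnorm q (f x)).
Proof.
move=> mf; apply: (measurableT_comp (measurable_powR q^-1)).
apply: measurable_sum => i; apply: (measurableT_comp (measurable_powR q)).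
exact: (measurableT_comp (@normr_measurable R setT)).
Qed.

(** Maximise on the compact unit sphere and extend by homogeneity. No triangle inequality is
    involved, so q < 1 is covered; positivity holds because the q-norm vanishes only at 0. *)
Lemma qnorm_max k : (0 < k)%N -> exists th : 'cV[R]_k,
  [/\ sqn th = 1, 0 < qnorm q th &
    forall z : 'cV[R]_k, qnorm q z <= qnorm q th * Num.sqrt (sqn z)].
Proof.
case: k => // k _.
(* Row vectors, since [bounded_closed_compact] gives the compactness of closed bounded sets of row
   vectors. *)
pose Sph := [set v : 'rV[R]_k.+1 | sqn v^T = 1].
have cco i : continuous (fun v : 'rV[R]_k.+1 => v^T i 0).
  move=> v; rewrite (_ : (fun v : 'rV[R]_k.+1 => v^T i 0) = fun v => v 0 i).
    exact: coord_continuous.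
  by apply/funext => u; rewrite mxE.
have csq : continuous (fun v : 'rV[R]_k.+1 => sqn v^T).
  apply: continuous_sumr => i v.
  apply: (continuous_comp (f := fun v : 'rV[R]_k.+1 => v^T i 0) (g := fun y : R => y ^+ 2)).
    exact: cco.
  exact: exprn_continuous.
have clS : closed Sph.
  rewrite (_ : Sph = (fun v : 'rV[R]_k.+1 => sqn v^T) @^-1` [set 1])//.
  by apply: preimage_closed => //; exact: closed_eq.
have bS : bounded_set Sph.
  exists 1; split; first exact: num_real.
  move=> M M1 v /= Sv.
  have vi i : `|v 0 i| <= 1.
    rewrite -(@ler_pXn2r _ 2)// ?nnegrE// expr1n real_normK ?num_real//.
    move: Sv; rewrite /Sph/= /sqn => <-; rewrite (bigD1 i)//= mxE lerDl.
    by apply: sumr_ge0 => j _; exact: sqr_ge0.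
  rewrite [leLHS]/Num.Def.normr /= mx_normrE; apply/bigmax_leP; split; first by lra.
  by move=> [a b] _ /=; rewrite ord1 (le_trans (vi b))// ltW.
have S0 : Sph !=set0.
  exists (\row_i (i == ord0)%:R); rewrite /Sph /= /sqn (bigD1 ord0)//= !mxE eqxx expr1n.
  rewrite big1 ?addr0// => i i0; by rewrite !mxE (negbTE i0) expr0n.
have [v Sv vmax] := compact_EVT_max S0 (bounded_closed_compact bS clS)
  (continuous_subspaceT (continuous_qnorm cco)).
have ineq (z : 'cV[R]_k.+1) : qnorm q z <= qnorm q v^T * Num.sqrt (sqn z).
  have [/sqn_eq0 ->|nz] := eqVneq (sqn z) 0.
    by rewrite qnorm0 mulr_ge0 ?qnorm_ge0.
  have z0 : 0 < Num.sqrt (sqn z) by rewrite sqrtr_gt0 lt_def nz sqn_ge0.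
  pose u := (Num.sqrt (sqn z))^-1 *: z.
  have uS : (u^T) \in Sph.
    rewrite inE /Sph /= trmxK /u sqnZ exprVn sqr_sqrtr ?sqn_ge0// mulVf//.
  have := vmax _ uS; rewrite trmxK /u qnormZ gtr0_norm ?invr_gt0//.
  by rewrite ler_pdivrMl// mulrC.
exists v^T; split => //; first exact/set_mem.
rewrite lt_def qnorm_ge0 andbT; apply/eqP => /qnorm_eq0 v0.
by move/set_mem: Sv; rewrite /Sph/= v0 /sqn big1 => [/eqP|i _]; rewrite ?mxE ?expr0n// eq_sym oner_eq0.
Qed.

End qnorm_theory.

(** * Independence of the norm and the direction *)

Section independent_sections.
Context {R : realType} {d d1 d2 : measure_display} {T : measurableType d}.
Context {E1 : measurableType d1} {E2 : measurableType d2}.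
Variables (P : probability T R) (X : T -> E1) (A : T -> E2).
Hypothesis mX : measurable_fun [set: T] X.
Hypothesis mA : measurable_fun [set: T] A.
Hypothesis indep : forall B C, measurable B -> measurable C ->
  P (X @^-1` B `&` A @^-1` C) = (P (X @^-1` B) * P (A @^-1` C))%E.

(** By independence the joint law is the product law. When all sections of D have the same
    probability, Fubini's theorem gives a constant integrand over B. *)
Lemma independent_section (B : set E1) (D : set (E1 * E2)) (c : \bar R) :
  measurable B -> measurable D ->
  (forall x, P (A @^-1` [set a | D (x, a)]) = c) ->
  P (X @^-1` B `&` [set w | D (X w, A w)]) = (P (X @^-1` B) * c)%E.
Proof.
move=> mB mD Dc.
have mXA : measurable_fun [set: T] (fun w => (X w, A w)) by exact: measurable_fun_pair.
pose X' := MeasurableFun.Pack (MeasurableFun.Class (isMeasurableFun.Build _ _ _ _ _ mX)).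
pose A' := MeasurableFun.Pack (MeasurableFun.Class (isMeasurableFun.Build _ _ _ _ _ mA)).
pose XA' := MeasurableFun.Pack (MeasurableFun.Class (isMeasurableFun.Build _ _ _ _ _ mXA)).
pose D' := (B `*` setT) `&` D.
have mD' : measurable D' by apply: measurableI => //; exact: measurableX.
have := @product_measure_unique _ _ _ _ R (distribution P X') (distribution P A')
  (distribution P XA') (fun B1 B2 mB1 mB2 => indep mB1 mB2) D' mD'.
have -> : P (X @^-1` B `&` [set w | D (X w, A w)]) = distribution P XA' D'.
  rewrite /distribution /pushforward /=; congr (P _).
  by apply/seteqP; split => w /=; [move=> []|move=> [[]]].
move=> <-; rewrite /product_measure1 /=.
transitivity (\int[distribution P X']_x ((cst c \_ B) x))%E.
  apply: eq_integral => x _ /=; rewrite patchE /distribution /pushforward /=.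
  case: ifPn => [/set_mem Bx|/negP nBx].
    rewrite -(Dc x); congr (P _); apply/seteqP; split => w /=; rewrite /xsection/= inE.
      by move=> [].
    by [].
  rewrite (_ : A @^-1` _ = set0) ?measure0//; apply/seteqP; split => w //=.
  by rewrite /xsection/= inE => -[[/= Bx _] _]; apply: nBx; rewrite inE.
by rewrite -integral_mkcond integral_cst// muleC.
Qed.

End independent_sections.

Section reflections.
Context {R : realType} (n : nat).

Lemma sqnE (x : 'cV[R]_n) : (x^T *m x) 0 0 = sqn x.
Proof. by rewrite mxE; apply: eq_bigr => i _; rewrite mxE expr2. Qed.

(** The Householder reflection in the hyperplane orthogonal to v = x - y; equal norms give v^T x =
    |v|^2 / 2, so x is sent to x - v = y. *)
Lemma reflection_exists (x y : 'cV[R]_n) : sqn x = sqn y ->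
  exists Q : 'M[R]_n, Q^T *m Q = 1%:M /\ Q *m x = y.
Proof.
move=> xy; pose v := x - y.
have [/sqn_eq0 v0|v0] := eqVneq (sqn v) 0.
  exists 1%:M; rewrite trmx1 !mul1mx; split => //.
  by apply/eqP; rewrite -subr_eq0; apply/eqP.
pose a := 2 / sqn v.
have vv : v^T *m v = (sqn v)%:M.
  by apply/matrixP => i j; rewrite !ord1 sqnE mxE eqxx mulr1n.
have vx : v^T *m x = (sqn v / 2)%:M.
  apply/matrixP => i j; rewrite !ord1 !mxE eqxx mulr1n.
  have -> : sqn v = 2 * (\sum_k v k 0 * x k 0) + (sqn y - sqn x).
    rewrite /sqn mulr_sumr -sumrB -big_split/=; apply: eq_bigr => k _.
    by rewrite !mxE; ring.
  rewrite xy subrr addr0 mulrAC mulfV// mul1r.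
  by apply: eq_bigr => k _; rewrite mxE.
exists (1%:M - a *: (v *m v^T)); split.
  have -> : (1%:M - a *: (v *m v^T))^T = 1%:M - a *: (v *m v^T).
    by rewrite linearB/= linearZ/= trmx_mul trmxK trmx1.
  rewrite mulmxBl mul1mx mulmxBr mulmx1 -scalemxAl -scalemxAr.
  rewrite mulmxA -(mulmxA v) vv mul_mx_scalar -scalemxAl !scalerA.
  have -> : a * (a * sqn v) = 2 * a by rewrite /a; field.
  by apply/matrixP => i j; rewrite !mxE; ring.
rewrite mulmxBl mul1mx -scalemxAl -mulmxA vx mul_mx_scalar scalerA.
rewrite (_ : a * (sqn v / 2) = 1) ?scale1r; last by rewrite /a; field.
by rewrite /v opprB addrC subrK.
Qed.

End reflections.

Section haar_directions.
Context {R : realType} {d : measure_display} {T : measurableType d}.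
Variables (P : probability T R) (n k : nat) (q : R) (q0 : 0 < q).
Variables (X : T -> 'cV[R]_n) (A : T -> 'M[R]_(n, k)).
Hypothesis rX : random_element X.
Hypothesis rA : random_element A.
Hypothesis hA : haar_stiefel P A.
Hypothesis indep : independent_elements P X A.
Local Notation mxT m k := (g_sigma_algebraType (@open 'M[R]_(m, k))).

(** If Q is orthogonal and Q x = y, then A^T x = (Q A)^T y, and Q A has the law of A. *)
Lemma haar_law_direction (x y : 'cV[R]_n) (C : set R) : sqn x = sqn y -> measurable C ->
  P [set w | C (qnorm q ((A w)^T *m x))] = P [set w | C (qnorm q ((A w)^T *m y))].
Proof.
move=> xy mC; have [Q [QQ Qx]] := reflection_exists xy.
pose B := [set M : 'M[R]_(n, k) | C (qnorm q (M^T *m y))].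
have bB : borel B.
  apply: (measurable_borel_preimage (h := fun M => qnorm q (M^T *m y))) => //.
  apply: measurable_qnorm => i.
  rewrite (_ : (fun M : mxT n k => (M^T *m y) i 0) = fun M => \sum_j M j i * y j 0).
    apply: measurable_sum => j; apply: measurable_funM; last exact: measurable_cst.
    exact: measurable_coord_id.
  by apply/funext => M; rewrite mxE; apply: eq_bigr => j _; rewrite mxE.
have E w : (Q *m A w)^T *m y = (A w)^T *m x.
  by rewrite -Qx trmx_mul -mulmxA (mulmxA Q^T) QQ mul1mx.
have E1 : [set w | C (qnorm q ((A w)^T *m x))] = (fun w => Q *m A w) @^-1` B.
  by apply/funext => w; rewrite /B /preimage /mkset E.
have E2 : A @^-1` B = [set w | C (qnorm q ((A w)^T *m y))].
  by apply/funext => w; rewrite /B /preimage /mkset.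
have H := hA.2 Q QQ B bB.
rewrite E2 in H.
rewrite -E1 in H.
exact: H.
Qed.

(** The default y at x = 0 makes the result a unit vector for every x, so the law above is the same
    for all x without exception. *)
Definition direction (y x : 'cV[R]_n) : 'cV[R]_n :=
  if sqn x == 0 then y else (Num.sqrt (sqn x))^-1 *: x.

Lemma sqn_direction y x : sqn y = 1 -> sqn (direction y x) = 1.
Proof.
move=> y1; rewrite /direction; case: eqP => [//|/eqP x0].
by rewrite sqnZ exprVn sqr_sqrtr ?sqn_ge0// mulVf.
Qed.

Lemma direction_eq y x : x = Num.sqrt (sqn x) *: direction y x.
Proof.
rewrite /direction; case: eqP => [x0|/eqP x0].
  by rewrite x0 sqrtr0 scale0r; exact: sqn_eq0.
by rewrite scalerA mulfV ?scale1r// sqrtr_eq0 -ltNge lt_def x0 sqn_ge0.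
Qed.

Lemma measurable_sqn m : measurable_fun [set: mxT m 1] (fun x : 'cV[R]_m => sqn x).
Proof.
by apply: measurable_sum => i; apply: measurable_funX; exact: measurable_coord_id.
Qed.

(** Conditionally on X, the q-norm has a law that does not depend on X: [independent_section]
    applies with constant sections. *)
Lemma independent_direction (y : 'cV[R]_n) (B C : set R) : sqn y = 1 ->
  measurable B -> measurable C ->
  P ([set w | B (Num.sqrt (sqn (X w)))] `&`
     [set w | C (qnorm q ((A w)^T *m direction y (X w)))]) =
  (P [set w | B (Num.sqrt (sqn (X w)))] *
   P [set w | C (qnorm q ((A w)^T *m y))])%E.
Proof.
move=> y1 mB mC.
have mX : @measurable_fun _ _ T (mxT n 1) [set: T] X.
  by move=> _ U bU; rewrite setTI; exact: rX.
have mA : @measurable_fun _ _ T (mxT n k) [set: T] A.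
  by move=> _ U bU; rewrite setTI; exact: rA.
pose D := [set p : mxT n 1 * mxT n k | C (qnorm q (p.2^T *m direction y p.1))].
pose B' : set (mxT n 1) := [set x : 'cV[R]_n | B (Num.sqrt (sqn x))].
have mB' : measurable B'.
  have : measurable_fun [set: mxT n 1] (fun x : 'cV[R]_n => Num.sqrt (sqn x)).
    apply: (measurableT_comp (@continuous_measurable_fun R (@Num.sqrt R) _)).
      exact: sqrt_continuous.
    exact: measurable_sqn.
  by move=> /(_ measurableT B mB); rewrite setTI.
have mD : measurable D.
  suff : measurable_fun [set: mxT n 1 * mxT n k]
      (fun p => qnorm q (p.2^T *m direction y p.1)).
    by move=> /(_ measurableT C mC); rewrite setTI.
  apply: measurable_qnorm => i.
  rewrite (_ : (fun p : mxT n 1 * mxT n k => _) =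
      fun p => \sum_j p.2 j i * direction y p.1 j 0); last first.
    by apply/funext => p; rewrite mxE; apply: eq_bigr => j _; rewrite mxE.
  apply: measurable_sum => j; apply: measurable_funM.
    exact: (measurableT_comp (measurable_coord_id j i) measurable_snd).
  suff md : measurable_fun [set: mxT n 1] (fun x : 'cV[R]_n => direction y x j 0).
    exact: (measurableT_comp md measurable_fst).
  rewrite (_ : (fun x => _) = fun x : mxT n 1 =>
     if sqn x == 0 then y j 0 else (Num.sqrt (sqn x)) `^ (-1) * x j 0); last first.
    apply/funext => x; rewrite /direction; case: ifP => // _.
    by rewrite mxE powR_inv1// sqrtr_ge0.
  apply: measurable_fun_ifT => /=.
  - apply: measurable_fun_eqr; [exact: measurable_sqn|exact: measurable_cst].
  - exact: measurable_cst.
  - apply: measurable_funM; last exact: measurable_coord_id.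
    apply: (measurableT_comp (measurable_powR (-1))).
    apply: (measurableT_comp (@continuous_measurable_fun R (@Num.sqrt R) _)).
      exact: sqrt_continuous.
    exact: measurable_sqn.
have := @independent_section R _ _ _ T (mxT n 1) (mxT n k) P X A mX mA indep B' D
  (P [set w | C (qnorm q ((A w)^T *m y))]) mB' mD.
apply => x.
have -> : A @^-1` [set a | D (x, a)] =
    [set w | C (qnorm q ((A w)^T *m direction y x))].
  by apply/funext => w; rewrite /D /preimage /mkset.
by apply: (haar_law_direction (C := C) _ mC); rewrite sqn_direction.
Qed.

End haar_directions.

Section first_row.
Context {R : realType}.

Lemma continuous_mx (U : topologicalType) m n (f : U -> 'M[R]_(m, n)) :
  (forall i j, continuous (fun x => f x i j)) -> continuous f.
Proof.
move=> cf x V [N nN sNV].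
suff : \forall y \near x, forall i j, N i j (f y i j).
  by apply: filterS => y Ny; apply: sNV.
apply: filter_forall => i; apply: filter_forall => j.
exact: (cf i j x _ (nN i j)).
Qed.

(** Defined for every n, including 0, so that it can be used along the whole sequence; A^T applied
    to it is the first row of A. *)
Definition unit_cV n : 'cV[R]_n := \col_i (i == 0 :> nat)%:R.

Lemma sqn_unit_cV n : (0 < n)%N -> sqn (unit_cV n) = 1.
Proof.
case: n => // n _; rewrite /sqn (bigD1 ord0)//= !mxE eqxx expr1n big1 ?addr0//.
by move=> [[|i] ?] //= _; rewrite !mxE expr0n.
Qed.

Definition dotp k (u v : 'cV[R]_k) : R := \sum_i u i 0 * v i 0.

Lemma mulmx_unit_cV n k (M : 'M[R]_(n, k)) (i0 : 'I_n) l : i0 = 0%N :> nat ->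
  (M^T *m unit_cV n) l 0 = M i0 l.
Proof.
move=> i00; rewrite mxE (bigD1 i0)//= !mxE i00 eqxx mulr1 big1 ?addr0// => i ii0.
rewrite !mxE (_ : (i == 0 :> nat) = false) ?mulr0//.
by apply/negbTE; apply: contraNN ii0 => /eqP i_0; apply/eqP/val_inj; rewrite /= i_0.
Qed.

Lemma row_dot_first n k (M : 'M[R]_(n, k)) (i0 : 'I_n) : i0 = 0%N :> nat ->
  row_dot M i0 i0 = sqn (M^T *m unit_cV n).
Proof.
by move=> i00; apply: eq_bigr => l _; rewrite (mulmx_unit_cV _ _ i00) expr2.
Qed.

Lemma row_dot_first_dotp n k (M : 'M[R]_(n, k)) (th : 'cV[R]_k) (i0 : 'I_n) :
  i0 = 0%N :> nat ->
  row_dot (M *m th) i0 i0 = dotp (M^T *m unit_cV n) th ^+ 2.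
Proof.
move=> i00; rewrite /row_dot big_ord1 expr2 /dotp mxE.
by congr (_ * _); apply: eq_bigr => l _; rewrite (mulmx_unit_cV _ _ i00).
Qed.

Lemma sqn_sub_dotp k (u th : 'cV[R]_k) : sqn th = 1 ->
  sqn (u - dotp u th *: th) = sqn u - dotp u th ^+ 2.
Proof.
move=> th1.
have E (t : R) : sqn (u - t *: th) = sqn u - 2 * t * dotp u th + t ^+ 2 * sqn th.
  rewrite /sqn /dotp !mulr_sumr -sumrB -big_split/=; apply: eq_bigr => i _.
  by rewrite !mxE; ring.
by rewrite E th1; ring.
Qed.

End first_row.

Section haar_projection.
Context {R : realType} {d : measure_display} {T : measurableType d}.
Variables (P : probability T R) (n k : nat) (A : T -> 'M[R]_(n, k)).
Hypothesis rA : random_element A.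
Hypothesis hA : haar_stiefel P A.
Variable th : 'cV[R]_k.
Hypothesis th1 : sqn th = 1.

Let continuous_mulmx : continuous (fun M : 'M[R]_(n, k) => M *m th).
Proof.
apply: continuous_mx => i j.
rewrite (_ : (fun M : 'M[R]_(n, k) => (M *m th) i j) = fun M => \sum_l M i l * th l j).
  apply: continuous_sumr => l M.
  exact: (cvgM (@coord_continuous R n k i l M) (cvg_cst _)).
by apply/funext => M; rewrite mxE.
Qed.

Lemma random_mulmx : random_element (fun w => A w *m th).
Proof. exact: (random_element_comp continuous_mulmx rA). Qed.

(** A unit combination of the columns of A is Haar distributed on the unit sphere. This reduces the
    component of the first row along [th] to the case of a single column. *)
Lemma haar_mulmx : haar_stiefel P (fun w => A w *m th).
Proof.
split.
  apply/eqP; rewrite eq_le probability_le1 /=; last first.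
    by apply: random_mulmx; exact: borel_stiefel.
  rewrite -hA.1 le_measure ?inE//.
  - by apply: rA; exact: borel_stiefel.
  - by apply: random_mulmx; exact: borel_stiefel.
  move=> w /=; rewrite /stiefel /= => st.
  rewrite trmx_mul mulmxA -(mulmxA th^T) st mulmx1.
  by apply/matrixP => i j; rewrite !ord1 sqnE th1 mxE eqxx.
move=> Q QQ B bB; have := hA.2 Q QQ _ (borel_preimage continuous_mulmx bB).
rewrite (_ : _ @^-1` (_ @^-1` B) = (fun w => Q *m (A w *m th)) @^-1` B)//.
by apply/seteqP; split => w /=; rewrite mulmxA.
Qed.

End haar_projection.

(** * Costs of the first row *)

Section first_row_tails.
Context {R : realType} {d : measure_display} {T : measurableType d}.
Variables (P : probability T R) (n k : nat) (A : T -> 'M[R]_(n, k)).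
Hypothesis n0 : (0 < n)%N.
Hypothesis rA : random_element A.
Hypothesis hA : haar_stiefel P A.
Let U w := (A w)^T *m unit_cV n.

Lemma measurable_first_row l : measurable_fun [set: T] (fun w => U w l 0).
Proof.
rewrite (_ : (fun w => _) = fun w => A w (Ordinal n0) l).
  exact: measurable_coord.
by apply/funext => w; rewrite (@mulmx_unit_cV R n k (A w) (Ordinal n0) l).
Qed.

Lemma measurable_sqn_first_row : measurable_fun [set: T] (fun w => sqn (U w)).
Proof.
by apply: measurable_sum => l; apply: measurable_funX; exact: measurable_first_row.
Qed.

Lemma measurable_dotp_first_row (th : 'cV[R]_k) :
  measurable_fun [set: T] (fun w => dotp (U w) th).
Proof.
apply: measurable_sum => l; apply: measurable_funM; last exact: measurable_cst.
exact: measurable_first_row.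
Qed.

Lemma first_row_upper (w L eps : R) : 0 < eps < 1 -> 2 * k%:R <= eps * n%:R ->
  0 <= w <= 1 -> 0 <= L -> 1 - w <= expR (- (2 * L)) ->
  (P [set t : T | (w <= sqn (U t))%R] <=
   (expR (k%:R / eps - L * ((1 - eps) * n%:R - 2)))%:E)%E.
Proof.
move=> e01 kn w01 L0 wL.
have := haar_upper_exp rA hA (Ordinal n0) e01 kn w01 L0 wL.
have -> : (fun w => row_dot (A w) (Ordinal n0) (Ordinal n0)) @^-1` [set z | w <= z] =
    [set t : T | (w <= sqn (U t))%R].
  by apply/funext => t; rewrite /preimage /mkset row_dot_first.
rewrite -lee_fin fineK// fin_num_measure//.
have := measurable_sqn_first_row; move=> /(_ measurableT `[w, +oo[%classic).
rewrite setTI (_ : _ @^-1` _ = [set t : T | (w <= sqn (U t))%R]); first by apply.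
by apply/funext => t; rewrite /preimage /mkset in_itv/= andbT.
Qed.

Lemma measurable_first_row_band (th : 'cV[R]_k) (w w' : R) :
  measurable [set t : T | (w <= dotp (U t) th ^+ 2 <= w')%R].
Proof.
have mf : measurable_fun [set: T] (fun t => dotp (U t) th ^+ 2).
  by apply: measurable_funX; exact: measurable_dotp_first_row.
have := mf measurableT `[w, w']%classic.
rewrite setTI (_ : _ @^-1` _ = [set t : T | (w <= dotp (U t) th ^+ 2 <= w')%R]); first by apply.
by apply/funext => t; rewrite /preimage /mkset in_itv/=.
Qed.

Lemma first_row_lower (th : 'cV[R]_k) (w w' L : R) : sqn th = 1 ->
  0 < w -> w < w' -> w' < 1 ->
  2 <= n%:R * w -> 0 <= L -> expR (- (2 * L)) <= 1 - w' ->
  ((((w' - w) / w') ^+ 2 / 16 * expR (- (L * (n%:R + 8 / (w' - w)))))%:E <=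
  P [set t : T | (w <= dotp (U t) th ^+ 2 <= w')%R])%E.
Proof.
move=> th1 w0 ww' w'1 nw L0 wL.
have := haar_lower_exp (random_mulmx rA th) (haar_mulmx rA hA th1) (Ordinal n0)
  erefl w0 ww' w'1 nw L0 wL.
have -> : (fun t => row_dot (A t *m th) (Ordinal n0) (Ordinal n0)) @^-1` [set z | w <= z <= w'] =
    [set t : T | (w <= dotp (U t) th ^+ 2 <= w')%R].
  by apply/funext => t; rewrite /preimage /mkset row_dot_first_dotp.
by rewrite -lee_fin fineK// fin_num_measure//; exact: measurable_first_row_band.
Qed.

End first_row_tails.

Section speeds.
Context {R : realType}.

(** The value +oo from c = 1 on encodes that |u| <= 1, and lets the infimum over 0 < c < 1 be taken
    over all c > 0. *)
Definition cost_A (c : R) : \bar R :=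
  if c < 1 then (- (2^-1 * ln (1 - c ^+ 2)))%:E else +oo%E.

Definition cost_B (c : R) : \bar R := (c ^+ 2 / 2)%:E.

End speeds.

Section first_row_asymptotics.
Context {R : realType} (k : nat) (k_gt0 : (0 < k)%N).
Context {d : nat -> measure_display} {T : forall n, measurableType (d n)}.
Variables (P : forall n, probability (T n) R) (A : forall n, T n -> 'M[R]_(n, k)).
Hypothesis rA : forall n, (k <= n)%N -> random_element (@A n).
Hypothesis hA : forall n, (k <= n)%N -> haar_stiefel (P n) (@A n).
Let U n (w : T n) := (A w)^T *m unit_cV n.

Let near_ge (x : R) : \forall n \near \oo, x <= n%:R.
Proof. exact: nbhs_infty_ger. Qed.

(** There is room for v strictly between 1 - c^2 and exp(-2 b), chosen inside ]0, 1[ even if c >= 1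
    or b < 0. The level c' = sqrt(1 - v) has a cost L > b, and the surplus absorbs the losses of
    [first_row_upper]. *)
Lemma upper_A (c b : R) : 0 < c -> (b%:E < cost_A c)%E ->
  exists2 c', 0 < c' < c & \forall n \near \oo,
    (P n [set w : T n | (c' ^+ 2 <= sqn (U w))%R] <= (expR (- (n%:R * b)))%:E)%E.
Proof.
move=> c0 bc.
have [v [v0 v1 vc vb]] : exists v, [/\ 0 < v, v < 1, 1 - c ^+ 2 < v & v < expR (- (2 * b))].
  pose l := Num.max 0 (1 - c ^+ 2); pose r := Num.min 1 (expR (- (2 * b))).
  have lr : l < r.
    rewrite /l /r gt_max !lt_min ltr01 expR_gt0/=.
    have c20 : 0 < c ^+ 2 by rewrite exprn_gt0.
    apply/andP; split; first by lra.
    move: bc; rewrite /cost_A; case: (ltP c 1) => [c1|c1 _].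
      rewrite lte_fin => bl; have p : 0 < 1 - c ^+ 2.
        by rewrite subr_gt0 expr_lt1 ?(ltW c0) ?(ltW c'0).
      by rewrite -[ltLHS]lnK ?posrE// ltr_expR; lra.
    apply: (@le_lt_trans _ _ 0); last exact: expR_gt0.
    by rewrite subr_le0 expr_ge1 ?(ltW c0).
  exists ((l + r) / 2).
  have [h1 h2] := midf_lt lr.
  split.
  - by apply: le_lt_trans h1; rewrite /l le_max lexx.
  - by apply: (lt_le_trans h2); rewrite /r ge_min lexx.
  - by apply: le_lt_trans h1; rewrite /l le_max lexx orbT.
  - by apply: (lt_le_trans h2); rewrite /r ge_min lexx orbT.
pose L := - (2^-1 * ln v).
have vL : v = expR (- (2 * L)) by rewrite /L -[LHS]lnK ?posrE//; congr expR; field.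
have L0 : 0 < L by rewrite /L; have := @ln_lt0 R v; rewrite v0 v1 => /(_ isT); lra.
have Lb : b < L.
  by move: vb; rewrite vL ltr_expR; lra.
exists (Num.sqrt (1 - v)).
  rewrite sqrtr_gt0 subr_gt0 v1/=.
  rewrite -(@ltr_pXn2r _ 2)// ?nnegrE ?sqrtr_ge0 ?(ltW c0)//.
  by rewrite sqr_sqrtr; lra.
pose b' := Num.max b 0.
have b'L : b' < L by rewrite /b' gt_max Lb L0.
have b'0 : 0 <= b' by rewrite /b' le_max lexx orbT.
have bb' : b <= b' by rewrite /b' le_max lexx.
(* Chosen so that L (1 - eps) is the midpoint of b' and L; b' >= 0 keeps eps below 1. *)
pose eps := (L - b') / (2 * L).
have eL : L * eps = (L - b') / 2 by rewrite /eps; field; rewrite gt_eqF.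
have e01 : 0 < eps < 1.
  apply/andP; split; first by apply: divr_gt0; lra.
  by rewrite /eps ltr_pdivrMr; lra.
have e0 : 0 < eps by case/andP: e01.
near=> n.
have kn : (k <= n)%N by near: n; exact: nbhs_infty_ge.
have n0 : (0 < n)%N by exact: leq_trans kn.
rewrite sqr_sqrtr ?subr_ge0 ?(ltW v1)//.
apply: le_trans (first_row_upper n0 (rA kn) (hA kn) e01 _ _ (ltW L0) _) _.
- by rewrite -ler_pdivrMl//; near: n; exact: near_ge.
- by rewrite subr_ge0 ltW//= gerBl ltW.
- by rewrite subKr vL.
rewrite lee_fin ler_expR.
have : (k%:R / eps + 2 * L) / (L * (1 - eps) - b) <= n%:R by near: n; exact: near_ge.
rewrite ler_pdivrMr; last by rewrite mulrBr mulr1 eL; lra.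
by lra.
Unshelve. all: by end_near. Qed.

(** [first_row_lower] gives exp(-n L) up to a constant factor, where L is the cost of c'; the margin
    a - L absorbs the factor for large n. *)
Lemma lower_A (th : 'cV[R]_k) (c c' a : R) : sqn th = 1 -> 0 < c -> c < c' ->
  (cost_A c' < a%:E)%E -> \forall n \near \oo,
  ((expR (- (n%:R * a)))%:E <= P n [set w : T n | (c ^+ 2 <= dotp (U w) th ^+ 2 <= c' ^+ 2)%R])%E.
Proof.
move=> th1 c0 cc'; rewrite /cost_A; case: ifPn => // c'1.
rewrite lte_fin; set L := - _ => La.
have c'0 : 0 < c' by exact: lt_trans cc'.
have v0 : 0 < 1 - c' ^+ 2 by rewrite subr_gt0 expr_lt1 ?(ltW c0) ?(ltW c'0).
have v1 : 1 - c' ^+ 2 < 1 by rewrite gtrBl exprn_gt0.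
have L0 : 0 <= L by rewrite /L; have := @ln_lt0 R (1 - c' ^+ 2); rewrite v0 v1 => /(_ isT); lra.
have vL : expR (- (2 * L)) = 1 - c' ^+ 2 by rewrite /L -[RHS]lnK ?posrE//; congr expR; field.
have c2 : c ^+ 2 < c' ^+ 2 by rewrite ltr_pXn2r ?nnegrE ?ltW.
pose D := ((c' ^+ 2 - c ^+ 2) / c' ^+ 2) ^+ 2 / 16.
have D0 : 0 < D.
  by rewrite /D divr_gt0// exprn_gt0// divr_gt0 ?subr_gt0// exprn_gt0.
near=> n.
have kn : (k <= n)%N by near: n; exact: nbhs_infty_ge.
have n0 : (0 < n)%N by exact: leq_trans kn.
apply: le_trans (first_row_lower n0 (rA kn) (hA kn) th1 _ c2 _ _ L0 _); last first.
- by rewrite vL.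
- rewrite -ler_pdivrMr ?exprn_gt0//; near: n; exact: near_ge.
- by rewrite expr_lt1 ?ltW.
- by rewrite exprn_gt0.
rewrite lee_fin -/D -[X in _ <= X * _](lnK (x := D)) ?posrE// -expRD ler_expR.
have : (8 * L / (c' ^+ 2 - c ^+ 2) - ln D) / (a - L) <= n%:R by near: n; exact: near_ge.
rewrite ler_pdivrMr ?subr_gt0//.
by lra.
Unshelve. all: by end_near. Qed.

Variable s : nat -> R.
Hypothesis s_oo : s n @[n --> \oo] --> +oo.
Hypothesis ns_oo : (n%:R / s n : R) @[n --> \oo] --> +oo.

Let near_s (x : R) : \forall n \near \oo, x <= s n.
Proof. by move/cvgryPge : s_oo; apply. Qed.

Let near_ns (x : R) : \forall n \near \oo, x <= n%:R / s n.
Proof. by move/cvgryPge : ns_oo; apply. Qed.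

(** At the level w = g s / n the inequality 1 - w <= exp(-w) allows L = w / 2, so that n L = s g /
    2. The midpoint g of 2 b' and c^2 leaves a margin on both sides. *)
Lemma upper_B (c b : R) : 0 < c -> (b%:E < cost_B c)%E ->
  exists2 c', 0 < c' < c & \forall n \near \oo,
    (P n [set w : T n | (c' ^+ 2 * (s n / n%:R) <= sqn (U w))%R] <= (expR (- (s n * b)))%:E)%E.
Proof.
move=> c0; rewrite lte_fin => bc.
pose b' := Num.max b 0.
have b'0 : 0 <= b' by rewrite /b' le_max lexx orbT.
have bb' : b <= b' by rewrite /b' le_max lexx.
have b'c : 2 * b' < c ^+ 2.
  have : b' < c ^+ 2 / 2 by rewrite /b' gt_max bc divr_gt0// exprn_gt0.
  by lra.
pose g := (2 * b' + c ^+ 2) / 2.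
have g0 : 0 < g by rewrite /g divr_gt0// ltr_pwDr ?exprn_gt0// mulr_ge0.
exists (Num.sqrt g).
  rewrite sqrtr_gt0 g0/= -(@ltr_pXn2r _ 2)// ?nnegrE ?sqrtr_ge0 ?(ltW c0)//.
  by rewrite sqr_sqrtr ?ltW// /g; lra.
rewrite sqr_sqrtr ?(ltW g0)//.
have bg : 2 * b' < g by rewrite /g; lra.
pose eps := (g - 2 * b') / (2 * g).
have eg : g * eps = (g - 2 * b') / 2 by rewrite /eps; field; rewrite gt_eqF.
have e01 : 0 < eps < 1.
  apply/andP; split; first by apply: divr_gt0; lra.
  by rewrite /eps ltr_pdivrMr; lra.
have e0 : 0 < eps by case/andP: e01.
near=> n.
have kn : (k <= n)%N by near: n; exact: nbhs_infty_ge.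
have n0 : (0 < n)%N by exact: leq_trans kn.
have nR0 : 0 < n%:R :> R by rewrite ltr0n.
have s0 : 0 < s n by apply: (@lt_le_trans _ _ 1) => //; near: n; exact: near_s.
have r0 : 0 < s n / n%:R by rewrite divr_gt0.
have rle x : 0 < x -> x <= n%:R / s n -> s n / n%:R <= x^-1.
  by move=> x0 xn; rewrite -invf_div lef_pV2 ?posrE// divr_gt0.
have r1 : s n / n%:R <= 1^-1 by apply: rle => //; near: n; exact: near_ns.
have rg : s n / n%:R <= g^-1 by apply: rle => //; near: n; exact: near_ns.
have gr : g * (s n / n%:R) <= 1 by rewrite -ler_pdivlMl// mulr1.
pose L := g * (s n / n%:R) / 2.
have L0 : 0 <= L by rewrite /L divr_ge0// mulr_ge0 ?ltW.
apply: le_trans (first_row_upper n0 (rA kn) (hA kn) e01 _ _ L0 _) _.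
- by rewrite -ler_pdivrMl//; near: n; exact: near_ge.
- by rewrite gr andbT mulr_ge0 ?ltW.
- by rewrite (le_trans _ (expR_ge1Dx _))// /L; lra.
rewrite lee_fin ler_expR.
have -> : L * ((1 - eps) * n%:R - 2) = s n * (g * (1 - eps) / 2) - g * (s n / n%:R).
  by rewrite /L; field; rewrite gt_eqF.
have : (k%:R / eps + 1) / (g * (1 - eps) / 2 - b) <= s n by near: n; exact: near_s.
rewrite ler_pdivrMr; last by rewrite mulrBr mulr1 eg; lra.
by lra.
Unshelve. all: by end_near. Qed.

(** The upper edge w' of the band tends to 0, so L = w' / (2 (1 - w')), which is admissible, makes n
    L asymptotic to s g, where g is the cost of c'. *)
Lemma lower_B (th : 'cV[R]_k) (c c' a : R) : sqn th = 1 -> 0 < c -> c < c' ->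
  (cost_B c' < a%:E)%E -> \forall n \near \oo,
  ((expR (- (s n * a)))%:E <=
   P n [set w : T n | (c ^+ 2 * (s n / n%:R) <= dotp (U w) th ^+ 2 <= c' ^+ 2 * (s n / n%:R))%R])%E.
Proof.
move=> th1 c0 cc'; rewrite /cost_B lte_fin; set g := c' ^+ 2 / 2 => ga.
have c'0 : 0 < c' by exact: lt_trans cc'.
have g0 : 0 < g by rewrite /g divr_gt0// exprn_gt0.
have c2 : c ^+ 2 < c' ^+ 2 by rewrite ltr_pXn2r ?nnegrE ?ltW.
have c20 : 0 < c ^+ 2 by rewrite exprn_gt0.
have c2' : 0 < c' ^+ 2 by rewrite exprn_gt0.
pose a1 := (g + a) / 2.
have ga1 : g < a1 by rewrite /a1; lra.
have a1a : a1 < a by rewrite /a1; lra.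
(* The solution of g (1 + tau) = a1 (1 - tau): tau bounds both w' and the relative error due to the
   term 8 / (w' - w). *)
pose tau := (a1 - g) / (a1 + g).
have tau0 : 0 < tau by rewrite /tau divr_gt0; lra.
have tau1 : tau < 1 by rewrite /tau ltr_pdivrMr; lra.
have tauE : g * (1 + tau) = a1 * (1 - tau) by rewrite /tau; field; lra.
pose D := ((c' ^+ 2 - c ^+ 2) / c' ^+ 2) ^+ 2 / 16.
have D0 : 0 < D.
  by rewrite /D divr_gt0// exprn_gt0// divr_gt0 ?subr_gt0.
near=> n.
have kn : (k <= n)%N by near: n; exact: nbhs_infty_ge.
have n0 : (0 < n)%N by exact: leq_trans kn.
have nR0 : 0 < n%:R :> R by rewrite ltr0n.
have s0 : 0 < s n by apply: (@lt_le_trans _ _ 1) => //; near: n; exact: near_s.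
have r0 : 0 < s n / n%:R by rewrite divr_gt0.
have rle x : 0 < x -> x <= n%:R / s n -> s n / n%:R <= x^-1.
  by move=> x0 xn; rewrite -invf_div lef_pV2 ?posrE// divr_gt0.
have w't : c' ^+ 2 * (s n / n%:R) <= tau.
  have : s n / n%:R <= (c' ^+ 2 / tau)^-1.
    by apply: rle; [rewrite divr_gt0|near: n; exact: near_ns].
  by rewrite invf_div ler_pdivlMr// mulrC.
have st : 8 / (c' ^+ 2 - c ^+ 2) / tau <= s n by near: n; exact: near_s.
pose r := s n / n%:R.
pose w' := c' ^+ 2 * r.
have v0 : 0 < 1 - w' by rewrite subr_gt0 (le_lt_trans w't).
pose L := w' / (2 * (1 - w')).
have L0 : 0 <= L.
  by rewrite /L divr_ge0// ?mulr_ge0// ltW.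
have D' : 0 < c' ^+ 2 - c ^+ 2 by rewrite subr_gt0.
apply: le_trans (first_row_lower n0 (rA kn) (hA kn) th1 _ _ _ _ L0 _); last first.
(* The reciprocal of 1 - w' is 1 + w' / (1 - w'), which is at most the exponential of 2 L = w' / (1
   - w'). *)
- rewrite -/r -/w' expRN -[leRHS]invrK lef_pV2 ?posrE ?expR_gt0 ?invr_gt0//.
  rewrite (le_trans _ (expR_ge1Dx _))// /L.
  rewrite le_eqVlt; apply/orP; left; apply/eqP; field; rewrite gt_eqF//.
- have -> : n%:R * (c ^+ 2 * (s n / n%:R)) = c ^+ 2 * s n by field; rewrite gt_eqF.
  by rewrite -ler_pdivrMl//; near: n; exact: near_s.
- by rewrite (le_lt_trans w't).
- by rewrite ltr_pM2r.
- by rewrite mulr_gt0.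
have -> : ((c' ^+ 2 * (s n / n%:R) - c ^+ 2 * (s n / n%:R)) / (c' ^+ 2 * (s n / n%:R))) ^+ 2 / 16 = D.
  rewrite /D -mulrBl; congr (_ ^+ 2 / _).
  by rewrite invfM mulrACA mulfV ?mulr1// gt_eqF.
rewrite lee_fin -[X in _ <= X * _](lnK (x := D)) ?posrE// -expRD ler_expR.
have LE : L * (n%:R + 8 / (c' ^+ 2 * (s n / n%:R) - c ^+ 2 * (s n / n%:R))) <= s n * a1.
  have -> : L * (n%:R + 8 / (c' ^+ 2 * (s n / n%:R) - c ^+ 2 * (s n / n%:R))) =
      s n * (g * (1 + 8 / (c' ^+ 2 - c ^+ 2) / s n) / (1 - w')).
    rewrite /L -mulrBl -/r.
    have -> : w' / (2 * (1 - w')) = g * r / (1 - w').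
      by rewrite /w' /g; field; rewrite gt_eqF.
    by rewrite /r; field; rewrite !gt_eqF.
  rewrite ler_pM2l// ler_pdivrMr//; apply: (@le_trans _ _ (g * (1 + tau))).
    by rewrite ler_pM2l// lerD2l ler_pdivrMr// (mulrC tau) -ler_pdivrMr.
  by rewrite tauE ler_pM2l; move: w't; rewrite -/r -/w'; lra.
have : - ln D / (a - a1) <= s n by near: n; exact: near_s.
rewrite ler_pdivrMr ?subr_gt0//.
by lra.
Unshelve. all: by end_near. Qed.

End first_row_asymptotics.

(** * Vectors close to a multiple of the maximiser *)

Section near_direction.
Context {R : realType} (q : R) (q0 : 0 < q) (k : nat) (th : 'cV[R]_k).
Hypothesis th1 : sqn th = 1.

Lemma sqr_coord_le_sqn (u : 'cV[R]_k) i : u i 0 ^+ 2 <= sqn u.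
Proof. by rewrite /sqn (bigD1 i)//= lerDl sumr_ge0// => j _; exact: sqr_ge0. Qed.

(* Among the vectors with [dotp u th] close to [c], those of norm close to [c]
   are close to [c *: th]. *)
Lemma qnorm_near_direction (c e : R) : 0 <= c -> 0 < e ->
  exists2 eta, 0 < eta & forall u : 'cV[R]_k,
    c ^+ 2 <= dotp u th ^+ 2 <= (c + eta) ^+ 2 -> sqn u <= (c + eta) ^+ 2 ->
    `|qnorm q u - qnorm q th * c| < e.
Proof.
move=> c0 e0.
have cq : continuous (fun u : 'cV[R]_k => qnorm q u).
  by apply: continuous_qnorm => // i; exact: coord_continuous.
have /(@cvgrPdist_lt _ R^o)/(_ e e0) := cq (c *: th).
rewrite qnormZ// ger0_norm// => /nbhs_ballP[rho /= rho0 near_c].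
(* The bound rho / 2 controls the error along [th]. The other two give (c + eta)^2 - c^2 <= (2 c +
   1) eta < (rho / 2)^2, which by Pythagoras bounds the component orthogonal to [th]. *)
pose eta := Num.min (rho / 2) (Num.min 1 (rho ^+ 2 / (4 * (2 * c + 1)))) / 2.
have p0 : 0 < 4 * (2 * c + 1) by rewrite mulr_gt0// ltr_wpDl// mulr_ge0.
have eta0 : 0 < eta.
  by rewrite /eta divr_gt0// !lt_min ltr01 !divr_gt0// exprn_gt0.
have eta1 : eta < rho / 2 /\ eta < 1 /\ eta < rho ^+ 2 / (4 * (2 * c + 1)).
  have : eta * 2 <= rho / 2 /\ eta * 2 <= 1 /\ eta * 2 <= rho ^+ 2 / (4 * (2 * c + 1)).
    by rewrite /eta divfK// !ge_min !lexx ?orbT.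
  by move=> [? [? ?]]; lra.
have {eta1}[eta1 [eta2 eta3]] := eta1.
have eta4 : (c + eta) ^+ 2 - c ^+ 2 < (rho / 2) ^+ 2.
  move: eta3; rewrite ltr_pdivlMr// => eta3.
  have : eta * eta <= eta by rewrite ler_piMr// ltW.
  by move: eta3; rewrite expr_div_n; lra.
exists eta => // u.
(* The hypotheses and the q-norm are even in u, whereas closeness to [c *: th] needs the sign. *)
wlog t0 : u / 0 <= dotp u th.
  move=> H tu su; have [/H|t0] := leP 0 (dotp u th); first exact.
  have dN : dotp (- u) th = - dotp u th.
    by rewrite /dotp -sumrN; apply: eq_bigr => i _; rewrite mxE mulNr.
  have qN : qnorm q (- u) = qnorm q u by rewrite -scaleN1r qnormZ// normrN1 mul1r.
  have sN : sqn (- u) = sqn u by rewrite -scaleN1r sqnZ sqrrN expr1n mul1r.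
  have Nt0 : 0 <= - dotp u th by rewrite oppr_ge0 ltW.
  by have := H (- u); rewrite dN sN qN sqrrN => /(_ Nt0 tu su).
move=> /andP[ct tc] su.
have ct' : c <= dotp u th by rewrite -(@ler_pXn2r _ 2)// nnegrE.
have tc' : dotp u th <= c + eta.
  by rewrite -(@ler_pXn2r _ 2)// nnegrE// addr_ge0// ltW.
rewrite distrC (mulrC _ c); apply: near_c.
rewrite /ball /= /mx_ball; split=> // i j; rewrite ord1 /ball /= mxE.
pose y := u - dotp u th *: th.
have yi : `|y i 0| < rho / 2.
  rewrite -(@ltr_pXn2r _ 2)// ?nnegrE ?divr_ge0 ?(ltW rho0)//.
  rewrite real_normK ?num_real// (le_lt_trans (sqr_coord_le_sqn y i))//.
  by rewrite /y sqn_sub_dotp//; lra.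
have thi : `|th i 0| <= 1.
  rewrite -(@ler_pXn2r _ 2)// ?nnegrE// expr1n real_normK ?num_real//.
  by rewrite -th1 sqr_coord_le_sqn.
have -> : c * th i 0 - u i 0 = (c - dotp u th) * th i 0 - y i 0.
  by rewrite /y !mxE; ring.
rewrite (le_lt_trans (ler_normB _ _))// (splitr rho) ler_ltD//.
rewrite normrM; apply: (@le_trans _ _ (eta * 1)); last by rewrite mulr1; exact: ltW.
by apply: ler_pM => //; rewrite distrC ger0_norm; lra.
Qed.

End near_direction.

(** * Exponential estimates for the rescaled q-norm of the first row *)

Section V_asymptotics.
Context {R : realType} (q : R) (q0 : 0 < q) (k : nat) (th : 'cV[R]_k).
Hypothesis th1 : sqn th = 1.
Let M := qnorm q th.
Hypothesis M0 : 0 < M.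
Hypothesis Mmax : forall z : 'cV[R]_k, qnorm q z <= M * Num.sqrt (sqn z).
Context {d : nat -> measure_display} {T : forall n, measurableType (d n)}.
Variables (P : forall n, probability (T n) R) (U : forall n, T n -> 'cV[R]_k).
Hypothesis mU : forall n, (k <= n)%N -> forall l, measurable_fun [set: T n] (fun w => U w l 0).
Variables (s r : nat -> R) (kappa : R -> \bar R).
Hypothesis s_oo : s n @[n --> \oo] --> +oo.
Hypothesis r_gt0 : \forall n \near \oo, 0 < r n.
Hypothesis kappa0 : kappa 0 = 0%E.
Hypothesis kappa_lt : forall c c' : R, 0 <= c -> c < c' -> (kappa c < +oo)%E -> (kappa c < kappa c')%E.
Hypothesis kappa_le : forall c c' : R, 0 <= c -> c <= c' -> (kappa c <= kappa c')%E.
Hypothesis kappa_rc : forall c a : R, 0 <= c -> (kappa c < a%:E)%E ->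
  exists2 c', c < c' & (kappa c' < a%:E)%E.
Hypothesis upper : forall c b : R, 0 < c -> (b%:E < kappa c)%E ->
  exists2 c', 0 < c' < c & \forall n \near \oo,
    (P n [set w : T n | (c' ^+ 2 * r n <= sqn (U w))%R] <= (expR (- (s n * b)))%:E)%E.
Hypothesis lower : forall c c' a : R, 0 < c -> c < c' -> (kappa c' < a%:E)%E ->
  \forall n \near \oo, ((expR (- (s n * a)))%:E <=
    P n [set w : T n | (c ^+ 2 * r n <= dotp (U w) th ^+ 2 <= c' ^+ 2 * r n)%R])%E.

Let V n (w : T n) : R := (Num.sqrt (r n))^-1 * qnorm q (U w).

Let near_s (x : R) : \forall n \near \oo, x <= s n.
Proof. by move/cvgryPge : s_oo; apply. Qed.

Let mset (n : nat) (f : T n -> R) (B : set R) : measurable_fun [set: T n] f ->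
  measurable B -> measurable (f @^-1` B).
Proof. by move=> mf mB; rewrite -[X in measurable X]setTI; exact: mf. Qed.

Let mV n : (k <= n)%N -> measurable_fun [set: T n] (@V n).
Proof.
move=> kn; apply: measurable_funM; first exact: measurable_cst.
by apply: measurable_qnorm; exact: mU.
Qed.

Let mS n c : (k <= n)%N -> measurable [set w : T n | c <= sqn (U w)].
Proof.
move=> kn; have : measurable_fun [set: T n] (fun w : T n => sqn (U w)).
  by apply: measurable_sum => l; apply: measurable_funX; exact: mU.
move=> /mset/(_ (measurable_itv `[c, +oo[)).
rewrite (_ : _ @^-1` _ = [set w : T n | c <= sqn (U w)]); first exact.
by apply/funext => t; rewrite /preimage /mkset in_itv/= andbT.
Qed.

Let mD n c c' : (k <= n)%N -> measurable [set w : T n | c <= dotp (U w) th ^+ 2 <= c'].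
Proof.
move=> kn; have : measurable_fun [set: T n] (fun w : T n => dotp (U w) th ^+ 2).
  apply: measurable_funX; apply: measurable_sum => l.
  by apply: measurable_funM; [exact: mU|exact: measurable_cst].
move=> /mset/(_ (measurable_itv `[c, c'])).
rewrite (_ : _ @^-1` _ = [set w : T n | c <= dotp (U w) th ^+ 2 <= c']); first exact.
by apply/funext => t; rewrite /preimage /mkset in_itv/=.
Qed.

(** For c > 0, maximality of [th] puts the event inside a tail event for |u|. At c = 0 the cost is
    0, so b < 0 and the bound is eventually at least 1. *)
Lemma V_upper c b : 0 <= c -> (b%:E < kappa c)%E ->
  exists2 c', c' < c & \forall n \near \oo,
    (P n [set w : T n | (M * c' <= V w)%R] <= (expR (- (s n * b)))%:E)%E.
Proof.
rewrite le_eqVlt => /predU1P[<-|c0].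
  rewrite kappa0 lte_fin => b0; exists (-1); first by rewrite ltrN10.
  near=> n.
  have kn : (k <= n)%N by near: n; exact: nbhs_infty_ge.
  rewrite (@le_trans _ _ 1%E)//.
    apply: probability_le1; have := mset (mV kn) (measurable_itv `[M * -1, +oo[).
    rewrite (_ : _ @^-1` _ = [set w : T n | M * -1 <= V w]); first exact.
    by apply/funext => t; rewrite /preimage /mkset in_itv/= andbT.
  rewrite lee_fin -[leLHS]expR0 ler_expR oppr_ge0 mulr_ge0_le0 ?(ltW b0)//.
  by near: n; exact: near_s.
move=> bc; have [c' /andP[c'0 c'c] Pn] := upper c0 bc.
exists c' => //; near=> n.
have kn : (k <= n)%N by near: n; exact: nbhs_infty_ge.
have rn : 0 < r n by near: n; exact: r_gt0.
have sr0 : 0 < Num.sqrt (r n) by rewrite sqrtr_gt0.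
apply: (@le_trans _ _ (P n [set w : T n | (c' ^+ 2 * r n <= sqn (U w))%R])); last first.
  by near: n.
rewrite le_measure ?inE//; last 2 first.
- exact: mS.
- move=> w /= MV.
  have cU : c' * Num.sqrt (r n) <= Num.sqrt (sqn (U w)).
    move: MV (Mmax (U w)); rewrite /V.
    move: (qnorm q (U w)) (Num.sqrt (sqn (U w))) => Q Z MV QZ.
    rewrite -(ler_pM2l M0); apply: le_trans QZ.
    by rewrite mulrA mulrC -ler_pdivlMl.
  have cr0 : 0 <= c' * Num.sqrt (r n) by rewrite mulr_ge0 ?sqrtr_ge0 ?(ltW c'0).
  have := lerXn2r 2 cr0 (sqrtr_ge0 (sqn (U w))) cU.
  by rewrite exprMn !sqr_sqrtr ?sqn_ge0 ?(ltW rn).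
have := mset (mV kn) (measurable_itv `[M * c', +oo[).
rewrite (_ : _ @^-1` _ = [set w : T n | M * c' <= V w]); first exact.
by apply/funext => t; rewrite /preimage /mkset in_itv/= andbT.
Unshelve. all: by end_near. Qed.

(** The band from c1 to c2 for the component along [th] has probability at least exp(-s a1), while
    |u| reaches the level c' < c3 with probability at most exp(-s b1), b1 > a1. On the difference
    [qnorm_near_direction] applies. *)
Lemma V_lower c a e : 0 <= c -> (kappa c < a%:E)%E -> 0 < e ->
  \forall n \near \oo,
    ((expR (- (s n * a)))%:E <= P n [set w : T n | (`|V w - M * c| < e)%R])%E.
Proof.
move=> c0 ca e0.
have [eta eta0 near_c] := qnorm_near_direction q0 th1 c0 e0.
have [cs ccs csa] := kappa_rc c0 ca.
pose h := Num.min (cs - c) eta.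
have h0 : 0 < h by rewrite /h lt_min eta0 subr_gt0 ccs.
have hcs : c + h <= cs.
  have : h <= cs - c by rewrite /h ge_min lexx.
  by lra.
have heta : h <= eta by rewrite /h ge_min lexx orbT.
(* All levels exceed c, so the lower edge of the band is positive even for c = 0. They stay below
   [cs], so the costs are finite, as strict monotonicity requires. *)
pose c3 := c + h; pose c2 := c + h / 2; pose c1 := c + h / 4.
have k3 : (kappa c3 < a%:E)%E by apply: le_lt_trans csa; apply: kappa_le; rewrite /c3; lra.
have fin_kappa c' : 0 <= c' -> (kappa c' < a%:E)%E -> kappa c' \is a fin_num.
  move=> c'0 c'a; rewrite ge0_fin_numE; first exact: lt_trans c'a (ltry _).
  by rewrite -kappa0; exact: kappa_le.
have k2 : (kappa c2 < kappa c3)%E.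
  apply: kappa_lt; rewrite ?/c2 ?/c3; [lra..|].
  apply: le_lt_trans (lt_trans k3 (ltry _)); apply: kappa_le; rewrite /c3; lra.
have [a1 [b1 [k2a1 ab1 b1k3]]] :
    exists a1 b1, [/\ (kappa c2 < a1%:E)%E, a1 < b1 & (b1%:E < kappa c3)%E].
  have f2 : kappa c2 \is a fin_num by apply: fin_kappa (lt_trans k2 k3); rewrite /c2; lra.
  have f3 : kappa c3 \is a fin_num by apply: fin_kappa k3; rewrite /c3; lra.
  move: k2; rewrite -(fineK f2) -(fineK f3) lte_fin.
  move: (fine (kappa c2)) (fine (kappa c3)) => x y xy.
  exists ((2 * x + y) / 3), ((x + 2 * y) / 3); rewrite !lte_fin; split; lra.
have a1a : a1 < a by rewrite -lte_fin (lt_trans _ k3)// (lt_trans _ b1k3)// lte_fin.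
have c1c2 : c1 < c2 by rewrite /c1 /c2; lra.
have c10 : 0 < c1 by rewrite /c1; lra.
have c30 : 0 < c3 by rewrite /c3; lra.
have low := lower c10 c1c2 k2a1.
have [c' /andP[c'0 c'c3] up] := upper c30 b1k3.
near=> n.
have kn : (k <= n)%N by near: n; exact: nbhs_infty_ge.
have rn : 0 < r n by near: n; exact: r_gt0.
have sr0 : 0 < Num.sqrt (r n) by rewrite sqrtr_gt0.
have Pl : ((expR (- (s n * a1)))%:E <= P n [set w : T n |
    (c1 ^+ 2 * r n <= dotp (U w) th ^+ 2 <= c2 ^+ 2 * r n)%R])%E by near: n.
have Pu : (P n [set w : T n | (c' ^+ 2 * r n <= sqn (U w))%R] <=
    (expR (- (s n * b1)))%:E)%E by near: n.
have mE : measurable [set w : T n | `|V w - M * c| < e].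
  have := mset (mV kn) (measurable_itv `]M * c - e, M * c + e[).
  rewrite (_ : _ @^-1` _ = [set w : T n | `|V w - M * c| < e]); first exact.
  by apply/funext => t; rewrite /preimage /mkset in_itv/= ltr_distl.
have sub : [set w : T n | c1 ^+ 2 * r n <= dotp (U w) th ^+ 2 <= c2 ^+ 2 * r n] `<=`
    [set w : T n | `|V w - M * c| < e] `|` [set w : T n | c' ^+ 2 * r n <= sqn (U w)].
  move=> w /= /andP[cd dc]; have [|us] := leP (c' ^+ 2 * r n) (sqn (U w)); first by right.
  left.
  pose u := (Num.sqrt (r n))^-1 *: U w.
  have -> : V w = qnorm q u by rewrite /V /u qnormZ// gtr0_norm// invr_gt0.
  have du : dotp u th ^+ 2 = dotp (U w) th ^+ 2 / r n.
    have -> : dotp u th = (Num.sqrt (r n))^-1 * dotp (U w) th.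
      by rewrite /dotp mulr_sumr; apply: eq_bigr => i _; rewrite mxE mulrA.
    by rewrite exprMn exprVn sqr_sqrtr ?(ltW rn)// mulrC.
  have su : sqn u = sqn (U w) / r n.
    by rewrite sqnZ exprVn sqr_sqrtr ?(ltW rn)// mulrC.
  apply: near_c; rewrite ?du ?su.
    rewrite ler_pdivlMr// ler_pdivrMr//; apply/andP; split.
      rewrite (le_trans _ cd)// ler_pM2r// lerXn2r ?nnegrE ?(ltW c10)//.
      by rewrite /c1; lra.
    rewrite (le_trans dc)// ler_pM2r// lerXn2r ?nnegrE ?addr_ge0 ?(ltW eta0)//.
      by rewrite /c2; lra.
    by rewrite /c2; lra.
  rewrite ler_pdivrMr// (le_trans (ltW us))// ler_pM2r//.
  rewrite lerXn2r ?nnegrE ?addr_ge0 ?(ltW eta0) ?(ltW c'0)//.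
  by move: c'c3; rewrite /c3; lra.
have PE : ((expR (- (s n * a1)))%:E <=
    P n [set w : T n | (`|V w - M * c| < e)%R] + (expR (- (s n * b1)))%:E)%E.
  apply: (le_trans Pl); apply: (@le_trans _ _ (P n ([set w : T n | (`|V w - M * c| < e)%R] `|`
      [set w : T n | (c' ^+ 2 * r n <= sqn (U w))%R]))).
    rewrite le_measure ?inE//; first exact: mD.
    by apply: measurableU => //; exact: mS.
  apply: (le_trans (measureU2 _ mE (mS _ kn))).
  by rewrite leeD2l.
have fin : P n [set w : T n | (`|V w - M * c| < e)%R] \is a fin_num.
  by rewrite fin_num_measure.
rewrite -(fineK fin) lee_fin; move: PE; rewrite -(fineK fin) -EFinD lee_fin.
set p := fine _ => pE.
(* For large s both the subtracted exp(-s b1) and the target exp(-s a) are at most half of exp(-s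
   a1). *)
have sb : s n * b1 = s n * a1 + s n * (b1 - a1) by ring.
have sa : s n * a = s n * a1 + s n * (a - a1) by ring.
have h2 (x : R) : 0 < x -> 2 <= s n * x -> expR (- (s n * x)) <= 1 / 2.
  move=> x0 sx; rewrite expRN ler_pdivlMr// ler_pdivrMl ?expR_gt0// mulr1.
  by rewrite (le_trans _ (expR_ge1Dx _))//; lra.
have e1 : expR (- (s n * (b1 - a1))) <= 1 / 2.
  apply: h2; rewrite ?subr_gt0// -ler_pdivrMr ?subr_gt0//.
  by near: n; exact: near_s.
have e2 : expR (- (s n * (a - a1))) <= 1 / 2.
  apply: h2; rewrite ?subr_gt0// -ler_pdivrMr ?subr_gt0//.
  by near: n; exact: near_s.
move: pE; rewrite sb sa !opprD !expRD.
have x0 := expR_ge0 (- (s n * a1)).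
have := ler_wpM2l x0 e1; have := ler_wpM2l x0 e2.
move: (expR (- (s n * a1))) (expR (- (s n * (a - a1)))) (expR (- (s n * (b1 - a1)))).
by move=> x y z /=; lra.
Unshelve. all: by end_near. Qed.

End V_asymptotics.

(** * Large deviations of a product *)

Section log_scale.
Context {R : realType}.
Implicit Types (p : \bar R) (s a : R).

Lemma lne_scaled_ge s a p : 0 < s -> ((expR (- (s * a)))%:E <= p)%E ->
  ((- a)%:E <= s^-1%:E * lne p)%E.
Proof.
move=> s0; have s'0 : (0 < s^-1%:E)%E by rewrite lte_fin invr_gt0.
case: p => [p| |] ep.
- rewrite lee_fin in ep; have p0 : 0 < p by exact: lt_le_trans (expR_gt0 _) ep.
  rewrite lne_EFin// -EFinM lee_fin ler_pdivlMl// mulrN.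
  by rewrite -ler_expR lnK ?posrE.
- by rewrite /= gt0_muley// leey.
- by move: ep; rewrite leeNy_eq.
Qed.

Lemma lne_scaled_le s a p : 0 < s -> (p <= (expR (- (s * a)))%:E)%E ->
  (s^-1%:E * lne p <= (- a)%:E)%E.
Proof.
move=> s0; have s'0 : (0 < s^-1%:E)%E by rewrite lte_fin invr_gt0.
case: p => [p| |] pe.
- rewrite lee_fin in pe; have [p0|p0] := leP p 0.
    by rewrite le0_lneNy ?lee_fin// gt0_muleNy// leNye.
  rewrite lne_EFin// -EFinM lee_fin ler_pdivrMl// mulrN.
  by rewrite -ler_expR lnK ?posrE.
- by move: pe; rewrite leye_eq.
- by rewrite /= gt0_muleNy// leNye.
Qed.

Lemma lne_scaled_gt s a p : 0 < s -> ((- a)%:E < s^-1%:E * lne p)%E ->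
  ((expR (- (s * a)))%:E <= p)%E.
Proof.
move=> s0 h; rewrite leNgt; apply/negP => /ltW /(lne_scaled_le s0).
by rewrite leNgt h.
Qed.

Lemma lne_scaled_lt s a p : 0 < s -> (s^-1%:E * lne p < (- a)%:E)%E ->
  (p <= (expR (- (s * a)))%:E)%E.
Proof.
move=> s0 h; rewrite leNgt; apply/negP => /ltW /(lne_scaled_ge s0).
by rewrite leNgt h.
Qed.

Lemma limn_esup_lt_near (u : nat -> \bar R) (x : \bar R) :
  (limn_esup u < x)%E -> \forall n \near \oo, (u n < x)%E.
Proof.
move=> /ereal_inf_lt[_ [B oB <-]] Bx; apply: filterS oB => n Bn.
by apply: le_lt_trans Bx; apply: ereal_sup_ubound; exists n.
Qed.

Lemma limn_esup_le_near (u : nat -> \bar R) (x : \bar R) :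
  (\forall n \near \oo, (u n <= x)%E) -> (limn_esup u <= x)%E.
Proof.
move=> ux; apply: ereal_inf_le; exists (ereal_sup (u @` [set n | (u n <= x)%E])).
  by exists [set n | (u n <= x)%E].
by apply: ge_ereal_sup => _ [n un <-].
Qed.

Lemma limn_einf_gt_near (u : nat -> \bar R) (x : \bar R) :
  (x < limn_einf u)%E -> \forall n \near \oo, (x < u n)%E.
Proof.
rewrite /limn_einf lteNr => /limn_esup_lt_near; apply: filterS => n.
by rewrite /= lteN2.
Qed.

Lemma limn_einf_ge_near (u : nat -> \bar R) (x : \bar R) :
  (\forall n \near \oo, (x <= u n)%E) -> (x <= limn_einf u)%E.
Proof.
move=> xu; rewrite /limn_einf leeNr; apply: limn_esup_le_near.
by apply: filterS xu => n; rewrite /= leeN2.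
Qed.

(** Testing against real numbers keeps infinite values of the infimum out of the estimates. *)
Lemma lee_of_real_lt (x y : \bar R) :
  (forall a : R, (a%:E < x)%E -> (y <= (- a)%:E)%E) -> (y <= - x)%E.
Proof.
case: x => [x| |] H /=.
- apply/lee_addgt0Pr => e e0; have := H (x - e); rewrite lte_fin gtrBl => /(_ e0).
  by rewrite -EFinD opprB addrC.
- case: y H => [y| |] H //.
    by exfalso; have := H (1 - y) (ltry _); rewrite lee_fin; lra.
  by have := H 0 (ltry _); rewrite leye_eq.
- by rewrite leey.
Qed.

Lemma lee_of_real_gt (x y : \bar R) :
  (forall a : R, (x < a%:E)%E -> ((- a)%:E <= y)%E) -> (- x <= y)%E.
Proof.
case: x => [x| |] H /=.
- apply/lee_addgt0Pr => e e0; have := H (x + e); rewrite lte_fin ltrDl => /(_ e0).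
  rewrite opprD => h; rewrite (_ : (- x)%:E = ((- x - e)%:E + e%:E)%E).
    exact: leeD2r.
  by rewrite -EFinD subrK.
- by rewrite leNye.
- case: y H => [y| |] H //.
    by exfalso; have := H (- y - 1) (ltNyr _); rewrite lee_fin; lra.
  by have := H 0 (ltNyr _); rewrite leeNy_eq.
Qed.

End log_scale.

Section clip.
Context {R : realType}.

Lemma clip_ge0 (x : R) : Rplus (Num.max x 0).
Proof. by rewrite /Rplus /= le_max lexx orbT. Qed.

(** A continuous retraction of the line onto the half-line, so that the map sending a pair to its
    product is defined and continuous on the whole plane. *)
Definition clip (x : R) : Rplus := SigSub (mem_set (clip_ge0 x)).

Lemma set_val_clip x : set_val (clip x) = Num.max x 0 :> R.
Proof. by []. Qed.

Lemma clipK (y : Rplus (R := R)) : clip (set_val y) = y.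
Proof.
apply: val_inj; rewrite /= max_l//.
exact: (set_mem (valP y)).
Qed.

Lemma continuous_clip : continuous clip.
Proof.
apply: (@continuous_comp_initial (Rplus (R := R)) R R set_val clip) => x.
apply: (@continuous_max R R id (cst 0)); first exact: cvg_id.
exact: cvg_cst.
Qed.

Lemma hausdorff_Rplus : hausdorff_space (Rplus (R := R)).
Proof.
move=> x y xy; apply: val_inj; apply: (@Rhausdorff R) => A B Ax By.
have cv : continuous (set_val : Rplus (R := R) -> R) by exact: initial_continuous.
have [z [zA zB]] := xy _ _ (cv x _ Ax) (cv y _ By).
by exists (set_val z).
Qed.

End clip.

Section ereal_splitting.
Context {R : realType}.

Lemma lt_adde_split (x y : \bar R) (b : R) : (0 <= x)%E -> (0 <= y)%E ->
  (b%:E < x + y)%E -> exists b1 b2, [/\ (b1%:E < x)%E, (b2%:E < y)%E & b <= b1 + b2].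
Proof.
case: x => [x| |] //; case: y => [y| |] // x0 y0 bxy.
- exists (x - (x + y - b) / 2), (y - (x + y - b) / 2).
  by move: bxy; rewrite -EFinD !lte_fin; split; lra.
- exists (x - 1), (b - x + 1); rewrite ltry lte_fin; split => //; lra.
- exists (b - y + 1), (y - 1); rewrite ltry lte_fin; split => //; lra.
- by exists b, 0; rewrite !ltry addr0.
Qed.

Lemma adde_lt_split (x y : \bar R) (b : R) : (0 <= x)%E -> (0 <= y)%E ->
  (x + y < b%:E)%E -> exists b1 b2, [/\ (x < b1%:E)%E, (y < b2%:E)%E & b1 + b2 <= b].
Proof.
case: x => [x| |] //; case: y => [y| |] // x0 y0.
rewrite -EFinD lte_fin => xyb.
exists (x + (b - x - y) / 2), (y + (b - x - y) / 2).
by rewrite !lte_fin; split; lra.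
Qed.

End ereal_splitting.

(** * Goodness of the contracted rate *)

Section contraction.
Context {R : realType}.
Variables (JX kappa : R -> \bar R) (M : R) (J : Rplus (R := R) -> \bar R).
Hypothesis JX_good : good_rate_function JX.
Hypothesis kappa_ge0 : forall c : R, 0 <= c -> (0 <= kappa c)%E.
Hypothesis kappa_lsc : forall c b : R, 0 <= c -> (b%:E < kappa c)%E ->
  exists2 c', c' < c & forall x, 0 <= x -> c' < x -> (b%:E < kappa x)%E.
Hypothesis kappa_bdd : forall b : R,
  exists g, forall c : R, 0 <= c -> (kappa c <= b%:E)%E -> c <= g.
Hypothesis J_ge0 : forall x, (0 <= J x)%E.
Hypothesis J_le : forall r c : R, 0 <= c -> (J (clip (M * r * c)) <= JX r + kappa c)%E.
Hypothesis J_lt : forall x (a : R), (J x < a%:E)%E ->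
  exists r c, [/\ 0 <= c, clip (M * r * c) = x & (JX r + kappa c < a%:E)%E].

Let JX_ge0 r : (0 <= JX r)%E. Proof. exact: JX_good.1.1. Qed.

Let K (b : R) := [set p : R * R | 0 <= p.2 /\ (JX p.1 + kappa p.2 <= b%:E)%E].

Let closed_K b : closed (K b).
Proof.
rewrite -[K b]setCK; apply: open_closedC; rewrite openE => -[r c] /= nK.
have [c0|c0] := ltP c 0.
  have : nbhs (r, c) [set p : R * R | p.2 < 0].
    exists (setT, [set x | x < 0]) => /=; last by move=> [x y] [].
    by split; [exact: filterT|exact: lt_nbhsl].
  by apply: filterS => -[x y] /= y0 [] /=; rewrite leNgt y0.
have bJ : (b%:E < JX r + kappa c)%E.
  by rewrite ltNge; apply/negP => le_b; apply: nK.
have [b1 [b2 [bJX bk bb]]] := lt_adde_split (JX_ge0 r) (kappa_ge0 c0) bJ.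
have [A rA JA] := JX_good.1.2 r b1 bJX.
have [c' c'c kc'] := kappa_lsc c0 bk.
have : nbhs (r, c) (A `*` [set x | c' < x]).
  by exists (A, [set x | c' < x]) => //=; split => //; exact: lt_nbhsr.
apply: filterS => -[x y] [/= Ax c'y] [/= y0].
apply/negP; rewrite -ltNge; apply: (@le_lt_trans _ _ (b1%:E + b2%:E)%E).
  by rewrite -EFinD lee_fin.
by apply: lteD; [exact: JA|exact: kc'].
Qed.

(** Goodness of [JX] bounds the radius, [kappa_bdd] bounds c, and lower semicontinuity of both costs
    gives closedness. *)
Let compact_K b : compact (K b).
Proof.
have [g kg] := kappa_bdd b.
apply: (@subclosed_compact _ _ ([set r | (JX r <= b%:E)%E] `*` `[0, g]%classic)).
- exact: closed_K.
- by apply: compact_setX; [exact: JX_good.2|exact: segment_compact].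
move=> [r c] [/= c0 Jk]; split => /=.
  by apply: le_trans Jk; rewrite leeDl// kappa_ge0.
rewrite in_itv/= c0/=; apply: kg => //.
by apply: le_trans Jk; rewrite leeDr.
Qed.

Let F (p : R * R) := clip (M * p.1 * p.2).

Let continuous_F : continuous F.
Proof.
move=> p; apply: (@continuous_comp _ _ _ (fun p : R * R => M * p.1 * p.2) clip).
  apply: (@cvgM _ _ (nbhs p) _ (fun p => M * p.1) snd); last exact: cvg_snd.
  by apply: (@cvgM _ _ (nbhs p) _ (cst M) fst); [exact: cvg_cst|exact: cvg_fst].
exact: continuous_clip.
Qed.

Let compact_image b : compact (F @` K b).
Proof.
apply: continuous_compact; last exact: compact_K.
exact: continuous_subspaceT.
Qed.

(** [J_lt] yields a pair only under a strict inequality, as attainment of the infimum is not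
    assumed; hence the images at the levels a + 1/(n+1), which decrease to a. *)
Let sublevelE (a : R) : [set x | (J x <= a%:E)%E] =
  \bigcap_n (F @` K (a + n.+1%:R^-1)).
Proof.
apply/seteqP; split => x /=.
  move=> Jx n _; have : (J x < (a + n.+1%:R^-1)%:E)%E.
    by apply: le_lt_trans Jx _; rewrite lte_fin ltrDl invr_gt0.
  by move=> /J_lt[r [c [c0 <- Jk]]]; exists (r, c) => //; split => //=; exact: ltW.
move=> H; apply/lee_addgt0Pr => e e0.
have [n ne] : exists n : nat, n.+1%:R^-1 <= e.
  exists (Num.truncn e^-1); rewrite -[leRHS]invrK lef_pV2 ?posrE ?invr_gt0//.
  by apply/ltW; have := Num.Theory.truncnS_gt e^-1.
have [[r c] [/= c0 Jk] <-] := H n I.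
rewrite /F /=; apply: (le_trans (J_le r c0)); apply: (le_trans Jk).
by rewrite -EFinD lee_fin lerD2l.
Qed.

Let closed_sublevel a : closed [set x | (J x <= a%:E)%E].
Proof.
rewrite sublevelE; apply: closed_bigI => n _.
by apply: compact_closed; [exact: hausdorff_Rplus|exact: compact_image].
Qed.

Lemma contraction_good : good_rate_function J.
Proof.
split; [split=> //|move=> a].
  apply/lower_semicontinuousP => a.
  rewrite (_ : [set x | _] = ~` [set x | (J x <= a%:E)%E]).
    exact: closed_openC.
  by apply/seteqP; split => x /=; [move=> ax; apply/negP; rewrite -ltNge|move=> /negP; rewrite -ltNge].
apply: (@subclosed_compact _ _ (F @` K (a + 1%:R^-1))) => //.
by rewrite sublevelE => x /(_ 0%N I).
Qed.

End contraction.

(** * Upper and lower bounds for the product *)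

Section product_ldp.
Context {R : realType} {d : nat -> measure_display}.
Context {T : forall n, measurableType (d n)}.
Variables (P : forall n, probability (T n) R) (k : nat) (s : nat -> R).
Variables (Rad V : forall n, T n -> R) (Y : forall n, T n -> Rplus (R := R)).
Variables (JX kappa : R -> \bar R) (M : R) (J : Rplus (R := R) -> \bar R).
Hypothesis s_oo : s n @[n --> \oo] --> +oo.
Hypothesis mRad : forall n, (k <= n)%N -> measurable_fun [set: T n] (@Rad n).
Hypothesis mV : forall n, (k <= n)%N -> measurable_fun [set: T n] (@V n).
Hypothesis Rad_ge0 : forall n (w : T n), (k <= n)%N -> 0 <= Rad w.
Hypothesis V_ge0 : forall n (w : T n), (k <= n)%N -> 0 <= V w.
Hypothesis YE : forall n (w : T n), (k <= n)%N -> Y w = clip (Rad w * V w).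
Hypothesis indep : forall n, (k <= n)%N -> forall B C : set R, measurable B -> measurable C ->
  P n (@Rad n @^-1` B `&` @V n @^-1` C) = (P n (@Rad n @^-1` B) * P n (@V n @^-1` C))%E.
Hypothesis M_gt0 : 0 < M.
Hypothesis Rad_ldp : ldp_grf P Rad s JX.
Hypothesis kappa_ge0 : forall c : R, 0 <= c -> (0 <= kappa c)%E.
Hypothesis kappa_bdd : forall b : R,
  exists g, forall c : R, 0 <= c -> (kappa c <= b%:E)%E -> c <= g.
Hypothesis V_upper : forall c b : R, 0 <= c -> (b%:E < kappa c)%E ->
  exists2 c', c' < c & \forall n \near \oo,
    (P n [set w : T n | (M * c' <= V w)%R] <= (expR (- (s n * b)))%:E)%E.
Hypothesis V_lower : forall c a e : R, 0 <= c -> (kappa c < a%:E)%E -> 0 < e ->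
  \forall n \near \oo,
    ((expR (- (s n * a)))%:E <= P n [set w : T n | (`|V w - M * c| < e)%R])%E.
Hypothesis J_rate : rate_function J.
Hypothesis J_le : forall r c : R, 0 <= c -> (J (clip (M * r * c)) <= JX r + kappa c)%E.
Hypothesis J_lt : forall x (a : R), (J x < a%:E)%E ->
  exists r c, [/\ 0 <= c, clip (M * r * c) = x & (JX r + kappa c < a%:E)%E].

Let JX_ge0 r : (0 <= JX r)%E. Proof. exact: Rad_ldp.1.1.1. Qed.

Let near_s (x : R) : \forall n \near \oo, x <= s n.
Proof. by move/cvgryPge : s_oo; apply. Qed.

Let mset (n : nat) (f : T n -> R) (B : set R) : measurable_fun [set: T n] f ->
  measurable B -> measurable (f @^-1` B).
Proof. by move=> mf mB; rewrite -[X in measurable X]setTI; exact: mf. Qed.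

Let random_Y n : (k <= n)%N -> random_element (@Y n).
Proof.
move=> kn; rewrite (_ : @Y n = clip \o (fun w => Rad w * V w)); last first.
  by apply/funext => w /=; rewrite YE.
apply: random_element_comp; first exact: continuous_clip.
by apply/random_elementP; apply: measurable_funM; [exact: mRad|exact: mV].
Qed.

Let itvB (r e : R) : set R := `]r - e, r + e[%classic.

Let Rad_lower (r a e : R) : (JX r < a%:E)%E -> 0 < e -> \forall n \near \oo,
  ((expR (- (s n * a)))%:E <= P n (@Rad n @^-1` itvB r e))%E.
Proof.
move=> ra e0.
have bB : borel (itvB r e) by apply/borel_measurableE; exact: measurable_itv.
have [low _ _] := Rad_ldp.2.2 _ bB.
have : ((- a)%:E < limn_einf (fun n => (s n)^-1%:E * lne (P n (@Rad n @^-1` itvB r e))))%E.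
  apply: lt_le_trans low; rewrite EFinN lteN2; apply: le_lt_trans ra.
  apply: ereal_inf_lbound; exists r => //.
  rewrite /interior; apply: open_nbhs_nbhs; split; first exact: interval_open.
  by rewrite /itvB /= in_itv/= ltrBlDr ltrDl e0.
move=> /limn_einf_gt_near H; near=> n.
apply: lne_scaled_gt; first by apply: (@lt_le_trans _ _ 1) => //; near: n; exact: near_s.
by near: n.
Unshelve. all: by end_near. Qed.

Let Rad_upper (B : set R) (b : R) : closed B ->
  (b%:E < ereal_inf (JX @` B))%E -> \forall n \near \oo,
  (P n (@Rad n @^-1` B) <= (expR (- (s n * b)))%:E)%E.
Proof.
move=> cB bB.
have boB : borel B by apply/borel_measurableE; exact: closed_measurable.
have [_ _ up] := Rad_ldp.2.2 _ boB.
have : (limn_esup (fun n => (s n)^-1%:E * lne (P n (@Rad n @^-1` B))) < (- b)%:E)%E.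
  apply: le_lt_trans up _; rewrite EFinN lteN2.
  by rewrite (_ : closure B = B)//; apply/esym/closure_id.
move=> /limn_esup_lt_near H; near=> n.
apply: lne_scaled_lt; first by apply: (@lt_le_trans _ _ 1) => //; near: n; exact: near_s.
by near: n.
Unshelve. all: by end_near. Qed.

Section upper_bound.
Variables (G : set (Rplus (R := R))) (a a0 : R).
Hypothesis clG : closed G.
Hypothesis JG : forall x, G x -> (a%:E < J x)%E.
Hypothesis a0a : a0 < a.

(** The part of the event Y in G on which the pair lies in S has probability O(exp(-s a0)). The
    cover [D] spares any measurability of S, and the free constant makes the notion stable under
    finite unions. *)
Let negl (S : set (R * R)) := exists2 C : R, 0 <= C & \forall n \near \oo,
  exists D : set (T n), [/\ measurable D,
    (forall w, S (Rad w, V w) -> G (clip (Rad w * V w)) -> D w) &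
    (P n D <= (C * expR (- (s n * a0)))%:E)%E].

Let negl0 : negl set0.
Proof.
exists 0 => //; near=> n; exists set0; split => //.
by rewrite measure0 mul0r.
Unshelve. all: by end_near. Qed.

Let neglU S1 S2 : negl S1 -> negl S2 -> negl (S1 `|` S2).
Proof.
move=> [C1 C10 H1] [C2 C20 H2]; exists (C1 + C2); first exact: addr_ge0.
near=> n.
have [D1 [mD1 sD1 PD1]] : exists D : set (T n), [/\ measurable D,
    (forall w, S1 (Rad w, V w) -> G (clip (Rad w * V w)) -> D w) &
    (P n D <= (C1 * expR (- (s n * a0)))%:E)%E] by near: n.
have [D2 [mD2 sD2 PD2]] : exists D : set (T n), [/\ measurable D,
    (forall w, S2 (Rad w, V w) -> G (clip (Rad w * V w)) -> D w) &
    (P n D <= (C2 * expR (- (s n * a0)))%:E)%E] by near: n.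
exists (D1 `|` D2); split; first exact: measurableU.
  by move=> w [/sD1 h /h|/sD2 h /h]; [left|right].
rewrite (le_trans (measureU2 _ mD1 mD2))// mulrDl EFinD; exact: leeD.
Unshelve. all: by end_near. Qed.

Let neglS S1 S2 : S1 `<=` S2 -> negl S2 -> negl S1.
Proof.
move=> S12 [C C0 H]; exists C => //; apply: filterS H => n [D [mD sD PD]].
by exists D; split => // w /S12; exact: sD.
Qed.

(** Away from G there is nothing to bound, since G is closed. Otherwise a < J <= JX r + kappa c is
    split between the two factors. A half-line is enough for V because its tail estimate already
    starts below c. *)
Let negl_local (p : R * R) : 0 <= p.2 -> exists2 O, nbhs p O & negl O.
Proof.
case: p => r v /= v0.
pose c := v / M.
have c0 : 0 <= c by rewrite /c divr_ge0// ltW.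
have vE : v = M * c by rewrite /c mulrCA mulfV ?mulr1// gt_eqF.
have [rvG|rvG] := pselect (G (clip (r * v))); last first.
  pose O := [set p : R * R | ~ G (clip (p.1 * p.2))].
  exists O.
    have cF : {for (r, v), continuous (fun p : R * R => clip (p.1 * p.2))}.
      apply: (@continuous_comp _ _ _ (fun p : R * R => p.1 * p.2) clip).
        by apply: (@cvgM _ _ (nbhs (r, v)) _ fst snd); [exact: cvg_fst|exact: cvg_snd].
      exact: continuous_clip.
    apply: (cF (~` G)); apply: open_nbhs_nbhs; split => //.
    exact: closed_openC.
  exists 0 => //; near=> n; exists set0; split => //.
  by rewrite measure0 mul0r.
have := JG rvG; rewrite vE mulrCA mulrA => aJ.
have := lt_le_trans aJ (J_le r c0).
move=> /(lt_adde_split (JX_ge0 r) (kappa_ge0 c0))[b1 [b2 [bJX bk ab]]].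
have [A rA JA] := Rad_ldp.1.1.2 r b1 bJX.
have [c' c'c Vc'] := V_upper c0 bk.
have /nbhs_ballP[rho /= rho0 Arho] := rA.
pose B : set R := `[r - rho / 2, r + rho / 2]%classic.
have JB : (b1%:E <= ereal_inf (JX @` B))%E.
  apply: le_ereal_inf_tmp => _ [x /= xB <-]; apply/ltW/JA/Arho.
  move: xB; rewrite /B /ball /= in_itv/= => /andP[x1 x2].
  by rewrite ltr_distlC; apply/andP; split; lra.
exists (B `*` [set x | M * c' < x]).
  exists (B, [set x | M * c' < x]) => //=; split => /=.
    apply/nbhs_ballP; exists (rho / 2) => /=; first by rewrite divr_gt0.
    move=> x; rewrite /ball /= ltr_distlC => /andP[x1 x2].
    by rewrite /B /= in_itv/=; apply/andP; split; lra.
  by apply: lt_nbhsr; rewrite ltr_pM2l.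
(* [JB] is only a weak inequality; giving up a - a0 makes it strict and still leaves b1' + b2 >=
   a0. *)
pose b1' := b1 - (a - a0).
have b1'J : (b1'%:E < ereal_inf (JX @` B))%E.
  by apply: lt_le_trans JB; rewrite lte_fin /b1' ltrBlDr ltrDl subr_gt0.
have clB : closed B by exact: interval_closed.
have RB := Rad_upper clB b1'J.
exists 1 => //; near=> n.
have kn : (k <= n)%N by near: n; exact: nbhs_infty_ge.
have s0 : 0 <= s n by near: n; exact: near_s.
pose C := `[M * c', +oo[%classic : set R.
have VC : @V n @^-1` C = [set w : T n | M * c' <= V w].
  by apply/funext => w; rewrite /preimage /C /mkset in_itv/= andbT.
have mB : measurable (B : set R) by exact: measurable_itv.
have mC : measurable C by exact: measurable_itv.
exists (@Rad n @^-1` B `&` @V n @^-1` C); split.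
- by apply: measurableI; apply: mset => //; [exact: mRad|exact: mV].
- by move=> w [/= Bw cw] _; split => //=; rewrite /C /= in_itv/= andbT ltW.
rewrite indep// VC mul1r.
apply: (@le_trans _ _ ((expR (- (s n * b1')))%:E * (expR (- (s n * b2)))%:E)%E).
  by apply: lee_pmul => //; near: n.
rewrite -EFinM lee_fin -expRD ler_expR -opprD lerN2 -mulrDr.
by rewrite ler_wpM2l// /b1'; lra.
Unshelve. all: by end_near. Qed.

(* Otherwise the sets with negligible complement in [Q] form a proper filter,
   which clusters at a point of [Q] that has no negligible neighbourhood. *)
Let negl_compact (Q : set (R * R)) : compact Q -> (forall p, Q p -> 0 <= p.2) -> negl Q.
Proof.
move=> cQ Q0; apply: contrapT => nQ.
pose Fi : set_system (R * R) := [set S | negl (Q `\` S)].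
have properFi : ProperFilter Fi.
  split; first by rewrite /Fi /= setD0.
  split.
  - by rewrite /Fi /= setDT.
  - by move=> A B FA FB; rewrite /Fi /= setDIr; exact: neglU.
  - by move=> A B AB; apply: neglS => x [Qx nB]; split => // /AB.
have FiQ : Fi Q by rewrite /Fi /= setDv.
have [p [Qp clp]] := cQ Fi properFi FiQ.
have [W pW nW] := negl_local (Q0 p Qp).
have FnW : Fi (~` W) by rewrite /Fi /= setDE setCK; apply: neglS nW => x [].
by have [x [nWx Wx]] := clp _ _ FnW pW.
Qed.

(** Exponential tightness: outside a rectangle one of the two factors is large, with probability at
    most exp(-s a0) for each; the rectangle itself is compact. The resulting constant C + 2 is
    absorbed by a1 < a0. *)
Lemma product_ldp_upper (G' : set (Rplus (R := R))) (a1 : R) : a1 < a0 -> borel G' -> G' `<=` G ->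
  \forall n \near \oo, (P n (@Y n @^-1` G') <= (expR (- (s n * a1)))%:E)%E.
Proof.
move=> a1a0 bG' G'G.
have [rho rho0 JXrho] : exists2 rho, 0 <= rho & forall r, (JX r <= a%:E)%E -> r <= rho.
  have /compact_bounded[N [_ HN]] := Rad_ldp.1.2 a.
  exists (`|N| + 1) => // r ra.
  by rewrite (le_trans (ler_norm r))// (HN (`|N| + 1))// ltr_pwDr// ler_norm.
have [g kg] := kappa_bdd a.
(* Beyond the bound g of the level set, hence kappa c > a; nonnegative, as [V_upper] requires. *)
pose c := Num.max 0 (g + 1).
have c0 : 0 <= c by rewrite /c le_max lexx.
have kc : (a0%:E < kappa c)%E.
  rewrite (@lt_trans _ _ a%:E) ?lte_fin// ltNge; apply/negP => /(kg _ c0).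
  have : g + 1 <= c by rewrite /c le_max lexx orbT.
  by lra.
have [c' c'c Vc'] := V_upper c0 kc.
pose B : set R := `[rho + 1, +oo[%classic.
have JXB : (a0%:E < ereal_inf (JX @` B))%E.
  apply: (@lt_le_trans _ _ a%:E); first by rewrite lte_fin.
  apply: le_ereal_inf_tmp => _ [x /= + <-]; rewrite /B /= in_itv/= andbT => xrho.
  rewrite leNgt; apply/negP => /ltW /JXrho; lra.
have clB : closed B by exact: interval_closed.
have RB := Rad_upper clB JXB.
have [C C0 HC] : negl (`[0, rho + 1]%classic `*` `[0, M * c]%classic).
  apply: negl_compact; first by apply: compact_setX; exact: segment_compact.
  by move=> [x y] [/= _]; rewrite in_itv/= => /andP[].
near=> n.
have kn : (k <= n)%N by near: n; exact: nbhs_infty_ge.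
have PD1 : (P n (@Rad n @^-1` B) <= (expR (- (s n * a0)))%:E)%E by near: n.
have PD2 : (P n [set w : T n | (M * c' <= V w)%R] <= (expR (- (s n * a0)))%:E)%E by near: n.
have sC : (C + 2) / (a0 - a1) <= s n by near: n; exact: near_s.
have [D [mD sD PD]] : exists D : set (T n), [/\ measurable D,
    (forall w, (`[0, rho + 1]%classic `*` `[0, M * c]%classic) (Rad w, V w) ->
       G (clip (Rad w * V w)) -> D w) &
    (P n D <= (C * expR (- (s n * a0)))%:E)%E] by near: n.
pose D1 := @Rad n @^-1` B.
pose D2 := [set w : T n | M * c' <= V w].
have mD1 : measurable D1 by apply: (mset (mRad kn)); exact: measurable_itv.
have mD2 : measurable D2.
  rewrite (_ : D2 = @V n @^-1` `[M * c', +oo[); first by apply: (mset (mV kn)); exact: measurable_itv.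
  by apply/funext => w; rewrite /preimage /D2 /mkset in_itv/= andbT.
have sub : @Y n @^-1` G' `<=` D `|` (D1 `|` D2).
  move=> w /= /G'G; rewrite YE// => Gw.
  have [|Rr] := leP (rho + 1) (Rad w).
    by move=> Rr; right; left; rewrite /D1 /B /= in_itv/= andbT.
  have [|Vv] := leP (M * c') (V w); first by move=> Vv; right; right.
  left; apply: sD => //; split; rewrite /= in_itv/=.
    by rewrite Rad_ge0//= ltW.
  by rewrite V_ge0//= (le_trans (ltW Vv))// ler_pM2l// ltW.
apply: (@le_trans _ _ (P n (D `|` (D1 `|` D2)))).
  rewrite le_measure ?inE//; first exact: random_Y.
  by apply: measurableU => //; exact: measurableU.
apply: (le_trans (measureU2 _ mD (measurableU _ _ mD1 mD2))).
apply: (@le_trans _ _ (((C + 2) * expR (- (s n * a0)))%:E)).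
  rewrite (_ : (C + 2) * expR (- (s n * a0)) = C * expR (- (s n * a0)) +
    (expR (- (s n * a0)) + expR (- (s n * a0)))); last by ring.
  rewrite EFinD (EFinD (expR _)) leeD//.
  by rewrite (le_trans (measureU2 _ mD1 mD2))// leeD.
rewrite lee_fin (_ : - (s n * a1) = s n * (a0 - a1) + - (s n * a0)); last by ring.
rewrite expRD ler_pM2r ?expR_gt0// (le_trans _ (expR_ge1Dx _))//.
by move: sC; rewrite ler_pdivrMr ?subr_gt0//; lra.
Unshelve. all: by end_near. Qed.

End upper_bound.

Lemma product_ldp : ldp P Y s J.
Proof.
split=> // G bG /=; split.
(* Lower bound: around a nearly optimal pair there is a rectangle whose products stay in G, and
   independence adds the two exponents. *)
- apply: lee_of_real_gt => a /ereal_inf_lt[_ [x Gx <-]] Jxa.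
  have [r [c [c0 rcx Jk]]] := J_lt Jxa.
  have [a1 [a2 [Ja1 ka2 a12]]] := adde_lt_split (JX_ge0 r) (kappa_ge0 c0) Jk.
  have cF : {for (r, M * c), continuous (fun p : R * R => clip (p.1 * p.2))}.
    apply: (@continuous_comp _ _ _ (fun p : R * R => p.1 * p.2) clip).
      by apply: (@cvgM _ _ (nbhs (r, M * c)) _ fst snd); [exact: cvg_fst|exact: cvg_snd].
    exact: continuous_clip.
  have : nbhs (r, M * c) [set p : R * R | G (clip (p.1 * p.2))].
    by apply: (cF G); rewrite mulrCA mulrA rcx.
  move=> /nbhs_ballP[e /= e0 eG].
  have Rl := Rad_lower Ja1 e0.
  have Vl := V_lower c0 ka2 e0.
  apply: limn_einf_ge_near; near=> n.
  have kn : (k <= n)%N by near: n; exact: nbhs_infty_ge.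
  have s1 : 1 <= s n by near: n; exact: near_s.
  have s0 : 0 < s n by exact: lt_le_trans s1.
  apply: lne_scaled_ge => //.
  pose C := `]M * c - e, M * c + e[%classic : set R.
  have VC : @V n @^-1` C = [set w : T n | `|V w - M * c| < e].
    by apply/funext => w; rewrite /preimage /C /mkset in_itv/= ltr_distl.
  have mB : measurable (itvB r e) by exact: measurable_itv.
  have mC : measurable C by exact: measurable_itv.
  apply: (@le_trans _ _ (P n (@Rad n @^-1` itvB r e `&` @V n @^-1` C))).
    rewrite indep// VC; apply: (@le_trans _ _ ((expR (- (s n * a1)))%:E * (expR (- (s n * a2)))%:E)%E).
      rewrite -EFinM lee_fin -expRD ler_expR -opprD lerN2 -mulrDr.
      by rewrite ler_wpM2l// ltW.
    by apply: lee_pmul => //; rewrite ?lee_fin ?expR_ge0//; near: n.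
  rewrite le_measure ?inE//.
  - by apply: measurableI; apply: mset => //; [exact: mRad|exact: mV].
  - exact: random_Y.
  move=> w [/= Rw Vw]; rewrite YE//; apply: (eG (Rad w, V w)).
  move: Rw Vw; rewrite /C /itvB /= !in_itv/= -!ltr_distl => Rw Vw.
  by split; rewrite /ball /= distrC.
- exact: limn_einf_sup.
(* Upper bound: the chain a < (a + b) / 2 < b below the infimum provides the two margins that
   [product_ldp_upper] uses. *)
- apply: lee_of_real_lt => a aJ.
  have [b ab bJ] : exists2 b : R, a < b & (b%:E < ereal_inf (J @` closure G))%E.
    case: (ereal_inf _) aJ => [x| |] //.
      by rewrite lte_fin => ax; exists ((a + x) / 2); rewrite ?lte_fin; lra.
    by move=> _; exists (a + 1); rewrite ?ltry//; lra.
  have JG x : closure G x -> (b%:E < J x)%E.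
    by move=> Gx; apply: lt_le_trans bJ _; apply: ereal_inf_lbound; exists x.
  have ab2 : (a + b) / 2 < b by lra.
  have aab : a < (a + b) / 2 by lra.
  have H := product_ldp_upper (@closed_closure _ G) JG ab2 aab bG (@subset_closure _ G).
  apply: limn_esup_le_near; near=> n.
  apply: lne_scaled_le; last by near: n.
  by apply: (@lt_le_trans _ _ 1) => //; near: n; exact: near_s.
Unshelve. all: by end_near. Qed.

End product_ldp.

(** * The rate function *)

Section costs.
Context {R : realType}.
Implicit Types a b c : R.

(** For c >= 1 both sides hold whatever b is, since 1 - exp(-2 b) < 1; one inequality on c^2 thus
    covers finite and infinite costs. *)
Lemma cost_A_gt b c : 0 <= c -> (b%:E < cost_A c)%E = (1 - expR (- (2 * b)) < c ^+ 2).
Proof.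
move=> c0; rewrite /cost_A; case: (ltP c 1) => [c1|c1].
  have v0 : 0 < 1 - c ^+ 2 by rewrite subr_gt0 expr_lt1.
  rewrite lte_fin ltrBlDr -ltrBlDl -[X in X < expR _](lnK (x := 1 - c ^+ 2)) ?posrE//.
  by rewrite ltr_expR; apply/idP/idP; lra.
rewrite ltry; apply/esym; apply: (@lt_le_trans _ _ 1).
  by rewrite gtrBl expR_gt0.
by rewrite expr_ge1.
Qed.

Lemma cost_A_lt a c : 0 <= c -> (cost_A c < a%:E)%E = (c ^+ 2 < 1 - expR (- (2 * a))).
Proof.
move=> c0; rewrite /cost_A; case: (ltP c 1) => [c1|c1].
  have v0 : 0 < 1 - c ^+ 2 by rewrite subr_gt0 expr_lt1.
  rewrite lte_fin ltrBrDl -ltrBrDr -[X in expR _ < X](lnK (x := 1 - c ^+ 2)) ?posrE//.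
  by rewrite ltr_expR; apply/idP/idP; lra.
apply/esym/negbTE; rewrite -leNgt; apply: (@le_trans _ _ 1).
  by rewrite gerBl expR_ge0.
by rewrite expr_ge1.
Qed.

Lemma cost_A0 : cost_A (0 : R) = 0%E.
Proof. by rewrite /cost_A ltr01 expr0n subr0 ln1 mulr0 oppr0. Qed.

Lemma cost_B0 : cost_B (0 : R) = 0%E.
Proof. by rewrite /cost_B expr0n mul0r. Qed.

Lemma cost_B_gt b c : (b%:E < cost_B c)%E = (2 * b < c ^+ 2).
Proof. by rewrite lte_fin; apply/idP/idP; lra. Qed.

Lemma cost_B_lt a c : (cost_B c < a%:E)%E = (c ^+ 2 < 2 * a).
Proof. by rewrite lte_fin; apply/idP/idP; lra. Qed.

Lemma cost_A_ge0 c : 0 <= c -> (0 <= cost_A c)%E.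
Proof.
move=> c0; rewrite /cost_A; case: ifPn => [c1|_]; last exact: leey.
rewrite lee_fin oppr_ge0 mulr_ge0_le0 ?invr_ge0//.
by rewrite ln_le0// gerBl sqr_ge0.
Qed.

Lemma cost_B_ge0 c : (0 <= cost_B c)%E.
Proof. by rewrite lee_fin divr_ge0// sqr_ge0. Qed.

(* Both costs are increasing functions of [c ^+ 2], with inverse [psi]. *)
Variables (kappa : R -> \bar R) (psi : R -> R).
Hypothesis kappa0 : kappa 0 = 0%E.
Hypothesis kappa_gt : forall b c, 0 <= c -> (b%:E < kappa c)%E = (psi b < c ^+ 2).
Hypothesis kappa_lt : forall a c, 0 <= c -> (kappa c < a%:E)%E = (c ^+ 2 < psi a).

Hypothesis kappa_ge0 : forall c, 0 <= c -> (0 <= kappa c)%E.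

Lemma cost_le c c' : 0 <= c -> c <= c' -> (kappa c <= kappa c')%E.
Proof.
move=> c0 cc'; have c'0 := le_trans c0 cc'.
have := kappa_ge0 c'0; have := fun b => kappa_gt b c'0; case: (kappa c') => [x gt'| |]//.
  move=> _; rewrite leNgt; apply/negP; rewrite kappa_gt// => xc.
  have : (x%:E < x%:E)%E; last by rewrite ltxx.
  by rewrite gt' (lt_le_trans xc)// lerXn2r ?nnegrE.
by move=> _ _; rewrite leey.
Qed.

Lemma cost_ltW c c' : 0 <= c -> c < c' -> (kappa c < +oo)%E -> (kappa c < kappa c')%E.
Proof.
move=> c0 cc'; have c'0 := ltW (le_lt_trans c0 cc').
have := kappa_ge0 c0; have := fun a => kappa_lt a c0; case: (kappa c) => [x lt'| |]// _ _.
rewrite kappa_gt//; apply: (@le_lt_trans _ _ (c ^+ 2)).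
  by rewrite leNgt -lt' ltxx.
by rewrite ltr_pXn2r ?nnegrE.
Qed.

Lemma cost_rc c a : 0 <= c -> (kappa c < a%:E)%E ->
  exists2 c', c < c' & (kappa c' < a%:E)%E.
Proof.
move=> c0; rewrite kappa_lt// => ca; have c20 := sqr_ge0 c.
have m0 : 0 <= (c ^+ 2 + psi a) / 2 by lra.
exists (Num.sqrt ((c ^+ 2 + psi a) / 2)).
  rewrite -(@ltr_pXn2r _ 2)// ?nnegrE ?sqrtr_ge0// sqr_sqrtr//; lra.
by rewrite kappa_lt ?sqrtr_ge0// sqr_sqrtr//; lra.
Qed.

Lemma cost_lsc c b : 0 <= c -> (b%:E < kappa c)%E ->
  exists2 c', c' < c & forall x : R, 0 <= x -> c' < x -> (b%:E < kappa x)%E.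
Proof.
move=> c0; rewrite kappa_gt// => bc.
have [b0|b0] := ltP (psi b) 0.
  exists (c - 1); first by rewrite gtrBl.
  by move=> x x0 _; rewrite kappa_gt// (lt_le_trans b0)// sqr_ge0.
exists (Num.sqrt (psi b)).
  by rewrite -(@ltr_pXn2r _ 2)// ?nnegrE ?sqrtr_ge0// sqr_sqrtr.
move=> x x0; rewrite kappa_gt// -(@ltr_pXn2r _ 2)// ?nnegrE ?sqrtr_ge0//.
by rewrite sqr_sqrtr.
Qed.

Lemma cost_bdd b : exists g : R, forall c : R, 0 <= c -> (kappa c <= b%:E)%E -> c <= g.
Proof.
exists (Num.sqrt (psi b)) => c c0; rewrite leNgt kappa_gt// -leNgt => cb.
by rewrite -[leLHS](ger0_norm c0) -sqrtr_sqr ler_wsqrtr.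
Qed.

End costs.

(** * Reduction of the rate to pairs of numbers *)

Section rate_con_contraction.
Context {R : realType} (q : R) (q0 : 0 < q) (k : nat) (th : 'cV[R]_k).
Hypothesis th1 : sqn th = 1.
Let M := qnorm q th.
Hypothesis M0 : 0 < M.
Hypothesis Mmax : forall z : 'cV[R]_k, qnorm q z <= M * Num.sqrt (sqn z).
Variables (JX kappa : R -> \bar R) (D : set R) (I : 'cV[R]_k -> \bar R).
Hypothesis JX_ge0 : forall r, (0 <= JX r)%E.
Hypothesis JX_lt : forall a : R, 0 < a -> exists r, (JX r < a%:E)%E.
Hypothesis kappa0 : kappa 0 = 0%E.
Hypothesis kappa_ge0 : forall c : R, 0 <= c -> (0 <= kappa c)%E.
Hypothesis kappa_le : forall c c' : R, 0 <= c -> c <= c' -> (kappa c <= kappa c')%E.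
Hypothesis D_gt0 : forall c, D c -> 0 < c.
Hypothesis D_kappa : forall c : R, 0 < c -> (kappa c < +oo)%E -> D c.
Hypothesis I0 : I 0 = 0%E.
Hypothesis IE : forall z, z != 0 ->
  I z = ereal_inf [set (JX (qnorm 2 z / c)%R + kappa c)%E | c in D].

Let I_ge0 z : (0 <= I z)%E.
Proof.
have [->|/IE ->] := eqVneq z 0; first by rewrite I0.
apply: le_ereal_inf_tmp => _ [c Dc <-].
by rewrite adde_ge0// kappa_ge0// ltW// D_gt0.
Qed.

Lemma rate_con_ge0 x : (0 <= rate_con q I x)%E.
Proof. by apply: le_ereal_inf_tmp => _ [z _ <-]. Qed.

(** The witness is z = r c [th], whose norms are r c and M r c. If the product is not positive, the
    clipped value is 0 and z = 0 has rate 0. *)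
Lemma rate_con_le (r c : R) : 0 <= c ->
  (rate_con q I (clip (M * r * c)) <= JX r + kappa c)%E.
Proof.
move=> c0; have sum0 : (0 <= JX r + kappa c)%E by rewrite adde_ge0// kappa_ge0.
have [x0|x0] := leP (M * r * c) 0.
  apply: le_trans sum0; rewrite -I0; apply: ereal_inf_lbound; exists 0 => //=.
  by rewrite qnorm0// set_val_clip max_r.
have c_gt0 : 0 < c.
  by rewrite lt_def c0 andbT; apply: contraTneq x0 => ->; rewrite mulr0 ltxx.
have r0 : 0 < r.
  by move: x0; rewrite pmulr_lgt0// pmulr_rgt0.
have [kfin|] := ltP (kappa c) +oo%E; last first.
  by rewrite leye_eq => /eqP ->; rewrite addey ?leey// gt_eqF// (lt_le_trans _ (JX_ge0 r)).
have rc0 : 0 < r * c by rewrite mulr_gt0.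
pose z := (r * c) *: th.
have sz : sqn z = (r * c) ^+ 2 by rewrite sqnZ th1 mulr1.
have z0 : z != 0.
  apply/eqP => z0; move: sz; rewrite z0 /sqn big1 => [/esym/eqP|i _].
    by rewrite sqrf_eq0 gt_eqF.
  by rewrite mxE expr0n.
have nz : qnorm 2 z / c = r.
  by rewrite qnorm2E sz sqrtr_sqr gtr0_norm// mulfK// gt_eqF.
apply: (@le_trans _ _ (I z)).
  apply: ereal_inf_lbound; exists z => //=.
  by rewrite set_val_clip qnormZ// gtr0_norm// max_l ?(ltW x0)// mulrC mulrA.
rewrite IE//; apply: ereal_inf_lbound; exists c; first exact: D_kappa.
by rewrite nz.
Qed.

(** Keep the radius r = |z| / c and turn the direction to [th]: the q-norm x is then reached at the
    level x / (M r), which is at most c because x <= M |z|, so the cost does not grow. For z = 0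
    take c = 0 and a radius of small rate. *)
Lemma rate_con_lt x (a : R) : (rate_con q I x < a%:E)%E ->
  exists r c, [/\ 0 <= c, clip (M * r * c) = x & (JX r + kappa c < a%:E)%E].
Proof.
move=> /ereal_inf_lt[_ [z /= zx <-]] Iza.
have x0 : 0 <= set_val x :> R by exact: (set_mem (valP x)).
have [zE|z0] := eqVneq z 0.
  have a0 : 0 < a by rewrite -lte_fin (le_lt_trans _ Iza).
  have [r Jr] := JX_lt a0; exists r, 0; split => //; last by rewrite kappa0 adde0.
  by rewrite mulr0 -(clipK x) -zx zE qnorm0.
move: Iza; rewrite IE// => /ereal_inf_lt[_ [c Dc <-]] Jk.
have c0 := D_gt0 Dc.
have sz : 0 < Num.sqrt (sqn z).
  by rewrite sqrtr_gt0 lt_def sqn_ge0 andbT; apply: contra z0 => /eqP/sqn_eq0 ->.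
pose r := qnorm 2 z / c.
have r0 : 0 < r by rewrite /r qnorm2E divr_gt0.
have Mr0 : 0 < M * r by rewrite mulr_gt0.
exists r, (set_val x / (M * r)); split.
- by rewrite divr_ge0// ltW.
- by rewrite mulrCA mulfV ?gt_eqF// mulr1 clipK.
apply: le_lt_trans Jk; rewrite leeD2l//; apply: kappa_le.
  by rewrite divr_ge0// ltW.
rewrite ler_pdivrMr// -zx (le_trans (Mmax z))// /r qnorm2E.
by rewrite mulrCA (mulrC c) divfK ?gt_eqF.
Qed.

End rate_con_contraction.

Section zero_infimum.
Context {R : realType} {d : nat -> measure_display}.
Context {T : forall n, measurableType (d n)}.

(** The upper bound for the whole space, which has probability 1, forces the infimum of the rate to
    be at most 0. *)
Lemma ldp_rate_lt (P : forall n, probability (T n) R) (X : topologicalType)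
    (eta : forall n, T n -> X) (s : nat -> R) (I : X -> \bar R) (a : R) :
  ldp P eta s I -> 0 < a -> exists x, (I x < a%:E)%E.
Proof.
move=> [_ ldpI] a0.
have bT : borel [set: X] by apply: sub_sigma_algebra; exact: openT.
have [_ _ up] := ldpI _ bT.
have : (ereal_inf (I @` closure [set: X]) <= 0)%E.
  rewrite -leeN2 oppe0; apply: le_trans up.
  apply: le_trans (limn_einf_sup _); apply: limn_einf_ge_near.
  apply: nearW => n; rewrite preimage_setT probability_setT lne1 mule0//.
move=> /le_lt_trans; rewrite -lte_fin in a0; move=> /(_ _ a0).
by move=> /ereal_inf_lt[_ [x _ <-]] Ia; exists x.
Qed.

End zero_infimum.

Section equal_laws.
Context {R : realType} {d : measure_display} {T : measurableType d}.
Variables (P : probability T R) (f g : T -> R).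
Hypothesis fg : forall C, measurable C -> P (f @^-1` C) = P (g @^-1` C).

Lemma equal_law_ge (c p : R) :
  (P [set w : T | (c <= g w)%R] <= p%:E)%E -> (P [set w : T | (c <= f w)%R] <= p%:E)%E.
Proof.
have E (h : T -> R) : [set w : T | c <= h w] = h @^-1` `[c, +oo[.
  by apply/funext => w; rewrite /preimage /mkset in_itv/= andbT.
by rewrite !E fg.
Qed.

Lemma equal_law_near (c e p : R) :
  (p%:E <= P [set w : T | (`|g w - c| < e)%R])%E ->
  (p%:E <= P [set w : T | (`|f w - c| < e)%R])%E.
Proof.
have E (h : T -> R) : [set w : T | `|h w - c| < e] = h @^-1` `]c - e, c + e[.
  by apply/funext => w; rewrite /preimage /mkset in_itv/= ltr_distl.
by rewrite !E fg.
Qed.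

End equal_laws.

(** * Both regimes at once: radius times direction *)

Section radial_ldp.
Context {R : realType} (k : nat) (q : R) (k_gt0 : (0 < k)%N) (q_gt0 : 0 < q).
Context {d : nat -> measure_display} {T : forall n, measurableType (d n)}.
Variables (P : forall n, probability (T n) R).
Variables (X : forall n, T n -> 'cV[R]_n) (A : forall n, T n -> 'M[R]_(n, k)).
Hypothesis rX : forall n, (k <= n)%N -> random_element (@X n).
Hypothesis rA : forall n, (k <= n)%N -> random_element (@A n).
Hypothesis hA : forall n, (k <= n)%N -> haar_stiefel (P n) (@A n).
Hypothesis indep : forall n, (k <= n)%N -> independent_elements (P n) (@X n) (@A n).
Variables (s r alpha : nat -> R) (kappa : R -> \bar R) (psi : R -> R) (JX : R -> \bar R).
Hypothesis s_oo : s n @[n --> \oo] --> +oo.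
Hypothesis r_gt0 : forall n, (k <= n)%N -> 0 < r n.
Hypothesis alpha_ge0 : forall n, (k <= n)%N -> 0 <= alpha n.
Hypothesis alpha_r : forall n, (k <= n)%N ->
  alpha n * (Num.sqrt (r n))^-1 = (Num.sqrt n%:R)^-1.
Hypothesis kappa0 : kappa 0 = 0%E.
Hypothesis kappa_ge0 : forall c : R, 0 <= c -> (0 <= kappa c)%E.
Hypothesis kappa_gt : forall b c : R, 0 <= c -> (b%:E < kappa c)%E = (psi b < c ^+ 2).
Hypothesis kappa_lt : forall a c : R, 0 <= c -> (kappa c < a%:E)%E = (c ^+ 2 < psi a).
Hypothesis upper : forall c b : R, 0 < c -> (b%:E < kappa c)%E ->
  exists2 c', 0 < c' < c & \forall n \near \oo,
    (P n [set w : T n | (c' ^+ 2 * r n <= sqn ((A w)^T *m unit_cV n))%R] <=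
     (expR (- (s n * b)))%:E)%E.
Hypothesis lower : forall (th : 'cV[R]_k) (c c' a : R), sqn th = 1 ->
  0 < c -> c < c' -> (kappa c' < a%:E)%E ->
  \forall n \near \oo, ((expR (- (s n * a)))%:E <=
    P n [set w : T n | (c ^+ 2 * r n <= dotp ((A w)^T *m unit_cV n) th ^+ 2 <=
                        c' ^+ 2 * r n)%R])%E.
Variable Rad : forall n, T n -> R.
Hypothesis RadE : forall n (w : T n), Rad w = alpha n * Num.sqrt (sqn (X w)).
Hypothesis Rad_ldp : ldp_grf P Rad s JX.
Variables (D : set R) (I : 'cV[R]_k -> \bar R).
Hypothesis D_gt0 : forall c, D c -> 0 < c.
Hypothesis D_kappa : forall c : R, 0 < c -> (kappa c < +oo)%E -> D c.
Hypothesis I0 : I 0 = 0%E.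
Hypothesis IE : forall z, z != 0 ->
  I z = ereal_inf [set (JX (qnorm 2 z / c)%R + kappa c)%E | c in D].

(** [V] follows the direction of X, so that Rad * V is exactly the variable of the theorem; [W] uses
    a fixed unit vector, for which the tail estimates are available. The two have the same law. *)
Let V n (w : T n) : R :=
  (Num.sqrt (r n))^-1 * qnorm q ((A w)^T *m direction (unit_cV n) (X w)).
Let W n (w : T n) : R := (Num.sqrt (r n))^-1 * qnorm q ((A w)^T *m unit_cV n).

Let n_gt0 n : (k <= n)%N -> (0 < n)%N. Proof. exact: leq_trans. Qed.

Let mScale (c : R) (B : set R) : measurable B -> measurable [set x : R | B (c * x)].
Proof.
move=> mB; have : measurable_fun [set: R] (fun x : R => c * x).
  by apply: measurable_funM; [exact: measurable_cst|exact: measurable_id].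
by move=> /(_ measurableT B mB); rewrite setTI.
Qed.

Let independent_Rad_V n : (k <= n)%N -> forall B C : set R,
  measurable B -> measurable C ->
  P n (@Rad n @^-1` B `&` @V n @^-1` C) = (P n (@Rad n @^-1` B) * P n (@W n @^-1` C))%E.
Proof.
move=> kn B C mB mC.
have := @independent_direction R _ _ (P n) n k q (@X n) (@A n) (rX kn) (rA kn) (hA kn)
  (indep kn) (unit_cV n) _ _ (sqn_unit_cV (n_gt0 kn)) (mScale (alpha n) mB)
  (mScale (Num.sqrt (r n))^-1 mC).
have -> : [set w : T n | [set x | B (alpha n * x)] (Num.sqrt (sqn (X w)))] = @Rad n @^-1` B.
  by apply/funext => w; rewrite /preimage /mkset RadE.
by [].
Qed.

Let law_V n (C : set R) : (k <= n)%N -> measurable C ->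
  P n (@V n @^-1` C) = P n (@W n @^-1` C).
Proof.
move=> kn mC; have := independent_Rad_V kn measurableT mC.
by rewrite preimage_setT setTI probability_setT mul1e.
Qed.

Let law_V_ge n (kn : (k <= n)%N) :=
  equal_law_ge (f := @V n) (g := @W n) (fun C => @law_V n C kn).

Let law_V_near n (kn : (k <= n)%N) :=
  equal_law_near (f := @V n) (g := @W n) (fun C => @law_V n C kn).

Let measurable_Rad n : (k <= n)%N -> measurable_fun [set: T n] (@Rad n).
Proof.
move=> kn; rewrite (_ : @Rad n = fun w => alpha n * Num.sqrt (sqn (X w))); last first.
  by apply/funext => w; rewrite RadE.
apply: measurable_funM; first exact: measurable_cst.
apply: (measurableT_comp (@continuous_measurable_fun R (@Num.sqrt R) _)).
  exact: sqrt_continuous.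
by apply: measurable_sum => i; apply: measurable_funX; exact: measurable_coord (rX kn).
Qed.

Let measurable_direction n i : (k <= n)%N ->
  measurable_fun [set: T n] (fun w : T n => direction (unit_cV n) (X w) i 0).
Proof.
move=> kn.
have msq : measurable_fun [set: T n] (fun w : T n => sqn (X w)).
  by apply: measurable_sum => j; apply: measurable_funX; exact: measurable_coord (rX kn).
rewrite (_ : (fun w => _) = fun w : T n =>
    if sqn (X w) == 0 then unit_cV n i 0
    else (Num.sqrt (sqn (X w))) `^ (-1) * X w i 0); last first.
  apply/funext => w; rewrite /direction; case: ifP => // _.
  by rewrite mxE powR_inv1// sqrtr_ge0.
apply: measurable_fun_ifT => /=.
- by apply: measurable_fun_eqr => //; exact: measurable_cst.
- exact: measurable_cst.
- apply: measurable_funM; last exact: measurable_coord (rX kn).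
  apply: (measurableT_comp (measurable_powR (-1))).
  apply: (measurableT_comp (@continuous_measurable_fun R (@Num.sqrt R) _)) => //.
  exact: sqrt_continuous.
Qed.

Let measurable_V n : (k <= n)%N -> measurable_fun [set: T n] (@V n).
Proof.
move=> kn; apply: measurable_funM; first exact: measurable_cst.
apply: measurable_qnorm => i.
rewrite (_ : (fun w : T n => _) = fun w : T n =>
    \sum_j A w j i * direction (unit_cV n) (X w) j 0); last first.
  by apply/funext => w; rewrite mxE; apply: eq_bigr => j _; rewrite mxE.
apply: measurable_sum => j; apply: measurable_funM.
  exact: measurable_coord (rA kn).
exact: measurable_direction.
Qed.

Let YE n (w : T n) : (k <= n)%N ->
  scaled_qnorm q n ((A w)^T *m X w) = clip (Rad w * V w).
Proof.
move=> kn; apply: val_inj => /=.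
rewrite max_l; last first.
  rewrite RadE /V !mulr_ge0 ?alpha_ge0 ?invr_ge0 ?sqrtr_ge0//; exact: qnorm_ge0.
rewrite RadE /V mulrACA alpha_r//.
rewrite [in LHS](direction_eq (unit_cV n) (X w)) -scalemxAr qnormZ//.
by rewrite ger0_norm ?sqrtr_ge0.
Qed.

Lemma radial_ldp : ldp_grf P (fun n w => scaled_qnorm q n ((@A n w)^T *m @X n w)) s
  (rate_con q I).
Proof.
have [th [th1 M0 Mmax]] := qnorm_max q_gt0 k_gt0.
have JX_ge0 : forall x, (0 <= JX x)%E := Rad_ldp.1.1.1.
have k_le := cost_le kappa_gt kappa_ge0.
have J_le := rate_con_le q_gt0 th1 M0 JX_ge0 kappa_ge0 D_kappa I0 IE.
have J_lt := rate_con_lt q_gt0 M0 Mmax JX_ge0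
  (fun a a0 => ldp_rate_lt Rad_ldp.2 a0) kappa0 kappa_ge0 k_le D_gt0 I0 IE.
have J_ge0 := rate_con_ge0 q JX_ge0 kappa_ge0 D_gt0 I0 IE.
have J_good := contraction_good Rad_ldp.1 kappa_ge0 (cost_lsc kappa_gt)
  (cost_bdd kappa_gt) J_ge0 (M := qnorm q th) J_le J_lt.
split=> //.
have mU n : (k <= n)%N -> forall l,
    measurable_fun [set: T n] (fun w : T n => ((A w)^T *m unit_cV n) l 0).
  by move=> kn l; apply: measurable_first_row; [exact: n_gt0|exact: rA].
have r_near : \forall n \near \oo, 0 < r n.
  by near=> n; apply: r_gt0; near: n; exact: nbhs_infty_ge.
have W_upper := V_upper M0 Mmax mU s_oo r_near kappa0 upper.
have W_lower := V_lower (P := P) (U := fun n (w : T n) => (A w)^T *m unit_cV n)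
  q_gt0 th1 mU s_oo r_near kappa0 (cost_ltW kappa_gt kappa_lt kappa_ge0) k_le
  (cost_rc kappa_lt) upper (fun c c' a => @lower th c c' a th1).
have Rad_ge0 n (w : T n) : (k <= n)%N -> 0 <= Rad w.
  by move=> kn; rewrite RadE mulr_ge0 ?alpha_ge0 ?sqrtr_ge0.
have V_ge0 n (w : T n) : (k <= n)%N -> 0 <= V w.
  by move=> kn; rewrite /V; apply: mulr_ge0; [rewrite invr_ge0; exact: sqrtr_ge0|exact: powR_ge0].
have indep_V n : (k <= n)%N -> forall B C : set R, measurable B -> measurable C ->
    P n (@Rad n @^-1` B `&` @V n @^-1` C) = (P n (@Rad n @^-1` B) * P n (@V n @^-1` C))%E.
  move=> kn B C mB mC; apply: etrans (independent_Rad_V kn mB mC) _.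
  exact: (congr1 (fun x => (_ * x)%E) (esym (law_V kn mC))).
apply: (product_ldp (P := P) (Rad := Rad) (V := V) (k := k) (M := qnorm q th)
  (kappa := kappa) s_oo measurable_Rad measurable_V Rad_ge0 V_ge0 YE indep_V M0
  Rad_ldp kappa_ge0 (cost_bdd kappa_gt) _ _ J_good.1 J_le J_lt).
- move=> c b c0 bc; have [c' c'c H] := W_upper c b c0 bc.
  exists c'; first exact: c'c.
  by apply: filterS2 (nbhs_infty_ge k) H => n kn; exact: law_V_ge.
- move=> c a e c0 ca e0; have H := W_lower c a e c0 ca e0.
  by apply: filterS2 (nbhs_infty_ge k) H => n kn; exact: law_V_near.
Unshelve. all: by end_near. Qed.

End radial_ldp.

Theorem corollary2p8 (R : realType) (k : nat) (q : R)
    (d : nat -> measure_display) (T : forall n, measurableType (d n))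
    (P : forall n, probability (T n) R)
    (X : forall n, T n -> 'cV[R]_n) (A : forall n, T n -> 'M[R]_(n, k))
    (s : nat -> R) (JX : R -> \bar R)
    (k_gt0 : (0 < k)%N) (q_gt0 : 0 < q)
    (X_random : forall n, (k <= n)%N -> random_element (X n))
    (A_random : forall n, (k <= n)%N -> random_element (A n))
    (A_haar : forall n, (k <= n)%N -> haar_stiefel (P n) (A n))
    (XA_indep : forall n, (k <= n)%N -> independent_elements (P n) (X n) (A n))
    (s_gt0 : forall n, (k <= n)%N -> 0 < s n) :
  let Y n w := scaled_qnorm q n ((A n w)^T *m X n w) in
  (assumption_A k P X s JX ->
     ldp_grf P Y s (rate_con q (rate_AX_A JX (k := k)))) /\
  (assumption_B P X s JX ->
     ldp_grf P Y s (rate_con q (rate_AX_B JX (k := k)))).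
Proof.
split=> [[sE Rad_ldp]|[s_oo ns_oo Rad_ldp]].
- have sE_near : \forall n \near \oo, s n = n%:R.
    by apply: filterS (nbhs_infty_ge k) => n; exact: sE.
  have s_oo : s n @[n --> \oo] --> +oo.
    apply/cvgryPge => x; apply: filterS2 sE_near (nbhs_infty_ger x) => n ->.
    by [].
  (* At speed n the first row deviates at size of order 1, so r = 1 and the factor 1 / sqrt n
     belongs entirely to the radius. *)
  refine (radial_ldp k_gt0 q_gt0 X_random A_random A_haar XA_indep (s := s)
    (r := fun=> 1) (alpha := fun n => (Num.sqrt n%:R)^-1) (kappa := @cost_A R)
    (psi := fun b => 1 - expR (- (2 * b))) s_oo _ _ _ cost_A0 (@cost_A_ge0 R)
    (@cost_A_gt R) (@cost_A_lt R) _ _ _ Rad_ldp (D := [set c | 0 < c < 1])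
    (I := rate_AX_A JX (k := k)) _ _ _ _).
  + by move=> n _; exact: ltr01.
  + by move=> n _; rewrite invr_ge0 sqrtr_ge0.
  + by move=> n _; rewrite sqrtr1 invr1 mulr1.
  + move=> c b c0 bc; have [c' c'c H] := upper_A k_gt0 A_random A_haar c0 bc.
    exists c'; first exact: c'c.
    apply: filterS2 sE_near H => n -> H.
    by rewrite mulr1; exact: H.
  + move=> th c c' a th1 c0 cc' ca.
    have H := lower_A k_gt0 A_random A_haar th1 c0 cc' ca.
    apply: filterS2 sE_near H => n -> H.
    by rewrite !mulr1; exact: H.
  + by move=> n w; rewrite qnorm2E mulrC.
  + by move=> c /andP[].
  + by move=> c c0; rewrite /cost_A; case: (ltP c 1) => // c1 _; rewrite /= c0 c1.
  + by rewrite /rate_AX_A eqxx.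
  + move=> z /negbTE z0; rewrite /rate_AX_A z0; congr ereal_inf.
    by apply: eq_imagel => c /andP[_ c1]; rewrite /cost_A c1 EFinN.
- have n_gt0 n : (k <= n)%N -> 0 < n%:R :> R.
    by move=> kn; rewrite ltr0n; exact: leq_trans kn.
  (* At speed s the first row deviates at size sqrt(s / n); dividing by it leaves exactly the
     normalisation sqrt s / n of the radius. *)
  refine (radial_ldp k_gt0 q_gt0 X_random A_random A_haar XA_indep (s := s)
    (r := fun n => s n / n%:R) (alpha := fun n => Num.sqrt (s n) / n%:R)
    (kappa := @cost_B R) (psi := fun b => 2 * b) s_oo _ _ _ cost_B0
    (fun c _ => cost_B_ge0 c) (fun b c _ => cost_B_gt b c)
    (fun a c _ => cost_B_lt a c) _ _ _ Rad_ldp (D := [set c | 0 < c])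
    (I := rate_AX_B JX (k := k)) _ _ _ _).
  + by move=> n kn; rewrite divr_gt0 ?s_gt0 ?n_gt0.
  + by move=> n kn; rewrite divr_ge0 ?sqrtr_ge0// ltW// n_gt0.
  + move=> n kn; have n0 := n_gt0 n kn; have sn := s_gt0 n kn.
    rewrite sqrtrM ?ltW// sqrtrV ?ltW//.
    have {1}-> : n%:R = Num.sqrt n%:R ^+ 2 :> R by rewrite sqr_sqrtr ?ltW.
    by field; rewrite !gt_eqF ?sqrtr_gt0.
  + exact: upper_B.
  + exact: lower_B.
  + by move=> n w; rewrite qnorm2E mulrAC.
  + by [].
  + by [].
  + by rewrite /rate_AX_B eqxx.
  + by move=> z /negbTE z0; rewrite /rate_AX_B z0.
Qed.
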